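(* Let $p\ge 2$ be an integer, $T>0$, and let $$P(t,x,D_t,D_x)=D_t+a_p(t)D_x^p+\sum_{j=0}^{p-1}a_j(t,x)D_x^j ,\qquad (t,x)\in[0,T]\times\mathbb{R},$$ with $a_p\in C([0,T];\mathbb{R})$, $a_j\in C([0,T];\mathcal{B}^\infty)$ for $0\le j\le p-1$, and suppose that there is a constant $m>0$ such that $|a_p(t)|\ge m$ for all $t\in[0,T]$. If the Cauchy problem $$\begin{cases}P(t,x,D_t,D_x)u(t,x)=f(t,x), & (t,x)\in[0,T]\times\mathbb{R},\\ u(0,x)=g(x), & x\in\mathbb{R},\end{cases}$$ is well-posed in $H^\infty$, then there exist constants $M,N>0$ such that $$\sup_{x\in\mathbb{R}}\ \min_{0\le\tau\le t\le T}\int_{-\varrho}^{\varrho}\operatorname{Im}a_{p-1}\bigl(t,x+p\,a_p(\tau)\theta\bigr)\,d\theta\le M\log(1+\varrho)+N\qquad\text{for all }\varrho>0 .$$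
   Context: $D=\frac1i\partial$. $\mathcal{B}^\infty=\mathcal{B}^\infty(\mathbb{R}_x)$ is the space of complex valued functions which are bounded on $\mathbb{R}$ together with all their derivatives. $H^\infty=\bigcap_{s}H^s(\mathbb{R})$, where $H^s$ is the $L^2$-based Sobolev space with norm $\|\cdot\|_s$. The minimum is over all pairs $(\tau,t)$ with $0\le\tau\le t\le T$. Well-posedness in $H^\infty$ of the Cauchy problem means: for every $f\in C([0,T];H^\infty)$ and $g\in H^\infty$ there is a unique solution $u\in C([0,T];H^\infty)$, with continuous dependence on the data; in particular, there exist $q\in\mathbb{N}\cup\{0\}$ and $C>0$ such that, when $f\equiv 0$, the solution satisfies $\|u(t,\cdot)\|_0\le C\|g\|_q$ for all $t\in[0,T]$ and all $g\in H^\infty$. *)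

(* Defs.v *)
From HB Require Import structures.
From mathcomp Require Import all_boot all_order all_algebra.
From mathcomp Require Import all_classical all_reals all_analysis.
From mathcomp Require Import complex.
Import Order.TTheory GRing.Theory Num.Theory.
Import numFieldNormedType.Exports.

Set Implicit Arguments.
Unset Strict Implicit.
Unset Printing Implicit Defensive.

Local Open Scope ring_scope.
Local Open Scope complex_scope.
Local Open Scope classical_set_scope.

(* [normc] is the real-valued modulus of a complex number; the notation [`|z|]
   on [R[i]] would instead take its values in [R[i]]. *)
Notation normc := ComplexField.Normc.normc.

Section Spaces.
Variable R : realType.

Local Notation mu := (@lebesgue_measure R).

Definition smooth (f : R -> R) : Prop :=
  forall n x, derivable (f^`(n)) x 1.

Definition test_function (phi : R -> R) : Prop :=
  smooth phi /\ compact (closure [set x | phi x != 0]).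

Definition cderiv (n : nat) (b : R -> R[i]) (x : R) : R[i] :=
  ((fun y => complex.Re (b y))^`(n) x) +i* ((fun y => complex.Im (b y))^`(n) x).

(* The Frechet space B^oo, with the seminorms sup |b^(n)|. The real [sup] is
   only meaningful on bounded sets, that is, for [b] in [Binf]. *)
Definition Binf : set (R -> R[i]) := [set b |
  [/\ smooth (fun x => complex.Re (b x)),
      smooth (fun x => complex.Im (b x)) &
      forall n, exists M : R, forall x, normc (cderiv n b x) <= M]].

Definition Bnorm (n : nat) (b : R -> R[i]) : R :=
  sup (range (fun x => normc (cderiv n b x))).

(* Elements of L^2 and H^oo are represented by (Borel measurable) functions;
   as elements of these spaces they are compared almost everywhere. *)
Definition L2 : set (R -> R[i]) := [set u |
  ((fun x => complex.Re (u x)) \in Lfun mu 2%:E) /\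
  ((fun x => complex.Im (u x)) \in Lfun mu 2%:E)].

Definition L2norm (u : R -> R[i]) : R :=
  fine ('N[mu]_2%:E[EFin \o (fun x => normc (u x))])%E.

Definition real_weak_deriv (n : nat) (u v : R -> R) : Prop :=
  forall phi, test_function phi ->
    \int[mu]_x (u x * derive1n n phi x) = (-1) ^+ n * \int[mu]_x (v x * phi x).

Definition weak_deriv (n : nat) (u v : R -> R[i]) : Prop :=
  real_weak_deriv n (fun x => complex.Re (u x)) (fun x => complex.Re (v x)) /\
  real_weak_deriv n (fun x => complex.Im (u x)) (fun x => complex.Im (v x)).

(* H^s for an integer s >= 0. *)
Definition Hs (s : nat) : set (R -> R[i]) := [set u |
  L2 u /\ forall j, (j <= s)%N -> exists v, L2 v /\ weak_deriv j u v].

(* The spaces H^s decrease with s, so that the intersection over integers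
   s >= 0 is the intersection over all real s. *)
Definition Hinf : set (R -> R[i]) := [set u | forall s, Hs s u].

(* A representative of the n-th weak derivative (unique up to a null set);
   junk value 0 if there is none in L^2. *)
Definition wderiv (n : nat) (u : R -> R[i]) : R -> R[i] :=
  xget (fun=> 0) [set v | L2 v /\ weak_deriv n u v].

(* Only meaningful on [Hs s]. *)
Definition Hnorm (s : nat) (u : R -> R[i]) : R :=
  Num.sqrt (\sum_(j < s.+1) L2norm (wderiv j u) ^+ 2).

(* D_x^n with D_x = (1/i) d/dx, in the sense of weak derivatives. *)
Definition Dx (n : nat) (u : R -> R[i]) (x : R) : R[i] :=
  'i%C ^- n * wderiv n u x.

(* C([0,T]; E) for the space E topologized by the seminorms [N 0], [N 1], ...;
   the values of [u] outside [0,T] are irrelevant. *)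
Definition C0T (T : R) (E : set (R -> R[i])) (N : nat -> (R -> R[i]) -> R) :
    set (R -> R -> R[i]) := [set u |
  (forall t : R, 0 <= t <= T -> E (u t)) /\
  (forall (n : nat) (t : R), 0 <= t <= T ->
    N n (fun x => u t' x - u t x) @[t' --> within `[0, T] (nbhs t)] --> (0 : R))].

(* [w] is D_t u at time [t], D_t = (1/i) d/dt: the difference quotients within
   [0,T] converge to it in H^oo (one-sided at the end points). *)
Definition is_Dt (T : R) (u : R -> R -> R[i]) (t : R) (w : R -> R[i]) : Prop :=
  Hinf w /\
  forall s : nat,
    Hnorm s (fun x => 'i%C^-1 * ((t' - t)^-1)%:C * (u t' x - u t x) - w x)
      @[t' --> within `[0, T] t^'] --> (0 : R).

(* u is a solution in C([0,T]; H^oo) of P u = f, u(0) = g, where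
   P = D_t + ap(t) D_x^p + sum_(j < p) a_j(t,x) D_x^j. *)
Definition solution (p : nat) (T : R) (ap : R -> R) (a : nat -> R -> R -> R[i])
    (f : R -> R -> R[i]) (g : R -> R[i]) (u : R -> R -> R[i]) : Prop :=
  [/\ C0T T Hinf Hnorm u,
      forall t : R, 0 <= t <= T -> exists2 w, is_Dt T u t w &
        {ae mu, forall x, w x + (ap t)%:C * Dx p (u t) x
                          + \sum_(j < p) a j t x * Dx j (u t) x = f t x} &
      {ae mu, forall x, u 0 x = g x}].

(* Well-posedness in H^oo: existence, uniqueness, and continuity of the
   solution map C([0,T]; H^oo) x H^oo -> C([0,T]; H^oo), (f, g) |-> u. *)
Definition well_posed (p : nat) (T : R) (ap : R -> R)
    (a : nat -> R -> R -> R[i]) : Prop :=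
  [/\ forall f g, C0T T Hinf Hnorm f -> Hinf g ->
        exists u, solution p T ap a f g u,
      forall f g u v, C0T T Hinf Hnorm f -> Hinf g ->
        solution p T ap a f g u -> solution p T ap a f g v ->
        forall t : R, 0 <= t <= T -> {ae mu, forall x, u t x = v t x} &
      forall f0 g0 u0, C0T T Hinf Hnorm f0 -> Hinf g0 ->
        solution p T ap a f0 g0 u0 ->
        forall (s : nat) (eps : R), 0 < eps ->
        exists (r : nat) (delta : R), 0 < delta /\
          forall f g u, C0T T Hinf Hnorm f -> Hinf g ->
            solution p T ap a f g u ->
            (forall t : R, 0 <= t <= T ->
               Hnorm r (fun x => f t x - f0 t x) <= delta) ->
            Hnorm r (fun x => g x - g0 x) <= delta ->
            forall t : R, 0 <= t <= T ->
              Hnorm s (fun x => u t x - u0 t x) <= eps].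

End Spaces.

(* Main.v *)
Require Import Defs.
From HB Require Import structures.
From mathcomp Require Import all_boot all_order all_algebra.
From mathcomp Require Import all_classical all_reals all_analysis.
From mathcomp Require Import complex.
From mathcomp Require Import measurable_realfun ring lra zify.
Import Order.TTheory GRing.Theory Num.Theory.
Import numFieldNormedType.Exports.
Local Open Scope classical_set_scope.
Local Open Scope ring_scope.

(* It suffices to bound the minimum over the pairs (0, t).  Suppose that for some
   x and some large rho all the integrals with tau = 0 exceed
   Lam ~ M log rho.  Put xi = rho^12.  On times of order rho^2 / xi^(p-1) the
   bicharacteristics X' = p a_p(t) xi^(p-1) sweep the slab of width rho around x,
   and averaging over them yields one ray, on a subinterval of these times, with
   xi^(p-1) * (integral of Im a_(p-1) along the ray) >= (m / max |a_p|) Lam - C.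

   Let u be the solution with zero initial value of P u = f, with f supported near
   the ray at the time s when the factor
   exp(- xi^(p-1) * integral of Im a_(p-1)) of the transposed transport equation
   is largest.  The pairings F_b(t) of u(t) with packets of frequency xi,
   width rho^-4 and profile b moving along the ray satisfy
   F_b' = S_b + F_(A b), where S_b comes from f and A b is smaller
   than b: over the whole time interval A contributes a factor O(rho^-2).
   Iterating this k times, at the final time F_b is bounded below by the
   contribution of f, a negative power rho^-E with E independent of M and k,
   up to an error O(rho^(-2k)).  On the other hand F_b is at most the final value of the
   amplitude, exp(- (m / max |a_p|) Lam + C), times the L^2 norm of u, and
   well-posedness bounds the latter at the cost of powers of xi which are
   included in E.  For M large this is a contradiction. *)

Set Implicit Arguments.
Unset Strict Implicit.
Unset Printing Implicit Defensive.
Local Open Scope complex_scope.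
Local Notation Re := complex.Re.
Local Notation Im := complex.Im.
Local Notation normc0 := ComplexField.Normc.normc0.

Ltac nneg := repeat (first [ assumption | apply: ler01 | apply: ler0n
  | apply: mulr_ge0 | apply: exprn_ge0 | apply: addr_ge0 | rewrite invr_ge0
  | (apply: ltW; assumption) ]).

(** * Complex-valued functions of a real variable *)

Section ComplexNorm.
Variable R : realType.
Implicit Types (z w : R[i]) (x a b : R).

Lemma ReD z w : Re (z + w) = Re z + Re w.
Proof. by case: z w => ? ? []. Qed.
Lemma ImD z w : Im (z + w) = Im z + Im w.
Proof. by case: z w => ? ? []. Qed.
Lemma ReM z w : Re (z * w) =
  Re z * Re w - Im z * Im w.
Proof. by case: z w => ? ? []. Qed.
Lemma ImM z w : Im (z * w) =
  Re z * Im w + Im z * Re w.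
Proof. by case: z w => ? ? []. Qed.
Lemma ReN z : Re (- z) = - Re z.
Proof. by case: z. Qed.
Lemma ImN z : Im (- z) = - Im z.
Proof. by case: z. Qed.

Lemma normc_sqr z : normc z ^+ 2 = Re z ^+ 2 + Im z ^+ 2.
Proof. by case: z => a b /=; rewrite sqr_sqrtr// addr_ge0// sqr_ge0. Qed.

Lemma normc_ge0 z : 0 <= normc z.
Proof. by case: z => a b; exact: sqrtr_ge0. Qed.

Lemma normc_Re z : `|Re z| <= normc z.
Proof.
by rewrite -(@ler_pXn2r _ 2)// ?nnegrE ?normc_ge0// normc_sqr real_normK ?num_real// lerDl sqr_ge0.
Qed.

Lemma normc_Im z : `|Im z| <= normc z.
Proof.
by rewrite -(@ler_pXn2r _ 2)// ?nnegrE ?normc_ge0// normc_sqr real_normK ?num_real// lerDr sqr_ge0.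
Qed.

Lemma normcR x : normc x%:C = `|x|.
Proof. by rewrite /= expr0n addr0 sqrtr_sqr. Qed.

Lemma normcD z w : normc (z + w) <= normc z + normc w.
Proof. exact: le_normcD. Qed.

Lemma normcN z : normc (- z) = normc z.
Proof. exact: complex.normcN. Qed.

Lemma normcM z w : normc (z * w) = normc z * normc w.
Proof. exact: ComplexField.Normc.normcM. Qed.

Lemma normc_i : normc ('i%C : R[i]) = 1.
Proof. by rewrite /= expr0n expr1n add0r sqrtr1. Qed.

Lemma normc_le z : normc z <= `|Re z| + `|Im z|.
Proof.
rewrite [X in normc X]complexE (le_trans (normcD _ _))//.
by rewrite normcM !normcR normc_i mul1r.
Qed.

Lemma normcX z n : normc (z ^+ n) = normc z ^+ n.
Proof.
elim: n => [|n IH]; first by rewrite !expr0 ComplexField.Normc.normc1.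
by rewrite !exprS ComplexField.Normc.normcM IH.
Qed.

Definition cis a : R[i] := cos a +i* sin a.

Lemma normc_cis a : normc (cis a) = 1.
Proof. by rewrite /= cos2Dsin2 sqrtr1. Qed.

End ComplexNorm.

Section ComplexDerivative.
Variable R : realType.
Implicit Types (f g : R -> R[i]) (x : R) (c d : R[i]).

Record is_cder f x d : Prop := IsCder {
  is_cder_Re : is_derive x 1 (fun y => Re (f y)) (Re d);
  is_cder_Im : is_derive x 1 (fun y => Im (f y)) (Im d) }.

Definition cder f x : R[i] :=
  derive1 (fun y => Re (f y)) x +i* derive1 (fun y => Im (f y)) x.

Lemma is_cderE f x d : is_cder f x d -> cder f x = d.
Proof.
move=> [h1 h2]; rewrite /cder !derive1E derive_val derive_val.
by case: d h1 h2.
Qed.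

Lemma is_cder_eq f x d d' : is_cder f x d -> d = d' -> is_cder f x d'.
Proof. by move=> h <-. Qed.

Lemma is_cderD f g x c d : is_cder f x c -> is_cder g x d ->
  is_cder (fun y => f y + g y) x (c + d).
Proof.
move=> [f1 f2] [g1 g2]; split.
- rewrite ReD; under eq_fun do rewrite ReD; exact: (derive.is_deriveD f1 g1).
- rewrite ImD; under eq_fun do rewrite ImD; exact: (derive.is_deriveD f2 g2).
Qed.

Lemma is_cderM f g x c d : is_cder f x c -> is_cder g x d ->
  is_cder (fun y => f y * g y) x (c * g x + f x * d).
Proof.
move=> [f1 f2] [g1 g2]; split.
- under eq_fun do rewrite ReM.
  apply: (is_derive_eq (is_deriveB (is_deriveM f1 g1) (is_deriveM f2 g2))).
  by rewrite /GRing.scale /= ReD !ReM; ring.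
- under eq_fun do rewrite ImM.
  apply: (is_derive_eq (derive.is_deriveD (is_deriveM f1 g2) (is_deriveM f2 g1))).
  by rewrite /GRing.scale /= ImD !ImM; ring.
Qed.

Lemma is_cder_cst c x : is_cder (fun=> c) x 0.
Proof. by split; exact: derive.is_derive_cst. Qed.

Lemma is_cderZ c f x d : is_cder f x d -> is_cder (fun y => c * f y) x (c * d).
Proof.
by move=> /(is_cderM (is_cder_cst c x)) h; apply: (is_cder_eq h); rewrite mul0r add0r.
Qed.

Lemma is_cder_real (f : R -> R) x (a : R) :
  is_derive x 1 f a -> is_cder (fun y => (f y)%:C) x a%:C.
Proof. by move=> h; split => //=; exact: derive.is_derive_cst. Qed.

Lemma is_cder_comp f (g : R -> R) x d (a : R) :
  is_cder f (g x) d -> is_derive x 1 g a -> is_cder (fun y => f (g y)) x (a%:C * d).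
Proof.
move=> [f1 f2] hg; split.
- apply: (is_derive_eq (is_derive1_comp (f := fun y => Re (f y)) f1 hg)).
  by rewrite ReM /=; ring.
- apply: (is_derive_eq (is_derive1_comp (f := fun y => Im (f y)) f2 hg)).
  by rewrite ImM /=; ring.
Qed.

Lemma is_cder_cis x : is_cder (@cis R) x ('i%C * cis x).
Proof.
split; rewrite ?ReM ?ImM /=.
- by apply: (is_derive_eq (is_derive_cos x)); ring.
- by apply: (is_derive_eq (is_derive_sin x)); ring.
Qed.

Definition cdf f := forall x, is_cder f x (cder f x).

Lemma cdf_of f g : (forall x, is_cder f x (g x)) -> cdf f /\ cder f = g.
Proof.
move=> h; have e : cder f = g by apply/funext => x; exact: is_cderE.
by split; first by move=> x; rewrite e.
Qed.

Fixpoint cdn n f : Prop := if n is m.+1 then cdf f /\ cdn m (cder f) else True.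

Definition csmooth f := forall n, cdn n f.

Lemma cdnW n f : cdn n.+1 f -> cdn n f.
Proof. by elim: n f => [//|n IH] f [h1 h2]; split; first exact: h1; exact: IH. Qed.

Lemma cdnD n f g : cdn n f -> cdn n g -> cdn n (fun y => f y + g y).
Proof.
elim: n f g => [//|n IH] f g [f1 f2] [g1 g2].
rewrite /=; have [h ->] := cdf_of (fun x => is_cderD (f1 x) (g1 x)).
by split; [exact: h|exact: IH].
Qed.

Lemma cdnM n f g : cdn n f -> cdn n g -> cdn n (fun y => f y * g y).
Proof.
elim: n f g => [//|n IH] f g [f1 f2] [g1 g2].
rewrite /=; have [h ->] := cdf_of (fun x => is_cderM (f1 x) (g1 x)).
split; first exact: h.
apply: cdnD; apply: IH => //; apply: cdnW; by split.
Qed.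

Lemma cdn_cst n c : cdn n (fun=> c).
Proof.
elim: n c => [//|n IH] c; rewrite /=; have [h ->] := cdf_of (is_cder_cst c).
by split.
Qed.

Lemma cdn_comp_shift n f (a : R) : cdn n f -> cdn n (fun y => f (y + a)).
Proof.
elim: n f => [//|n IH] f [f1 f2].
rewrite /=; have [|h ->] := @cdf_of (fun y => f (y + a)) (fun y => cder f (y + a)).
  move=> x; apply: (is_cder_eq (is_cder_comp (f1 _) (is_derive_shift x 1 a))).
  by rewrite mul1r.
by split; [exact: h|exact: IH].
Qed.

Lemma csmoothD f g : csmooth f -> csmooth g -> csmooth (fun y => f y + g y).
Proof. by move=> hf hg n; exact: cdnD. Qed.
Lemma csmoothM f g : csmooth f -> csmooth g -> csmooth (fun y => f y * g y).
Proof. by move=> hf hg n; exact: cdnM. Qed.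
Lemma csmooth_cst c : csmooth (fun=> c).
Proof. by move=> n; exact: cdn_cst. Qed.
Lemma csmoothZ c f : csmooth f -> csmooth (fun y => c * f y).
Proof. by move=> hf; apply: csmoothM => //; exact: csmooth_cst. Qed.
Lemma csmooth_shift f a : csmooth f -> csmooth (fun y => f (y + a)).
Proof. by move=> hf n; exact: cdn_comp_shift. Qed.
Lemma csmooth_cdf f : csmooth f -> cdf f.
Proof. by move=> /(_ 1) []. Qed.
Lemma csmooth_cder f : csmooth f -> csmooth (cder f).
Proof. by move=> h n; have [] := h n.+1. Qed.
Lemma csmooth_iter n f : csmooth f -> csmooth (iter n cder f).
Proof. by move=> h; elim: n => //= n IH; exact: csmooth_cder. Qed.

Lemma csmooth_sum (I : Type) (s : seq I) (F : I -> R -> R[i]) :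
  (forall i, csmooth (F i)) -> csmooth (fun y => \sum_(i <- s) F i y).
Proof.
move=> h; elim: s => [|i s IH].
  by under eq_fun do rewrite big_nil; exact: csmooth_cst.
by under eq_fun do rewrite big_cons; exact: csmoothD.
Qed.

Lemma cderD f g : cdf f -> cdf g ->
  cder (fun y => f y + g y) = (fun y => cder f y + cder g y).
Proof. by move=> hf hg; have [] := cdf_of (fun x => is_cderD (hf x) (hg x)). Qed.
Lemma cderM f g : cdf f -> cdf g ->
  cder (fun y => f y * g y) = (fun y => cder f y * g y + f y * cder g y).
Proof. by move=> hf hg; have [] := cdf_of (fun x => is_cderM (hf x) (hg x)). Qed.
Lemma cderZ c f : cdf f -> cder (fun y => c * f y) = (fun y => c * cder f y).
Proof. by move=> hf; have [] := cdf_of (fun x => is_cderZ c (hf x)). Qed.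

Lemma cder_shift f a : cdf f -> cder (fun y => f (y + a)) = fun y => cder f (y + a).
Proof.
move=> hf; have [|//] := @cdf_of (fun y => f (y + a)) (fun y => cder f (y + a)).
move=> x; apply: (is_cder_eq (is_cder_comp (hf _) (is_derive_shift x 1 a))).
by rewrite mul1r.
Qed.

Lemma iter_cderE n f : iter n cder f = cderiv n f.
Proof.
rewrite /cderiv; elim: n => [|n IH] /=; first by apply/funext => x; case: (f x).
by rewrite IH.
Qed.

Lemma smooth_csmooth f : smooth (fun x => Re (f x)) ->
  smooth (fun x => Im (f x)) -> csmooth f.
Proof.
move=> h1 h2 n.
have H m : cdf (iter m cder f).
  move=> x; rewrite iter_cderE; split => /=.
  - rewrite derive1E; exact/derivableP/h1.
  - rewrite derive1E; exact/derivableP/h2.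
elim: n f {h1 h2} H => [//|n IH] f H; split; first exact: (H 0).
by apply: IH => m; rewrite -iterSr; exact: H.
Qed.

Lemma csmooth_smooth f : csmooth f ->
  smooth (fun x => Re (f x)) /\ smooth (fun x => Im (f x)).
Proof.
move=> h; split=> n x; have := csmooth_cdf (csmooth_iter n h) x;
  rewrite iter_cderE => -[h1 h2]; exact: ex_derive.
Qed.

Lemma cder_eq0 f (A : set R) : open A -> (forall x, A x -> f x = 0) ->
  forall x, A x -> cder f x = 0.
Proof.
move=> oA h x Ax; apply: is_cderE; split.
- apply: (@near_eq_is_derive _ _ _ (fun=> 0 : R)).
  by apply: filterS (open_nbhs_nbhs (conj oA Ax)) => y /h /= ->.
- apply: (@near_eq_is_derive _ _ _ (fun=> 0 : R)).
  by apply: filterS (open_nbhs_nbhs (conj oA Ax)) => y /h /= ->.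
Qed.

End ComplexDerivative.

Arguments cder {R} f x.

(** * Operators acting on the profile of a packet *)

Section WeightedBounds.
Variable R : realType.
Variables (W w : R).
Hypothesis W0 : 0 <= W.
Implicit Types (f g : R -> R[i]) (x A B : R) (c : R[i]) (n : nat).

(* [cb n B f]: the i-th derivative of [f] is at most [B * W ^+ i] on [-w, w],
   for all [i <= n]. *)
Fixpoint cb n B f : Prop := (forall x, `|x| <= w -> normc (f x) <= B) /\
  (if n is m.+1 then cb m (B * W) (cder f) else True).

Lemma cb0 n B f : cb n B f -> forall x, `|x| <= w -> normc (f x) <= B.
Proof. by case: n => [|n] []. Qed.

Lemma cbW n B f : cb n.+1 B f -> cb n B f.
Proof.
elim: n B f => [|n IH] B f [h1 h2]; split; first exact: h1.
- by [].
- exact: h1.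
- exact: IH.
Qed.

Lemma cb_leq m n B f : (m <= n)%N -> cb n B f -> cb m B f.
Proof.
move=> /subnK <-; elim: (n - m)%N => [//|k IH] h; apply: IH; exact: cbW.
Qed.

Lemma cb_le n A B f : A <= B -> cb n A f -> cb n B f.
Proof.
elim: n A B f => [|n IH] A B f AB [h1 h2]; (split;
  first by move=> x hx; exact: le_trans (h1 x hx) AB) => //.
by apply: IH h2; exact: ler_wpM2r.
Qed.

Lemma cbD n A B f g : csmooth f -> csmooth g -> cb n A f -> cb n B g ->
  cb n (A + B) (fun y => f y + g y).
Proof.
elim: n A B f g => [|n IH] A B f g sf sg [f1 f2] [g1 g2]; split.
- by move=> x hx; rewrite (le_trans (normcD _ _))// lerD ?f1 ?g1.
- by [].
- by move=> x hx; rewrite (le_trans (normcD _ _))// lerD ?f1 ?g1.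
- rewrite cderD ?mulrDl; [|exact: csmooth_cdf|exact: csmooth_cdf].
  by apply: IH => //; exact: csmooth_cder.
Qed.

Lemma cbZ n B f c : csmooth f -> cb n B f -> cb n (normc c * B) (fun y => c * f y).
Proof.
elim: n B f => [|n IH] B f sf [f1 f2]; split.
- by move=> x hx; rewrite normcM ler_wpM2l ?normc_ge0 ?f1.
- by [].
- by move=> x hx; rewrite normcM ler_wpM2l ?normc_ge0 ?f1.
- rewrite cderZ -?mulrA; last exact: csmooth_cdf.
  by apply: IH => //; exact: csmooth_cder.
Qed.

Lemma cb_cst n c : cb n (normc c) (fun=> c).
Proof.
have H m B : 0 <= B -> cb m B (fun=> 0).
  elim: m B => [|m IH] B B0; split.
  - by move=> x _; rewrite normc0.
  - by [].
  - by move=> x _; rewrite normc0.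
  - have [_ ->] := cdf_of (is_cder_cst (0 : R[i])); apply: IH; exact: mulr_ge0.
case: n => [|n]; split=> //.
have [_ ->] := cdf_of (is_cder_cst c); apply: H; rewrite mulr_ge0// normc_ge0 //.
Qed.

Lemma cbM n A B f g : 0 <= A -> 0 <= B -> csmooth f -> csmooth g ->
  cb n A f -> cb n B g -> cb n (2 ^+ n * (A * B)) (fun y => f y * g y).
Proof.
elim: n A B f g => [|n IH] A B f g A0 B0 sf sg hf hg.
  have [f1 _] := hf; have [g1 _] := hg; split=> // x hx.
  by rewrite expr0 mul1r normcM ler_pM ?normc_ge0 ?f1 ?g1.
have [f1 f2] := hf; have [g1 g2] := hg; split=> [x hx|].
  rewrite normcM (@le_trans _ _ (A * B))//.
    by rewrite ler_pM ?normc_ge0 ?f1 ?g1.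
  by rewrite ler_peMl ?mulr_ge0// exprn_ege1// ler1n.
rewrite cderM; [|exact: csmooth_cdf|exact: csmooth_cdf].
have -> : 2 ^+ n.+1 * (A * B) * W =
    2 ^+ n * (A * W * B) + 2 ^+ n * (A * (B * W)) by rewrite exprS; ring.
by apply: cbD; [apply: csmoothM => //; exact: csmooth_cder
  |apply: csmoothM => //; exact: csmooth_cder
  |apply: IH => //; [exact: mulr_ge0|exact: csmooth_cder|exact: cbW]
  |apply: IH => //; [exact: mulr_ge0|exact: csmooth_cder|exact: cbW]].
Qed.

Lemma cb_sum n B (p : nat) (F : nat -> R -> R[i]) :
  (forall j, (j < p)%N -> csmooth (F j) /\ cb n B (F j)) ->
  csmooth (fun y => \sum_(j < p) F j y) /\
  cb n (p%:R * B) (fun y => \sum_(j < p) F j y).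
Proof.
elim: p => [|p IH] h.
  under eq_fun do rewrite big_ord0.
  split; first exact: csmooth_cst.
  by have := cb_cst n (0 : R[i]); rewrite normc0 mul0r.
under eq_fun do rewrite big_ord_recr /=.
have [h1 h2] := IH (fun j hj => h j (ltnW hj)).
have [h3 h4] := h p (leqnn _).
split; first exact: csmoothD.
by rewrite -natr1 mulrDl mul1r; apply: cbD.
Qed.

Definition Jop f y : R[i] := 'i%C * cder f y.
(* Multiplication by e^(-i xi x) conjugates i d/dx, the transpose of D_x, into
   [Qop xi]; [Qrem1 j] and [Qrem2 j] are [Qop xi ^ j] minus the first one,
   respectively two, terms of its expansion in decreasing powers of [xi]. *)
Definition Qop xi f y : R[i] := (xi : R)%:C * f y + Jop f y.

Lemma csmooth_Jop f : csmooth f -> csmooth (Jop f).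
Proof. by move=> h; apply: csmoothZ; exact: csmooth_cder. Qed.

Lemma csmooth_Qop xi f : csmooth f -> csmooth (Qop xi f).
Proof.
by move=> h; apply: csmoothD; [exact: csmoothZ|exact: csmooth_Jop].
Qed.

Lemma csmooth_Qpow xi j f : csmooth f -> csmooth (iter j (Qop xi) f).
Proof. by move=> h; elim: j => [//|j IH]; exact: csmooth_Qop. Qed.

Lemma cb_Jop n B f : csmooth f -> cb n.+1 B f -> cb n (B * W) (Jop f).
Proof.
move=> sf [_ h]; have := cbZ 'i%C (csmooth_cder sf) h.
by rewrite normc_i mul1r.
Qed.

Variable xi : R.
Hypothesis W_gt0 : 0 < W.
Hypothesis Wxi : W <= xi.

Let xi0 : 0 < xi. Proof. exact: lt_le_trans W_gt0 Wxi. Qed.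

Lemma cb_Qop n B f : 0 <= B -> csmooth f -> cb n.+1 B f ->
  cb n (2 * xi * B) (Qop xi f).
Proof.
move=> B0 sf h.
apply: (@cb_le _ (xi * B + B * W)).
  have -> : 2 * xi * B = xi * B + B * xi by ring.
  by rewrite lerD2l ler_wpM2l.
apply: cbD; [exact: csmoothZ|exact: csmooth_Jop| |exact: cb_Jop].
by have := cbZ xi%:C sf (cbW h); rewrite normcR gtr0_norm.
Qed.

Lemma cb_Qpow j n B f : 0 <= B -> csmooth f -> cb (n + j) B f ->
  cb n ((2 * xi) ^+ j * B) (iter j (Qop xi) f).
Proof.
move=> B0 sf; elim: j n => [|j IH] n; first by rewrite addn0 expr0 mul1r.
rewrite -addSnnS => h; rewrite exprS -mulrA iterS.
apply: cb_Qop; [|exact: csmooth_Qpow|exact: IH].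
by nneg.
Qed.

Lemma QopD f g : csmooth f -> csmooth g ->
  Qop xi (fun y => f y + g y) = fun y => Qop xi f y + Qop xi g y.
Proof.
move=> sf sg; apply/funext => y; rewrite /Qop /Jop cderD; try exact: csmooth_cdf.
by ring.
Qed.

Lemma QopZ c f : csmooth f -> Qop xi (fun y => c * f y) = fun y => c * Qop xi f y.
Proof.
move=> sf; apply/funext => y; rewrite /Qop /Jop cderZ; last exact: csmooth_cdf.
by ring.
Qed.

Definition Qrem1 j f y : R[i] := iter j (Qop xi) f y + (- (xi ^+ j)%:C) * f y.

Lemma csmooth_Qrem1 j f : csmooth f -> csmooth (Qrem1 j f).
Proof.
by move=> h; apply: csmoothD; [exact: csmooth_Qpow|exact: csmoothZ].
Qed.

Lemma cb_Qrem1 j n B f : 0 <= B -> csmooth f -> cb (n + j) B f ->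
  cb n (3 ^+ j * xi ^+ j * (W / xi) * B) (Qrem1 j f).
Proof.
move=> B0 sf; elim: j n => [|j IH] n h.
  have -> : Qrem1 0 f = fun=> 0.
    by apply/funext => y; rewrite /Qrem1 /= expr0; ring.
  apply: (@cb_le _ (normc (0 : R[i]))); last exact: cb_cst.
  by rewrite normc0; nneg.
have -> : Qrem1 j.+1 f = fun y => Qop xi (Qrem1 j f) y + (xi ^+ j)%:C * Jop f y.
  apply/funext => y; rewrite /Qrem1 QopD ?QopZ ?iterS//.
  - by rewrite [in Qop xi f y]/Qop exprS rmorphM /=; ring.
  - exact: csmooth_Qpow.
  - exact: csmoothZ.
have h' : cb (n.+1 + j) B f by rewrite addSnnS.
apply: (@cb_le _ (2 * xi * (3 ^+ j * xi ^+ j * (W / xi) * B) + xi ^+ j * (B * W))).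
  have -> : 3 ^+ j.+1 * xi ^+ j.+1 * (W / xi) * B = 3 * 3 ^+ j * (xi ^+ j * (W * B)).
    by rewrite !exprS; field; rewrite gt_eqF.
  have -> : 2 * xi * (3 ^+ j * xi ^+ j * (W / xi) * B) + xi ^+ j * (B * W) =
     (2 * 3 ^+ j + 1) * (xi ^+ j * (W * B)).
    by field; rewrite gt_eqF.
  rewrite ler_wpM2r//; first by nneg.
  by have : 1 <= 3 ^+ j :> R; [rewrite exprn_ege1// ler1n|lra].
apply: cbD.
- exact/csmooth_Qop/csmooth_Qrem1.
- exact/csmoothZ/csmooth_Jop.
- apply: cb_Qop; [|exact: csmooth_Qrem1|exact: IH].
  by nneg.
- have := cbZ (xi ^+ j)%:C (csmooth_Jop sf) (cb_Jop sf (cb_leq _ h')).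
  by rewrite normcR ger0_norm ?exprn_ge0 ?ltW//; apply; rewrite addSn ltnS leq_addr.
Qed.

Definition Qrem2 j f y : R[i] := iter j (Qop xi) f y + (- (xi ^+ j)%:C) * f y
   + (- (j%:R * xi ^+ j / xi)%:C) * Jop f y.

Lemma csmooth_Qrem2 j f : csmooth f -> csmooth (Qrem2 j f).
Proof.
move=> h; apply: csmoothD; last exact/csmoothZ/csmooth_Jop.
exact: csmooth_Qrem1.
Qed.

Lemma cb_Qrem2 j n B f : 0 <= B -> csmooth f -> cb (n + j.+1) B f ->
  cb n (3 ^+ j * xi ^+ j * (W / xi) ^+ 2 * B) (Qrem2 j f).
Proof.
move=> B0 sf; elim: j n => [|j IH] n h.
  have -> : Qrem2 0 f = fun=> 0.
    by apply/funext => y; rewrite /Qrem2 /= expr0 !mul0r rmorph0; ring.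
  apply: (@cb_le _ (normc (0 : R[i]))); last exact: cb_cst.
  by rewrite normc0; nneg.
have -> : Qrem2 j.+1 f = fun y => Qop xi (Qrem2 j f) y +
    (j%:R * xi ^+ j / xi)%:C * Jop (Jop f) y.
  apply/funext => y; rewrite /Qrem2 QopD; [|exact: csmooth_Qrem1|exact/csmoothZ/csmooth_Jop].
  rewrite QopD; [|exact: csmooth_Qpow|exact: csmoothZ].
  rewrite (QopZ _ sf) (QopZ _ (csmooth_Jop sf)) iterS.
  rewrite [in Qop xi f y]/Qop [in Qop xi (Jop f) y]/Qop.
  have -> : (j.+1%:R * xi ^+ j.+1 / xi)%:C = (j%:R * xi ^+ j / xi)%:C * xi%:C + (xi ^+ j)%:C.
    rewrite -rmorphM -rmorphD /=; congr (_%:C).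
    by rewrite exprS -natr1; field; rewrite gt_eqF.
  by rewrite exprS rmorphM /=; ring.
have h' : cb (n.+1 + j.+1) B f by rewrite addSnnS.
apply: (@cb_le _ (2 * xi * (3 ^+ j * xi ^+ j * (W / xi) ^+ 2 * B)
   + (j%:R * xi ^+ j / xi) * (B * W * W))).
  have -> : 3 ^+ j.+1 * xi ^+ j.+1 * (W / xi) ^+ 2 * B =
      3 * 3 ^+ j * (xi ^+ j * (W * W * B) / xi).
    by rewrite !exprS; field; rewrite gt_eqF.
  have -> : 2 * xi * (3 ^+ j * xi ^+ j * (W / xi) ^+ 2 * B)
      + (j%:R * xi ^+ j / xi) * (B * W * W) =
      (2 * 3 ^+ j + j%:R) * (xi ^+ j * (W * W * B) / xi).
    by field; rewrite gt_eqF.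
  rewrite ler_wpM2r//; first by nneg.
  have : (j%:R : R) <= 3 ^+ j by rewrite -natrX ler_nat ltnW// ltn_expl.
  by lra.
apply: cbD.
- exact/csmooth_Qop/csmooth_Qrem2.
- exact/csmoothZ/csmooth_Jop/csmooth_Jop.
- apply: cb_Qop; [|exact: csmooth_Qrem2|exact: IH].
  by nneg.
- have k0 : 0 <= j%:R * xi ^+ j / xi.
    by nneg.
  have hJ : cb n (B * W * W) (Jop (Jop f)).
    apply: cb_Jop; first exact: csmooth_Jop.
    apply: cb_Jop => //; apply: cb_leq h'; lia.
  have := cbZ (j%:R * xi ^+ j / xi)%:C (csmooth_Jop (csmooth_Jop sf)) hJ.
  by rewrite normcR ger0_norm.
Qed.

End WeightedBounds.

Section AmplitudeOperator.
Variable R : realType.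
Implicit Types (f g : R -> R[i]) (x A B : R) (n p : nat).

Lemma le_of_derivative_bound (f df : R -> R) (K : R) :
  (forall x : R, is_derive x 1 f (df x)) -> (forall x, `|df x| <= K) ->
  forall x y, `|f x - f y| <= K * `|x - y|.
Proof.
move=> h1 h2.
have cf : continuous f.
  move=> x; have [h _] := h1 x.
  exact/differentiable_continuous/derivable1_diffP.
have H x y : x < y -> `|f y - f x| <= K * `|y - x|.
  move=> xy; have [|z _ ->] := MVT xy (fun z _ => h1 z).
    exact: continuous_subspaceT.
  by rewrite normrM ler_wpM2r.
move=> x y; case: (ltgtP x y) => [/H|/H //|->].
- by rewrite distrC (distrC y).
- by rewrite !subrr normr0 mulr0.
Qed.

Lemma cder_lipschitz f K : cdf f -> (forall x, normc (cder f x) <= K) ->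
  forall x y, normc (f x - f y) <= 2 * K * `|x - y|.
Proof.
move=> h1 h2 x y; apply: (le_trans (normc_le _)).
rewrite !ReD !ImD !ReN !ImN (_ : 2 * K * _ = K * `|x - y| + K * `|x - y|); last ring.
rewrite lerD//.
- apply: (@le_of_derivative_bound (fun y => Re (f y)) (fun y => Re (cder f y))).
  + by move=> z; have [] := h1 z.
  + by move=> z; exact: le_trans (normc_Re _) (h2 z).
- apply: (@le_of_derivative_bound (fun y => Im (f y)) (fun y => Im (cder f y))).
  + by move=> z; have [] := h1 z.
  + by move=> z; exact: le_trans (normc_Im _) (h2 z).
Qed.

Variables (W w xi : R).
Hypotheses (W1 : 1 <= W) (Ww : W * w = 1) (Wxi : W <= xi).

Let W0 : 0 < W. Proof. exact: lt_le_trans ltr01 W1. Qed.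
Let xi0 : 0 < xi. Proof. exact: lt_le_trans W0 Wxi. Qed.
Let w0 : 0 < w. Proof. by rewrite -(pmulr_rgt0 _ W0) Ww. Qed.

Lemma cb_bounded n A f : 0 <= A ->
  (forall i, (i <= n)%N -> forall x, normc (iter i cder f x) <= A) ->
  cb W w n A f.
Proof.
move=> A0; elim: n f => [|n IH] f h; split=> //.
- by move=> x _; exact: (h 0).
- by move=> x _; exact: (h 0).
- apply: (@cb_le _ _ _ _ n A); [exact: ltW|by rewrite ler_peMr|].
  by apply: IH => i hi x; rewrite -iterSr; exact: h.
Qed.

Lemma cb_increment n A f : 0 <= A -> csmooth f ->
  (forall i, (i <= n)%N -> forall x, normc (iter i cder f x) <= A) ->
  (1 <= n)%N ->
  cb W w n (2 * A * w) (fun y => f y + (- f 0)).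
Proof.
move=> A0 sf h n1.
have h0 x : `|x| <= w -> normc (f x - f 0) <= 2 * A * w.
  move=> xw; apply: (le_trans (cder_lipschitz (csmooth_cdf sf) (h 1 n1) x 0)).
  by rewrite subr0 ler_wpM2l// mulr_ge0.
case: n h n1 => // n h _; split => //.
rewrite cderD; [|exact: csmooth_cdf|exact/csmooth_cdf/csmooth_cst].
have [_ ->] := cdf_of (is_cder_cst (- f 0)).
under eq_fun do rewrite addr0.
apply: (@cb_le _ _ _ _ n A); [exact: ltW| |].
  by rewrite -mulrA (mulrC w) Ww mulr1; lra.
by apply: cb_bounded => // i hi x; rewrite -iterSr; exact: h.
Qed.

(* The operator governing the pairing of a solution with a wave packet of
   frequency [xi] and amplitude [b]; [c j] is the j-th coefficient seen from
   the centre of the packet. Its smallness is what makes the packet travel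
   along the bicharacteristic. *)
Definition ampop p (cp : R) (c : nat -> R -> R[i]) (b : R -> R[i]) (y : R) : R[i] :=
  - 'i%C * (cp%:C * Qrem2 xi p b y
    + Qrem1 xi p.-1 (fun y => c p.-1 y * b y) y
    + (xi ^+ p.-1)%:C * ((c p.-1 y + (- c p.-1 0)) * b y)
    + \sum_(j < p.-1) iter j (Qop xi) (fun y => c j y * b y) y).

Lemma ampop_bound p n (B Ca Am cp : R) (c : nat -> R -> R[i]) (b : R -> R[i]) : (1 < p)%N -> 0 <= B -> 0 <= Ca ->
  `|cp| <= Am -> csmooth b -> cb W w (n + p.+1) B b ->
  (forall j, (j < p)%N -> csmooth (c j)) ->
  (forall j, (j < p)%N -> forall i, (i <= n + p.+1)%N -> forall x,
     normc (iter i cder (c j) x) <= Ca) ->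
  csmooth (ampop p cp c b) /\
  cb W w n ((3 ^+ p * Am + 2 ^+ (n + p.+1) * Ca * (3 ^+ p + 2 + p%:R * 2 ^+ p))
     * xi ^+ p.-1 * (W ^+ 2 / xi + w) * B) (ampop p cp c b).
Proof.
move=> p1 B0 Ca0 cpA sb hb sc hc.
have Am0 : 0 <= Am := le_trans (normr_ge0 _) cpA.
have p0 : (p.-1 < p)%N by rewrite prednK// ltnW.
set M := (2 ^+ (n + p.+1) : R).
have M0 : 0 <= M by rewrite exprn_ge0.
have scb j : (j < p)%N -> csmooth (fun y => c j y * b y).
  by move=> jp; apply: csmoothM => //; exact: sc.
have hcb j : (j < p)%N -> cb W w (n + p.+1) (M * (Ca * B)) (fun y => c j y * b y).
  move=> jp; apply: cbM => //; [exact: ltW|exact: sc|].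
  by apply: cb_bounded => //; exact: hc.
have MCB : 0 <= M * (Ca * B) by nneg.
have xip : xi ^+ p = xi ^+ p.-1 * xi by rewrite -[in LHS](prednK (ltnW p1)) exprSr.
have X0 : 0 <= xi ^+ p.-1 by nneg.
have iW : 1 / xi <= W ^+ 2 / xi.
  by rewrite ler_wpM2r ?invr_ge0 ?(ltW xi0)// exprn_ege1.
have iW1 : W / xi <= W ^+ 2 / xi.
  by rewrite ler_wpM2r ?invr_ge0 ?(ltW xi0)// expr2 ler_peMl// ltW.
have D0 : 0 <= W ^+ 2 / xi by nneg.
pose f1 := fun y => cp%:C * Qrem2 xi p b y.
have [s1 b1] : csmooth f1 /\ cb W w n (3 ^+ p * Am * xi ^+ p.-1 * (W ^+ 2 / xi + w) * B) f1.
  have s := csmooth_Qrem2 xi p sb; split; first exact: csmoothZ.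
  have := cbZ cp%:C s (cb_Qrem2 (ltW W0) W0 Wxi B0 sb hb).
  apply: cb_le; first exact: ltW.
  rewrite normcR.
  have -> : 3 ^+ p * Am * xi ^+ p.-1 * (W ^+ 2 / xi + w) * B =
    Am * (3 ^+ p * xi ^+ p.-1 * (W ^+ 2 / xi + w) * B) by ring.
  apply: ler_pM => //; first by nneg.
  rewrite ler_wpM2r// xip.
  have -> : 3 ^+ p * (xi ^+ p.-1 * xi) * (W / xi) ^+ 2 = 3 ^+ p * xi ^+ p.-1 * (W ^+ 2 / xi).
    by field; rewrite gt_eqF.
  by rewrite ler_wpM2l ?lerDl ?(ltW w0)//; nneg.
pose f2 := Qrem1 xi p.-1 (fun y => c p.-1 y * b y).
have [s2 b2] : csmooth f2 /\
   cb W w n (3 ^+ p * xi ^+ p.-1 * (W ^+ 2 / xi + w) * (M * (Ca * B))) f2.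
  split; first exact/csmooth_Qrem1/scb.
  have h : cb W w (n + p.-1) (M * (Ca * B)) (fun y => c p.-1 y * b y).
    by apply: cb_leq (hcb _ p0); rewrite leq_add2l (leq_trans (leq_pred p)).
  apply: cb_le (cb_Qrem1 (ltW W0) W0 Wxi MCB (scb _ p0) h); first exact: ltW.
  rewrite ler_wpM2r//; apply: ler_pM; try by nneg.
    by rewrite ler_wpM2r// ler_eXn2l ?ltr1n// leq_pred.
  by apply: (le_trans iW1); rewrite lerDl ltW.
pose f3 := fun y => (xi ^+ p.-1)%:C * ((c p.-1 y + (- c p.-1 0)) * b y).
have sinc : csmooth (fun y => c p.-1 y + (- c p.-1 0)).
  by apply: csmoothD; [exact: sc|exact: csmooth_cst].
have [s3 b3] : csmooth f3 /\
   cb W w n (2 * xi ^+ p.-1 * (W ^+ 2 / xi + w) * (M * (Ca * B))) f3.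
  split; first by apply: csmoothZ; exact: csmoothM.
  have h : cb W w (n + p.+1) (M * (2 * Ca * w * B)) (fun y => (c p.-1 y + (- c p.-1 0)) * b y).
    apply: cbM => //; [exact: ltW|by nneg|].
    apply: cb_increment => //; [exact: sc|exact: hc|by rewrite addnS].
  have h' := cbZ (xi ^+ p.-1)%:C (csmoothM sinc sb) (cb_leq (leq_addr _ _) h).
  apply: cb_le h'; first exact: ltW.
  rewrite normcR ger0_norm//.
  have -> : xi ^+ p.-1 * (M * (2 * Ca * w * B)) = 2 * xi ^+ p.-1 * w * (M * (Ca * B)) by ring.
  by rewrite ler_wpM2r// ler_wpM2l ?lerDr//; nneg.
pose F j := iter j (Qop xi) (fun y => c j y * b y).
have [s4 b4] : csmooth (fun y => \sum_(j < p.-1) F j y) /\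
   cb W w n (p.-1%:R * (2 ^+ p * xi ^+ p.-1 * (W ^+ 2 / xi + w) * (M * (Ca * B))))
     (fun y => \sum_(j < p.-1) F j y).
  apply: cb_sum; first exact: ltW.
  move=> j jp; have jp' : (j < p)%N by rewrite (leq_trans jp)// leq_pred.
  split; first exact/csmooth_Qpow/scb.
  have h : cb W w (n + j) (M * (Ca * B)) (fun y => c j y * b y).
    by apply: cb_leq (hcb _ jp'); rewrite leq_add2l leqW// ltnW.
  apply: cb_le (cb_Qpow (ltW W0) W0 Wxi MCB (scb _ jp') h); first exact: ltW.
  rewrite ler_wpM2r// exprMn -mulrA; apply: ler_pM; try by nneg.
    by rewrite ler_eXn2l ?ltr1n// ltnW.
  apply: (@le_trans _ _ (xi ^+ p.-1 * (1 / xi))).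
    rewrite mul1r ler_pdivlMr// -exprSr ler_weXn2l// ?(le_trans W1)//.
  by rewrite ler_wpM2l// (le_trans iW)// lerDl ltW.
have sall : csmooth (fun y => f1 y + f2 y + f3 y + \sum_(j < p.-1) F j y).
  by apply: csmoothD => //; apply: csmoothD => //; apply: csmoothD.
split; first exact: csmoothZ sall.
have ball := cbD (csmoothD (csmoothD s1 s2) s3) s4 (cbD (csmoothD s1 s2) s3 (cbD s1 s2 b1 b2) b3) b4.
have := cbZ (- 'i%C) sall ball.
apply: cb_le; first exact: ltW.
rewrite normcN normc_i mul1r.
set E := W ^+ 2 / xi + w.
have E0 : 0 <= E by rewrite addr_ge0// ltW.
have -> : (3 ^+ p * Am + M * Ca * (3 ^+ p + 2 + p%:R * 2 ^+ p)) * xi ^+ p.-1 * E * B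
  = 3 ^+ p * Am * xi ^+ p.-1 * E * B + 3 ^+ p * xi ^+ p.-1 * E * (M * (Ca * B))
   + 2 * xi ^+ p.-1 * E * (M * (Ca * B)) + p%:R * (2 ^+ p * xi ^+ p.-1 * E * (M * (Ca * B))).
  by ring.
rewrite lerD2l ler_wpM2r//; first by nneg.
by rewrite ler_nat leq_pred.
Qed.

End AmplitudeOperator.

(** * The pairing of square-integrable functions *)

Section SquareIntegrable.
Variable R : realType.
Local Notation mu := (@lebesgue_measure R).
Implicit Types (f g : R -> R) (u v z : R -> R[i]).

Lemma normr_poweR2 (r : R) : (`|r%:E| `^ 2)%E = (r ^+ 2)%:E.
Proof.
by rewrite abse_EFin poweR_EFin powR_mulrn// -normrX ger0_norm// sqr_ge0.
Qed.

Lemma Lnorm2E f :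
  ('N[mu]_2%:E[EFin \o f] = (\int[mu]_x (f x ^+ 2)%:E) `^ 2^-1)%E.
Proof.
by rewrite unlock; congr poweR; apply: eq_integral => x _; exact: normr_poweR2.
Qed.

Lemma Lfun2P f : f \in Lfun mu 2%:E <-> measurable_fun setT f /\
  mu.-integrable setT (EFin \o (fun x => f x ^+ 2)).
Proof.
split=> [hf|[mf hf]].
  split; last exact: Lfun2_integrable_sqr.
  by move: hf; rewrite inE => /andP[]; rewrite inE.
rewrite inE; apply/andP; split; rewrite inE //=.
rewrite /finite_norm Lnorm2E; apply: poweR_lty.
exact: integrable_lty hf.
Qed.

Lemma measurable_normc u : measurable_fun setT (fun x => Re (u x)) ->
  measurable_fun setT (fun x => Im (u x)) ->
  measurable_fun setT (fun x => normc (u x)).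
Proof.
move=> h1 h2; rewrite (_ : (fun x => _) =
  @Num.sqrt R \o (fun x => Re (u x) ^+ 2 + Im (u x) ^+ 2)).
  have ms : measurable_fun setT (@Num.sqrt R).
    by apply: continuous_measurable_fun; exact: sqrt_continuous.
  apply: (measurableT_comp ms).
  by apply: measurable_funD; exact: measurable_funX.
by apply/funext => x /=; case: (u x).
Qed.

Lemma L2_normc u : L2 u -> (fun x => normc (u x)) \in Lfun mu 2%:E.
Proof.
move=> [/Lfun2P[m1 i1] /Lfun2P[m2 i2]]; apply/Lfun2P; split.
  exact: measurable_normc.
have -> : EFin \o (fun x => normc (u x) ^+ 2) =
    (fun x => ((Re (u x) ^+ 2)%:E + (Im (u x) ^+ 2)%:E)%E).
  by apply/funext => x /=; rewrite normc_sqr EFinD.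
exact: (integrableD measurableT i1 i2).
Qed.

Lemma L2norm_ge0 u : 0 <= L2norm u.
Proof. by apply: fine_ge0; exact: Lnorm_ge0. Qed.

Lemma L2norm_sqr u : L2 u -> L2norm u ^+ 2 = (\int[mu]_x (normc (u x) ^+ 2))%R.
Proof.
move=> hu; have /Lfun2P[_ h] := L2_normc hu.
rewrite /L2norm Lnorm2E /Rintegral.
have ge0 : (0 <= \int[mu]_x (normc (u x) ^+ 2)%:E)%E.
  by apply: integral_ge0 => x _; rewrite lee_fin sqr_ge0.
have := integrable_fin_num measurableT h => /fineK <-.
by rewrite poweR_EFin /= powR12_sqrt ?fine_ge0// sqr_sqrtr// fine_ge0.
Qed.

Lemma Lfun2D f g : f \in Lfun mu 2%:E -> g \in Lfun mu 2%:E ->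
  (fun x => f x + g x) \in Lfun mu 2%:E.
Proof.
have [_ h] := @Lfun_addr_closed _ _ _ mu 2%:E (lee1n 2); move=> hf hg; exact: h.
Qed.

Lemma Lfun2Z f (a : R) : f \in Lfun mu 2%:E -> (fun x => a * f x) \in Lfun mu 2%:E.
Proof.
by move=> /(Lfun_scale a) h; under eq_fun do rewrite mulrC; apply: h; rewrite ler1n.
Qed.

Lemma L2D u v : L2 u -> L2 v -> L2 (fun x => u x + v x).
Proof.
move=> [u1 u2] [v1 v2]; split.
- by under eq_fun do rewrite ReD; exact: Lfun2D.
- by under eq_fun do rewrite ImD; exact: Lfun2D.
Qed.

Lemma L2Z (c : R[i]) u : L2 u -> L2 (fun x => c * u x).
Proof.
move=> [u1 u2]; split.
- under eq_fun do rewrite ReM -mulNr; apply: Lfun2D; exact: Lfun2Z.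
- under eq_fun do rewrite ImM; apply: Lfun2D; exact: Lfun2Z.
Qed.

Lemma L2B u v : L2 u -> L2 v -> L2 (fun x => u x - v x).
Proof.
by move=> hu /(L2Z (-1)) /(L2D hu); under eq_fun do rewrite mulN1r.
Qed.

Lemma L2_normc_mul_integrable u v : L2 u -> L2 v ->
  mu.-integrable setT (EFin \o (fun x => normc (u x) * normc (v x))).
Proof.
by move=> hu hv; apply/Lfun1_integrable; apply: Lfun2_mul_Lfun1; exact: L2_normc.
Qed.

Lemma L2_measurable u : L2 u -> measurable_fun setT (fun x => Re (u x)) /\
  measurable_fun setT (fun x => Im (u x)).
Proof. by move=> [/Lfun2P[? _] /Lfun2P[? _]]. Qed.

(* Bilinear rather than sesquilinear, so that the transposed operators, without
   complex conjugates, act on the packets. *)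
Definition pr u v : R := (\int[mu]_x (Re (u x * v x)))%R.

Lemma L2_pr_integrable u v : L2 u -> L2 v ->
  mu.-integrable setT (EFin \o (fun x => Re (u x * v x))).
Proof.
move=> hu hv; have [u1 u2] := L2_measurable hu; have [v1 v2] := L2_measurable hv.
apply: (le_integrable measurableT _ _ (L2_normc_mul_integrable hu hv)).
- apply/measurable_EFinP; under eq_fun do rewrite ReM.
  by apply: measurable_funB; exact: measurable_funM.
- move=> x _ /=; rewrite lee_fin -normcM (le_trans (normc_Re _))//.
  exact: ler_norm.
Qed.

Lemma pr_bound u v : L2 u -> L2 v -> `|pr u v| <= L2norm u * L2norm v.
Proof.
move=> hu hv.
have hi := L2_normc_mul_integrable hu hv.
apply: (@le_trans _ _ (\int[mu]_x (normc (u x) * normc (v x)))%R).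
  apply: (le_trans (le_normr_Rintegral measurableT (L2_pr_integrable hu hv))).
  apply: le_Rintegral => //.
  - by have /integrable_norm := L2_pr_integrable hu hv.
  - by move=> x _ /=; rewrite -normcM normc_Re.
have [u1 u2] := L2_measurable hu; have [v1 v2] := L2_measurable hv.
have hold := @hoelder _ _ _ mu (fun x => normc (u x)) (fun x => normc (v x)) 2 2
   (measurable_normc u1 u2) (measurable_normc v1 v2) ltac:(by []) ltac:(by [])
   ltac:(by rewrite [RHS]splitr !div1r).
have fin z : L2 z -> ('N[mu]_2%:E[EFin \o (fun x => normc (z x))])%E \is a fin_num.
  move=> /L2_normc; rewrite inE => /andP[_]; rewrite inE /finite_norm => h.
  by rewrite ge0_fin_numE// Lnorm_ge0.
rewrite /L2norm -lee_fin EFinM !fineK ?fin//; last exact: integrable_fin_num.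
apply: le_trans hold; rewrite Lnorm1 /Rintegral.
apply: ge0_le_integral => //.
- by move=> x _; rewrite lee_fin mulr_ge0// normc_ge0.
- by case/integrableP : hi.
- by apply: measurableT_comp => //; case/integrableP : hi.
- by move=> x _ /=; rewrite lee_fin ler_norm.
Qed.

Lemma prDl u1 u2 v : L2 u1 -> L2 u2 -> L2 v ->
  pr (fun x => u1 x + u2 x) v = pr u1 v + pr u2 v.
Proof.
move=> h1 h2 hv; rewrite /pr -RintegralD//; try exact: L2_pr_integrable.
by apply: eq_Rintegral => x _; rewrite mulrDl ReD.
Qed.

Lemma prBl u1 u2 v : L2 u1 -> L2 u2 -> L2 v ->
  pr (fun x => u1 x - u2 x) v = pr u1 v - pr u2 v.
Proof.
move=> h1 h2 hv; apply/eqP; rewrite eq_sym subr_eq -prDl//; last exact: L2B.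
by apply/eqP; congr pr; apply/funext => x; rewrite subrK.
Qed.

Lemma prDr u v1 v2 : L2 u -> L2 v1 -> L2 v2 ->
  pr u (fun x => v1 x + v2 x) = pr u v1 + pr u v2.
Proof.
move=> h1 h2 hv; rewrite /pr -RintegralD//; try exact: L2_pr_integrable.
by apply: eq_Rintegral => x _; rewrite mulrDr ReD.
Qed.

Lemma prA (c : R[i]) u v : pr (fun x => c * u x) v = pr u (fun x => c * v x).
Proof. by apply: eq_Rintegral => x _; congr Re; rewrite mulrCA mulrA. Qed.

Lemma pr_ae u1 u2 v : L2 u1 -> L2 u2 -> L2 v -> {ae mu, forall x, u1 x = u2 x} ->
  pr u1 v = pr u2 v.
Proof.
move=> h1 h2 hv e; rewrite /pr /Rintegral; congr fine.
apply: ae_eq_integral => //.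
- by case/integrableP: (L2_pr_integrable h1 hv).
- by case/integrableP: (L2_pr_integrable h2 hv).
- apply: filterS e; first exact: (ae_filter_ringOfSetsType mu).
  by move=> x /= -> _.
Qed.

End SquareIntegrable.

(** * Test functions and weak derivatives *)

Section AffineComposition.
Variable R : realType.
Implicit Types (f g : R -> R[i]) (x a b : R).

Lemma is_derive_affine a b x : is_derive x 1 (fun y : R => a * y + b) a.
Proof.
apply: (is_derive_eq (is_deriveD (is_deriveZ a (is_derive_id x (1 : R))) (is_derive_cst b x 1))).
by rewrite addr0 /GRing.scale /= mulr1.
Qed.

Lemma continuous_line a b : continuous (fun y : R => b + a * y).
Proof.
move=> y; apply: cvgD; first exact: cvg_cst.
by apply: cvgM; [exact: cvg_cst|exact: cvg_id].
Qed.

Lemma is_cder_affine f a b x : cdf f ->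
  is_cder (fun y => f (a * y + b)) x (a%:C * cder f (a * x + b)).
Proof. by move=> h; apply: is_cder_comp; [exact: h|exact: is_derive_affine]. Qed.

Lemma cder_affine f a b : cdf f ->
  cder (fun y => f (a * y + b)) = fun y => a%:C * cder f (a * y + b).
Proof. by move=> h; have [] := cdf_of (fun x => is_cder_affine a b x h). Qed.

Lemma csmooth_affine f a b : csmooth f -> csmooth (fun y => f (a * y + b)).
Proof.
move=> sf n; elim: n f sf => [//|n IH] f sf; split.
  by have [] := cdf_of (fun x => is_cder_affine a b x (csmooth_cdf sf)).
rewrite cder_affine; last exact: csmooth_cdf.
apply: cdnM; first exact: cdn_cst.
by apply: IH; exact: csmooth_cder.
Qed.

Lemma csmooth_cis a : csmooth (fun y => cis (a * y)).
Proof.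
have h x : is_cder (fun y => cis (a * y)) x ((a%:C * 'i%C) * cis (a * x)).
  rewrite -mulrA; apply: is_cder_comp; first exact: is_cder_cis.
  by have := is_derive_affine a 0 x; under eq_fun do rewrite addr0.
have [h1 h2] := cdf_of h.
elim=> [//|n IH]; split; first exact: h1.
by rewrite h2; apply: cdnM => //; exact: cdn_cst.
Qed.

End AffineComposition.

Section Bump.
Variable R : realType.
Implicit Types (x y : R) (k n : nat).

Lemma is_derive_sqr_bound (f : R -> R) x (C : R) :
  (forall y, `|f y - f x| <= C * (y - x) ^+ 2) -> is_derive x 1 f 0.
Proof.
move=> h; apply/is_derive1_caratheodory.
exists (fun y => if y == x then 0 else (f y - f x) / (y - x)); split.
- move=> y; case: eqP => [->|/eqP yx]; first by rewrite !subrr mulr0.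
  by rewrite divfK// subr_eq0.
- have C0 : 0 <= C by have := h (x + 1); rewrite addrAC subrr add0r expr1n mulr1; apply: le_trans.
  apply/cvgrPdist_le => e e0; rewrite eqxx.
  near=> y; rewrite sub0r normrN; case: eqP => [_|/eqP yx]; first by rewrite normr0 ltW.
  rewrite normrM normfV ler_pdivrMr ?normr_gt0 ?subr_eq0//.
  apply: (le_trans (h y)); rewrite -real_normK ?num_real// expr2 mulrA ler_wpM2r//.
  apply: (@le_trans _ _ ((C + 1) * `|y - x|)); first by rewrite ler_wpM2r// lerDl.
  rewrite mulrC -ler_pdivlMr ?ltr_wpDl//.
  near: y; apply/nbhs_ballP; exists (e / (C + 1)) => /=.
    by rewrite divr_gt0// ltr_wpDl.
  by move=> y; rewrite /ball /= distrC => /ltW.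
- by rewrite eqxx.
Unshelve. all: by end_near. Qed.

(* The derivatives of [flat k] are combinations of the [flat j]. *)
Definition flat k x : R := if 0 < x then x ^- k * expR (- x^-1) else 0.

Lemma flat_le0 k x : x <= 0 -> flat k x = 0.
Proof. by rewrite /flat leNgt => /negbTE ->. Qed.

Lemma flat_ge0 k x : 0 <= flat k x.
Proof.
by rewrite /flat; case: ifPn => // x0; rewrite mulr_ge0 ?expR_ge0// invr_ge0 exprn_ge0// ltW.
Qed.

Lemma flat_le_sqr k x : flat k x <= (k.+2)`!%:R * x ^+ 2.
Proof.
rewrite /flat; case: ifPn => [x0|_]; last by rewrite mulr_ge0// sqr_ge0.
rewrite expRN mulrC -ler_pdivlMr ?invr_gt0 ?exprn_gt0// invrK.
rewrite invf_ple ?posrE ?expR_gt0 ?mulr_gt0 ?exprn_gt0 ?ltr0n ?fact_gt0//.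
apply: le_trans (@expR_ge1Dxn R x^-1 k.+1 _); last by rewrite invr_ge0 ltW.
rewrite ler_wpDl//.
by rewrite -mulrA -exprD add2n invfM exprVn mulrC.
Qed.

Lemma is_derive_flat k x :
  is_derive x 1 (flat k) (- k%:R * flat k.+1 x + flat k.+2 x).
Proof.
have [x0|x0|->] := ltgtP x 0.
- rewrite !flat_le0 ?(ltW x0)// mulr0 addr0.
  apply: (@near_eq_is_derive _ _ _ (fun=> 0 : R)).
  by near=> y; rewrite flat_le0//; apply: ltW; near: y; exact: lt_nbhsl.
- apply: (@near_eq_is_derive _ _ _ (fun y => y ^- k * expR (- y^-1))).
    near=> y; rewrite /flat ifT//; near: y; exact: lt_nbhsr.
  have xn : x != 0 by rewrite gt_eqF.
  have dk : is_derive x 1 (fun y : R => y ^- k) (- k%:R * x ^- k.+1).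
    have hX : is_derive x 1 (fun y : R => y ^+ k) (k%:R * x ^+ k.-1).
      split; first exact: exprn_derivable.
      by rewrite exp_derive /GRing.scale /= mulr1.
    apply: (is_derive_eq (@is_deriveV R (fun y => y ^+ k) x _ 1 (expf_neq0 k xn) hX)).
    rewrite /GRing.scale /=; case: k hX => [|k] _; first by rewrite !mul0r oppr0 mul0r mulr0.
    by rewrite /= !exprS; field; rewrite xn expf_neq0.
  have dv : is_derive x 1 (fun y : R => - y^-1) (x ^- 2).
    apply: (is_derive_eq (is_deriveN (@is_deriveV R id x 1 1 xn (is_derive_id x (1 : R))))).
    by rewrite /GRing.scale /= mulr1 opprK.
  have de := is_derive1_comp (is_derive_expR _) dv.
  apply: (is_derive_eq (is_deriveM dk de)).
  rewrite /flat x0 /GRing.scale /= !exprS expr0 mulr1.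
  by field; rewrite xn expf_neq0.
- apply: (@is_derive_eq _ _ _ _ _ _ _ 0); last by rewrite !flat_le0// mulr0 addr0.
  apply: (@is_derive_sqr_bound _ _ (k.+2)`!%:R) => y.
  by rewrite (@flat_le0 k 0)// !subr0 ger0_norm ?flat_ge0// flat_le_sqr.
Unshelve. all: by end_near. Qed.

Lemma csmooth_flat k : csmooth (fun x => (flat k x)%:C).
Proof.
move=> n; elim: n k => [//|n IH] k.
have h x : is_cder (fun x => (flat k x)%:C) x
   ((- k%:R)%:C * (flat k.+1 x)%:C + (flat k.+2 x)%:C).
  by rewrite -rmorphM -rmorphD /=; apply: is_cder_real; exact: is_derive_flat.
have [h1 h2] := cdf_of h; split; first exact: h1.
rewrite h2; apply: cdnD; last exact: IH.
by apply: cdnM; [exact: cdn_cst|exact: IH].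
Qed.

Definition bump x : R := flat 0 (1 - x) * flat 0 (1 + x).

Lemma bump_eq0 x : 1 <= `|x| -> bump x = 0.
Proof.
rewrite /bump ler_normr => /orP[h|h].
- by rewrite flat_le0 ?mul0r// subr_le0.
- by rewrite (@flat_le0 _ (1 + x)) ?mulr0//; lra.
Qed.

Lemma csmooth_bump : csmooth (fun x => (bump x)%:C).
Proof.
have -> : (fun x => (bump x)%:C) =
  (fun x => (flat 0 ((-1) * x + 1))%:C * (flat 0 (1 * x + 1))%:C).
  apply/funext => x; rewrite -rmorphM /=; congr (_%:C).
  by rewrite /bump mulN1r mul1r [- x + 1]addrC [x + 1]addrC.
apply: csmoothM.
- exact: (csmooth_affine (-1) 1 (csmooth_flat 0)).
- exact: (csmooth_affine 1 1 (csmooth_flat 0)).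
Qed.

End Bump.

Section TestFunctions.
Variable R : realType.
Local Notation mu := (@lebesgue_measure R).
Implicit Types (f g : R -> R) (u v z : R -> R[i]) (x r : R).

Definition ctest z := csmooth z /\ exists r, forall x, r < `|x| -> z x = 0.

Lemma csmooth_continuous z : csmooth z ->
  continuous (fun x => Re (z x)) /\ continuous (fun x => Im (z x)).
Proof.
move=> h; split=> x; have [[h1 _] [h2 _]] := csmooth_cdf h x;
  exact/differentiable_continuous/derivable1_diffP.
Qed.

Lemma open_far r : open [set x : R | r < `|x|].
Proof.
have -> : [set x : R | r < `|x|] = [set x | r < x] `|` [set x | x < - r].
  apply/seteqP; split=> x /=; rewrite lter_normr.
  - by move=> /orP[?|?]; [left|right; rewrite ltrNr].
  - by move=> [->//|]; rewrite ltrNr => ->; rewrite orbT.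
by apply: openU; [exact: open_gt|exact: open_lt].
Qed.

Lemma ctest_cder z : ctest z -> ctest (cder z).
Proof.
move=> [sz [r hr]]; split; first exact: csmooth_cder.
exists r => x xr; exact: (cder_eq0 (@open_far r) hr).
Qed.

Lemma ctest_iter n z : ctest z -> ctest (iter n cder z).
Proof. by move=> h; elim: n => [//|n IH]; exact: ctest_cder. Qed.

Lemma ctestM a z : csmooth a -> ctest z -> ctest (fun x => a x * z x).
Proof.
move=> sa [sz [r hr]]; split; first exact: csmoothM.
by exists r => x /hr ->; rewrite mulr0.
Qed.

Lemma ctestZ c z : ctest z -> ctest (fun x => c * z x).
Proof. by apply: ctestM; exact: csmooth_cst. Qed.

Lemma compact_support f r : (forall x, r < `|x| -> f x = 0) ->
  compact (closure [set x | f x != 0]).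
Proof.
move=> h; apply: (subclosed_compact (@closed_closure _ _) (@segment_compact _ (-r) r)).
rewrite closureEbigcap => x; apply; split.
  exact: itv_closed.
by move=> y /= fy; rewrite in_itv /= -ler_norml leNgt; apply: contra fy => /h ->.
Qed.

Lemma ctest_test_function z : ctest z ->
  test_function (fun x => Re (z x)) /\ test_function (fun x => Im (z x)).
Proof.
move=> [sz [r hr]]; have [s1 s2] := csmooth_smooth sz.
split; (split; first by []); by apply: (@compact_support _ r) => x /hr ->.
Qed.

Lemma Rintegral_support f a b : (forall x, ~ (a <= x <= b) -> f x = 0) ->
  (\int[mu]_x f x)%R = (\int[mu]_(x in `[a, b]) f x)%R.
Proof.
move=> h; rewrite [RHS]Rintegral_mkcond; congr Rintegral.
apply/funext => x; rewrite patchE; case: ifPn => //.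
by rewrite notin_setE /= in_itv /= => /h.
Qed.

Lemma continuous_integrable f a b : continuous f -> mu.-integrable `[a, b] (EFin \o f).
Proof.
move=> cf; apply: continuous_compact_integrable; first exact: segment_compact.
exact: continuous_subspaceT.
Qed.

Lemma cst_integrable a b c : mu.-integrable `[a, b] (EFin \o (fun=> c : R)).
Proof. by apply: continuous_integrable => x; exact: cvg_cst. Qed.

Lemma Rintegral_cst_itv a b c : a <= b -> (\int[mu]_(x in `[a, b]) c)%R = c * (b - a).
Proof.
move=> ab; rewrite Rintegral_cst; last exact: measurable_itv.
have e := @lebesgue_measure_itv R `[a, b]%R; rewrite [X in fine X]e /= lte_fin.
case: ltP => //= ba; have -> : b = a by apply/eqP; rewrite eq_le ba.
by rewrite subrr.
Qed.

Lemma integrable_support f a b : continuous f -> (forall x, ~ (a <= x <= b) -> f x = 0) ->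
  mu.-integrable setT (EFin \o f).
Proof.
move=> cf h.
have -> : EFin \o f = (EFin \o f) \_ `[a, b].
  apply/funext => x; rewrite patchE; case: ifPn => //.
  by rewrite notin_setE /= in_itv /= => /h ->.
apply/(integrable_restrict _ _ (@measurableT _ _)) => //.
rewrite setTI; exact: continuous_integrable.
Qed.

Lemma continuous_Lfun2 f a b : continuous f -> (forall x, ~ (a <= x <= b) -> f x = 0) ->
  f \in Lfun mu 2%:E.
Proof.
move=> cf h; apply/Lfun2P; split; first exact: continuous_measurable_fun.
apply: (@integrable_support _ a b).
- by move=> x; apply: continuousM; exact: cf.
- by move=> x /h ->; rewrite expr0n.
Qed.

Lemma far_itv z r : (forall x, r < `|x| -> z x = 0) ->
  forall x, ~ (- r <= x <= r) -> z x = 0.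
Proof. by move=> h x; rewrite -ler_norml => /negP; rewrite -ltNge => /h. Qed.

Lemma ctest_L2 z : ctest z -> L2 z.
Proof.
move=> [sz [r hr]]; have [c1 c2] := csmooth_continuous sz.
by split; apply: (@continuous_Lfun2 _ (-r) r) => // x /(far_itv hr) ->.
Qed.

Lemma L2norm_le_support z (c w B : R) : L2 z -> 0 <= B -> 0 <= w ->
  (forall x, w < `|x - c| -> z x = 0) -> (forall x, normc (z x) <= B) ->
  L2norm z ^+ 2 <= B ^+ 2 * (2 * w).
Proof.
move=> hz B0 w0 hs hB; rewrite L2norm_sqr//.
have hs' x : ~ (c - w <= x <= c + w) -> normc (z x) ^+ 2 = 0.
  move=> h; rewrite hs ?normc0 ?expr0n// ltNge.
  by apply/negP; rewrite ler_distl => h'; apply: h.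
rewrite (Rintegral_support hs').
have -> : B ^+ 2 * (2 * w) = (\int[mu]_(x in `[(c - w), (c + w)]) (B ^+ 2))%R.
  by rewrite Rintegral_cst_itv; [congr (_ * _); ring|lra].
apply: le_Rintegral => //.
- have /Lfun2P[_ h] := L2_normc hz.
  exact: (integrableS measurableT _ (@subsetT _ _)).
- exact: cst_integrable.
- by move=> x _; rewrite ler_pXn2r// nnegrE normc_ge0.
Qed.

End TestFunctions.

Section WeakDerivatives.
Variable R : realType.
Local Notation mu := (@lebesgue_measure R).
Implicit Types (f g : R -> R) (u v z : R -> R[i]) (x r : R).

Lemma derivable_continuous f : (forall x, derivable f x 1) -> continuous f.
Proof. by move=> h x; exact/differentiable_continuous/derivable1_diffP. Qed.

Lemma by_parts f g r : (forall x, derivable f x 1) -> continuous (derive1 f) ->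
  (forall x, derivable g x 1) -> continuous (derive1 g) ->
  (forall x, r < `|x| -> f x = 0) -> (forall x, r < `|x| -> derive1 f x = 0) ->
  (\int[mu]_x (f x * derive1 g x))%R = - (\int[mu]_x (derive1 f x * g x))%R.
Proof.
move=> df cf dg cg hf hf'.
have r1 : r < `|r| + 1 by rewrite (le_lt_trans (ler_norm r))// ltrDl.
have sup h : (forall x, r < `|x| -> h x = 0) -> forall k : R -> R,
    forall x, ~ (- (`|r| + 1) <= x <= `|r| + 1) -> h x * k x = 0.
  move=> hh k x; rewrite -ler_norml => /negP; rewrite -ltNge => hx.
  by rewrite hh ?mul0r// (lt_trans r1).
rewrite (Rintegral_support (sup _ hf _)) (Rintegral_support (sup _ hf' _)).
have LR (k : R -> R) : (forall x, derivable k x 1) ->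
    derivable_oo_LRcontinuous k (- (`|r| + 1)) (`|r| + 1).
  move=> dk; have ck := derivable_continuous dk.
  by split; [move=> x _; exact: dk|exact/cvg_at_right_filter/ck|exact/cvg_at_left_filter/ck].
have h0 : 0 < `|r| + 1 by rewrite ltr_wpDl.
have ab : - (`|r| + 1) < `|r| + 1 by rewrite (lt_trans _ h0)// oppr_lt0.
rewrite (@Rintegration_by_parts _ f g (derive1 f) (derive1 g) _ _ ab
  (continuous_subspaceT cf) (LR _ df) (fun x _ => erefl)
  (continuous_subspaceT cg) (LR _ dg) (fun x _ => erefl)).
rewrite (hf (`|r| + 1)); last by rewrite (gtr0_norm h0).
rewrite (hf (- (`|r| + 1))); last by rewrite normrN (gtr0_norm h0).
by rewrite !mul0r subr0 sub0r.
Qed.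

Lemma ctest_by_parts n z (phi : R -> R) : ctest z -> smooth phi ->
  (\int[mu]_x (Re (z x) * derive1n n phi x) =
     (-1) ^+ n * \int[mu]_x (Re (iter n cder z x) * phi x) /\
   \int[mu]_x (Im (z x) * derive1n n phi x) =
     (-1) ^+ n * \int[mu]_x (Im (iter n cder z x) * phi x))%R.
Proof.
move=> hz sphi; elim: n z hz => [|n IH] z hz; first by rewrite expr0 !mul1r.
have [h1 h2] := IH _ (ctest_cder hz).
rewrite iterSr !exprS !mulN1r !mulNr -h1 -h2.
have [sz [r hr]] := hz; have [sz' _] := ctest_cder hz.
have [c1 c2] := csmooth_continuous sz'.
have cphi : continuous (derive1n n.+1 phi) by apply: derivable_continuous => x; exact: sphi.
have hr' := cder_eq0 (@open_far _ r) hr.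
have dphi : forall x, derivable (derive1n n phi) x 1 by exact: sphi.
split.
- apply: (@by_parts (fun x => Re (z x)) _ r _ c1 dphi cphi).
  + by move=> x; have [[]] := csmooth_cdf sz x.
  + by move=> x /hr ->.
  + by move=> x /hr' /(congr1 (@complex.Re R)).
- apply: (@by_parts (fun x => Im (z x)) _ r _ c2 dphi cphi).
  + by move=> x; have [_ []] := csmooth_cdf sz x.
  + by move=> x /hr ->.
  + by move=> x /hr' /(congr1 (@complex.Im R)).
Qed.

Lemma ctest_weak_deriv n z : ctest z -> weak_deriv n z (iter n cder z).
Proof. by move=> hz; split=> phi [sphi _]; have [] := ctest_by_parts n hz sphi. Qed.

Lemma prE u v : L2 u -> L2 v -> pr u v =
  (\int[mu]_x (Re (u x) * Re (v x)) -
   \int[mu]_x (Im (u x) * Im (v x)))%R.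
Proof.
move=> [u1 u2] [v1 v2]; rewrite -RintegralB//.
- by apply: eq_Rintegral => x _; rewrite ReM.
- exact/Lfun1_integrable/Lfun2_mul_Lfun1.
- exact/Lfun1_integrable/Lfun2_mul_Lfun1.
Qed.

Lemma pr_weak_deriv j u v z : L2 u -> L2 v -> weak_deriv j u v -> ctest z ->
  pr v z = (-1) ^+ j * pr u (iter j cder z).
Proof.
move=> hu hv [w1 w2] hz.
rewrite !prE//; [|exact/ctest_L2/ctest_iter|exact: ctest_L2].
have [t1 t2] := ctest_test_function hz.
rewrite iter_cderE /= mulrBr w1// w2// !mulrA -exprMn mulrNN mulr1 expr1n !mul1r.
by [].
Qed.

End WeakDerivatives.

Section Uniqueness.
Variable R : realType.
Local Notation mu := (@lebesgue_measure R).
Implicit Types (f g h : R -> R) (u v z : R -> R[i]) (x r a b : R).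

Lemma indic_Lfun2 a b : (\1_(`[a, b]%classic) : R -> R) \in Lfun mu 2%:E.
Proof.
apply/Lfun2P; split; first exact: measurable_indic.
have -> : EFin \o (fun x => (\1_(`[a, b]%classic) x : R) ^+ 2) = EFin \o \1_(`[a, b]%classic).
  by apply/funext => x /=; rewrite indicE; case: (x \in _); rewrite ?expr1n ?expr0n.
apply: integrable_indic_itv.
Qed.

Lemma Lfun2_integrable_itv h a b : h \in Lfun mu 2%:E ->
  mu.-integrable `[a, b] (EFin \o h).
Proof.
move=> hh; have /Lfun1_integrable H := Lfun2_mul_Lfun1 hh (indic_Lfun2 a b).
have E : EFin \o (h \* \1_(`[a, b]%classic)) = (EFin \o h) \_ `[a, b].
  apply/funext => x; rewrite /= patchE indicE.
  by case: ifPn => _; rewrite ?mulr1 ?mulr0.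
rewrite E in H.
by move/(integrable_restrict _ _ (@measurableT _ _)) : H; rewrite setTI; apply.
Qed.

(* Tends to the indicator function of ]a, b[; it is enough to test against these
   to see that a function is zero almost everywhere. *)
Definition cutoff a b (n : nat) x : R :=
  flat 0 (n.+1%:R * x + - (n.+1%:R * a)) * flat 0 (- n.+1%:R * x + n.+1%:R * b).

Lemma cutoff_eq0 a b n x : ~ (a < x < b) -> cutoff a b n x = 0.
Proof.
move=> h; have [xa|ax] := leP x a.
  by rewrite /cutoff flat_le0 ?mul0r// subr_le0 ler_wpM2l.
have [bx|xb] := leP b x; last by case: h; rewrite ax xb.
by rewrite /cutoff [X in _ * X]flat_le0 ?mulr0// mulNr addrC subr_le0 ler_wpM2l.
Qed.

Lemma ctest_cutoff a b n : ctest (fun x => (cutoff a b n x)%:C).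
Proof.
split.
  have -> : (fun x => (cutoff a b n x)%:C) = (fun x =>
     (flat 0 (n.+1%:R * x + - (n.+1%:R * a)))%:C * (flat 0 (- n.+1%:R * x + n.+1%:R * b))%:C).
    by apply/funext => x; rewrite -rmorphM.
  apply: csmoothM.
  - exact: (csmooth_affine n.+1%:R (- (n.+1%:R * a)) (csmooth_flat R 0)).
  - exact: (csmooth_affine (- n.+1%:R) (n.+1%:R * b) (csmooth_flat R 0)).
exists (`|a| + `|b|) => x hx; rewrite cutoff_eq0// => /andP[ax xb].
have := ler_norm b; have := ler_norm (- a); rewrite normrN => h1 h2.
have := normr_ge0 a; have := normr_ge0 b => h3 h4.
by move: hx; rewrite lter_normr => /orP[]; lra.
Qed.

Lemma cutoff_bound a b n x : `|cutoff a b n x| <= 1.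
Proof.
have le1 y : flat 0 y <= 1.
  rewrite /flat; case: ifPn => // y0.
  by rewrite expr0 invr1 mul1r expR_le1 oppr_le0 invr_ge0 ltW.
by rewrite ger0_norm ?mulr_ge0 ?flat_ge0// mulr_ile1 ?flat_ge0 ?le1.
Qed.

Lemma cutoff_cvg a b x :
  cutoff a b n x @[n --> \oo] --> (\1_(`]a, b[%classic) x : R).
Proof.
rewrite indicE.
have [h|h] := pselect (a < x < b); last first.
  rewrite memNset; last by rewrite /= in_itv.
  by apply: cvg_near_cst; near=> n; exact: cutoff_eq0.
rewrite mem_set; last by rewrite /= in_itv.
have /andP[ax xb] := h.
have L (c : R) : 0 < c -> flat 0 (n.+1%:R * c) @[n --> \oo] --> (1 : R).
  move=> c0; rewrite (_ : (fun n => _) = fun n => expR (- c^-1 * harmonic n)).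
    have q : - c^-1 * harmonic n @[n --> \oo] --> (- c^-1 * 0 : R).
      by apply: cvgMr; exact: cvg_harmonic.
    have := continuous_cvg _ (@continuous_expR R _) q.
    by rewrite mulr0 expR0; apply.
  apply/funext => n; rewrite /flat ifT ?mulr_gt0//.
  by rewrite expr0 invr1 mul1r invfM mulNr mulrC.
have -> : (cutoff a b)^~ x = fun n => flat 0 (n.+1%:R * (x - a)) * flat 0 (n.+1%:R * (b - x)).
  by apply/funext => n; rewrite /cutoff !mulrBr mulNr [- _ + _]addrC.
by rewrite -[1%:R](mulr1 (1 : R)); apply: cvgM; apply: L; rewrite subr_gt0.
Unshelve. all: by end_near. Qed.

Lemma integral_itv_eq0 h a b : h \in Lfun mu 2%:E ->
  (forall phi, test_function phi -> (\int[mu]_x (h x * phi x))%R = 0) ->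
  (\int[mu]_(x in `]a, b[) h x)%R = 0.
Proof.
move=> hh H.
have /Lfun2P[mh _] := hh.
pose g x : R := `|h x * \1_(`[a, b]%classic) x|.
have ig : mu.-integrable setT (EFin \o g).
  by have := Lfun2_mul_Lfun1 hh (indic_Lfun2 a b) => /Lfun1_integrable /integrable_norm.
have mphi n : measurable_fun setT (cutoff a b n).
  by apply: continuous_measurable_fun; have [] := csmooth_continuous (ctest_cutoff a b n).1.
have m1 n : measurable_fun setT (fun x => (h x * cutoff a b n x)%:E).
  by apply/measurable_EFinP; exact: (measurable_funM mh (mphi n)).
have m2 : measurable_fun setT (fun x => (h x * \1_(`]a, b[%classic) x)%:E).
  have mi : measurable_fun setT (\1_(`]a, b[%classic) : R -> R) by exact: measurable_indic.
  by apply/measurable_EFinP; exact: (measurable_funM mh mi).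
have cvx : {ae mu, forall x, setT x -> (h x * cutoff a b n x)%:E @[n --> \oo] -->
    (h x * \1_(`]a, b[%classic) x)%:E}.
  apply: aeW => x _; apply: cvg_EFin; first by near=> n.
  by apply: cvgMr; exact: cutoff_cvg.
have bd : {ae mu, forall x, forall n, setT x ->
    (`|(h x * cutoff a b n x)%:E| <= (EFin \o g) x)%E}.
  apply: aeW => x n _; rewrite /= lee_fin /g !(normrM (h x)) ler_wpM2l// indicE.
  have [xI|xI] := pselect (`[a, b]%classic x).
    by rewrite mem_set// normr1 cutoff_bound.
  rewrite memNset// normr0 normr_le0 cutoff_eq0// => /andP[ax xb]; apply: xI.
  by rewrite /= in_itv /= !ltW.
have [_ _ cv] := @dominated_convergence _ _ _ mu _ measurableT _ _ _ m1 m2 cvx ig bd.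
have z : (fun n => \int[mu]_x (h x * cutoff a b n x)%:E)%E = (fun=> 0%E).
  apply/funext => n.
  have [t _] := ctest_test_function (ctest_cutoff a b n).
  have i : mu.-integrable setT (fun x => (h x * cutoff a b n x)%:E).
    have [c _] := ctest_L2 (ctest_cutoff a b n).
    exact/Lfun1_integrable/(Lfun2_mul_Lfun1 hh c).
  have := H _ t; rewrite /Rintegral => e.
  by rewrite -(fineK (integrable_fin_num measurableT i)) e.
have := cvg_lim (@ereal_hausdorff R) cv; rewrite z lim_cst; last exact: ereal_hausdorff.
rewrite Rintegral_mkcond /Rintegral => e.
rewrite (_ : (fun x => _) = (fun x => (h x * \1_(`]a, b[%classic) x)%:E)) -?e//.
apply/funext => x; rewrite patchE indicE.
by case: ifPn => _; rewrite ?mulr1 ?mulr0.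
Unshelve. all: by end_near. Qed.

Lemma ae_eq0_of_test h : h \in Lfun mu 2%:E ->
  (forall phi, test_function phi -> (\int[mu]_x (h x * phi x))%R = 0) ->
  {ae mu, forall x, h x = 0}.
Proof.
move=> hh H.
have L (n : nat) : {ae mu, forall x, `|x| < n%:R -> h x = 0}.
  pose N : R := n%:R.
  pose f := h \_ `[- N, N].
  have i1 := Lfun2_integrable_itv (- N) N hh.
  have lf : locally_integrable [set: R] f by apply: integrable_locally.
  have iT : mu.-integrable setT (EFin \o f).
    by rewrite /f -restrict_EFin; apply/(integrable_restrict _ _ (@measurableT _ _)) => //; rewrite setTI.
  have iy y : mu.-integrable [set` Interval (BLeft (- N)) (BRight y)] (EFin \o f).
    exact: (integrableS measurableT _ (@subsetT _ _) iT).
  have := FTC1 iy lf.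
  apply: filterS; first exact: (ae_filter_ringOfSetsType mu).
  move=> x + xN; rewrite ltr_norml in xN; have /andP[x1 x2] := xN.
  rewrite lte_fin => /(_ x1) [_].
  rewrite {2}/f patchE mem_set /= ?in_itv /= ?(ltW x1) ?(ltW x2)// => <-.
  have F0 y : - N < y -> y < N ->
      (\int[mu]_(t in [set` Interval (BLeft (- N)) (BRight y)]) f t)%R = 0.
    move=> y1 y2.
    transitivity (\int[mu]_(t in `[(- N), y]) h t)%R.
      apply: eq_Rintegral => t; rewrite inE /= in_itv /= => /andP[t1 t2].
      by rewrite /f patchE mem_set//= in_itv /= t1 (le_trans t2)// ltW.
    rewrite -Rintegral_itv_bndo_bndc -?Rintegral_itv_obnd_cbnd; first exact: integral_itv_eq0.
    + have := Lfun2_integrable_itv (- N) y hh => /(integrableS _ _ _); apply => //.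
      exact: subset_itv_oo_cc.
    + have := Lfun2_integrable_itv (- N) y hh => /(integrableS _ _ _); apply => //.
      exact: subset_itv_co_cc.
  rewrite derive1E.
  apply: (@derive_val _ _ _ _ _ _ _).
  apply: (@near_eq_is_derive _ _ _ (fun=> 0 : R)).
  near=> y; rewrite F0//; near: y; [exact: lt_nbhsr|exact: lt_nbhsl].
have hL := @ae_foralln _ _ _ mu _ L.
apply: filterS hL => x hx.
by apply: (hx (Num.bound `|x|)); exact: archi_boundP.
Unshelve. all: by end_near. Qed.

End Uniqueness.

Section SobolevNorm.
Variable R : realType.
Local Notation mu := (@lebesgue_measure R).
Implicit Types (f g h : R -> R) (u v z : R -> R[i]) (x r a b : R) (n : nat).

Lemma real_weak_deriv_unique n (f v1 v2 : R -> R) : v1 \in Lfun mu 2%:E ->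
  v2 \in Lfun mu 2%:E -> real_weak_deriv n f v1 -> real_weak_deriv n f v2 ->
  {ae mu, forall x, v1 x = v2 x}.
Proof.
move=> h1 h2 w1 w2.
have h : (fun x => v1 x + (-1) * v2 x) \in Lfun mu 2%:E by exact/Lfun2D/Lfun2Z.
have := ae_eq0_of_test h.
have H phi : test_function phi -> (\int[mu]_x ((v1 x + (-1) * v2 x) * phi x))%R = 0.
  move=> tphi.
  have c : phi \in Lfun mu 2%:E.
    have [sphi cK] := tphi.
    have [M [_ hM]] := compact_bounded cK.
    apply: (@continuous_Lfun2 _ _ (- (M + 1)) (M + 1)).
      by apply: derivable_continuous => x; exact: (sphi 0).
    move=> x hx; apply/eqP; apply: contra_notT hx => phix.
    have := hM (M + 1); rewrite ltrDl ltr01 => /(_ isT x) /=.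
    by rewrite ler_norml; apply; exact: subset_closure.
  transitivity (\int[mu]_x (v1 x * phi x) - \int[mu]_x (v2 x * phi x))%R.
    rewrite -RintegralB//.
    - by apply: eq_Rintegral => x _ /=; ring.
    - exact/Lfun1_integrable/Lfun2_mul_Lfun1.
    - exact/Lfun1_integrable/Lfun2_mul_Lfun1.
  have := w1 _ tphi; rewrite (w2 _ tphi) => /(congr1 (fun y => (-1) ^+ n * y)).
  by rewrite !mulrA -exprMn mulrNN mulr1 expr1n !mul1r => ->; rewrite subrr.
move=> /(_ H); apply: filterS; first exact: (ae_filter_ringOfSetsType mu).
by move=> x /= /eqP; rewrite mulN1r subr_eq0 => /eqP.
Qed.

Lemma weak_deriv_unique n u v1 v2 : L2 v1 -> L2 v2 -> weak_deriv n u v1 ->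
  weak_deriv n u v2 -> {ae mu, forall x, v1 x = v2 x}.
Proof.
move=> [r1 i1] [r2 i2] [wr1 wi1] [wr2 wi2].
have h1 := real_weak_deriv_unique r1 r2 wr1 wr2.
have h2 := real_weak_deriv_unique i1 i2 wi1 wi2.
apply: (@filterS2 _ _ (ae_filter_ringOfSetsType mu) _ _ _ _ h1 h2) => x e1 e2.
by apply/eqP; rewrite eq_complex e1 e2 !eqxx.
Qed.

Lemma wderivP n u v : L2 v -> weak_deriv n u v ->
  L2 (wderiv n u) /\ weak_deriv n u (wderiv n u).
Proof.
move=> h1 h2; rewrite /wderiv.
exact: (@xgetPex _ (fun=> 0) [set v | L2 v /\ weak_deriv n u v] (ex_intro _ v (conj h1 h2))).
Qed.

Lemma wderiv_ae n u v : L2 v -> weak_deriv n u v ->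
  {ae mu, forall x, wderiv n u x = v x}.
Proof.
by move=> h1 h2; have [h3 h4] := wderivP h1 h2; exact: (weak_deriv_unique h3 h1 h4 h2).
Qed.

Lemma L2norm_ae u v : L2 u -> L2 v -> {ae mu, forall x, u x = v x} ->
  L2norm u = L2norm v.
Proof.
move=> hu hv e; apply/eqP.
rewrite -(@eqrXn2 _ 2)// ?L2norm_ge0// !L2norm_sqr// /Rintegral; apply/eqP; congr fine.
apply: ae_eq_integral => //.
- by have /Lfun2P[_ /integrableP[]] := L2_normc hu.
- by have /Lfun2P[_ /integrableP[]] := L2_normc hv.
- apply: filterS e; first exact: (ae_filter_ringOfSetsType mu).
  by move=> x /= -> _.
Qed.

Lemma weak_deriv0 u : weak_deriv 0 u u.
Proof. by split=> phi _; rewrite expr0 mul1r. Qed.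

Lemma Hnorm0E u : L2 u -> Hnorm 0 u = L2norm u.
Proof.
move=> hu; rewrite /Hnorm big_ord_recl big_ord0 addr0 /= sqrtr_sqr ger0_norm ?L2norm_ge0//.
have [h _] := wderivP hu (weak_deriv0 u).
exact: L2norm_ae h hu (wderiv_ae hu (weak_deriv0 u)).
Qed.

Lemma Hinf_wderiv n u : Hinf u -> L2 (wderiv n u) /\ weak_deriv n u (wderiv n u).
Proof.
by move=> /(_ n) [_ /(_ n (leqnn n)) [v [h1 h2]]]; exact: wderivP h1 h2.
Qed.

Lemma Hinf_L2 u : Hinf u -> L2 u.
Proof. by move=> /(_ 0) []. Qed.

Lemma ctest_Hinf z : ctest z -> Hinf z.
Proof.
move=> hz s; split; first exact: ctest_L2.
move=> j _; exists (iter j cder z); split.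
- exact/ctest_L2/ctest_iter.
- exact: ctest_weak_deriv.
Qed.

Lemma ctest_cst0 : ctest (fun=> (0 : R[i]) : R[i]).
Proof. by split; [exact: csmooth_cst|exists 0]. Qed.

Lemma cder_far z (c w : R) : (forall x, w < `|x - c| -> z x = 0) ->
  forall x, w < `|x - c| -> cder z x = 0.
Proof.
move=> h; apply: (@cder_eq0 _ _ [set x | w < `|x - c|]) => //.
have -> : [set x : R | w < `|x - c|] = (fun x => x - c) @^-1` [set x | w < `|x|] by [].
apply: open_comp; last exact: open_far.
by move=> x _; apply: cvgB; [exact: cvg_id|exact: cvg_cst].
Qed.

Lemma Hnorm_le n z (c w B : R) : ctest z -> 0 <= B -> 0 <= w -> 2 * w <= 1 ->
  (forall x, w < `|x - c| -> z x = 0) ->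
  (forall i x, (i <= n)%N -> normc (iter i cder z x) <= B) ->
  Hnorm n z <= n.+1%:R * B.
Proof.
move=> hz B0 w0 w1 hs hB.
have nB : 0 <= n.+1%:R * B by rewrite mulr_ge0.
rewrite -[leRHS]ger0_norm// -sqrtr_sqr ler_wsqrtr//.
apply: (@le_trans _ _ (\sum_(j < n.+1) B ^+ 2)).
  apply: ler_sum => i _.
  have hi := ctest_iter i hz; have h2 := ctest_L2 hi.
  have [h3 _] := wderivP h2 (ctest_weak_deriv i hz).
  rewrite (L2norm_ae h3 h2 (wderiv_ae h2 (ctest_weak_deriv i hz))).
  have hsi : forall x, w < `|x - c| -> iter i cder z x = 0.
    by elim: (nat_of_ord i) => [//|k IH]; exact: cder_far.
  have hBi x : normc (iter i cder z x) <= B by apply: hB; rewrite -ltnS.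
  apply: (le_trans (L2norm_le_support h2 B0 w0 hsi hBi)).
  by rewrite ler_piMr// sqr_ge0.
rewrite sumr_const card_ord -[X in X <= _]mulr_natl exprMn ler_wpM2r ?sqr_ge0//.
by rewrite expr2 ler_peMl// ler1n.
Qed.

Lemma Hnorm_eq0 n : Hnorm n (fun=> 0 : R[i]) = 0 :> R.
Proof.
have hz := ctest_cst0; apply/eqP; rewrite eq_le sqrtr_ge0 andbT.
suff h : Hnorm n (fun=> 0 : R[i]) <= n.+1%:R * 0 :> R by rewrite mulr0 in h.
apply: (@Hnorm_le n _ 0 0 0 hz (lexx _) (lexx _)).
- by rewrite mulr0 ler01.
- by [].
- move=> i x _.
  have -> : iter i (@cder R) (fun=> 0) = fun=> 0.
    elim: i => [//|i /= ->]; by have [_ ->] := cdf_of (is_cder_cst (0 : R[i])).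
  by rewrite normc0.
Qed.

End SobolevNorm.

(** * Wave packets *)

Section Packets.
Variable R : realType.
Local Notation mu := (@lebesgue_measure R).
Implicit Types (u v z b : R -> R[i]) (x y X xi : R) (c : R[i]) (n j : nat).

Definition packet xi X c b x : R[i] := c * cis (- xi * x) * b (x + (- X)).

Lemma packet_csmooth xi X c b : csmooth b -> csmooth (packet xi X c b).
Proof.
move=> sb; apply: csmoothM; last exact: csmooth_shift.
by apply: csmoothZ; exact: csmooth_cis.
Qed.

Lemma packet_far xi X c b w : (forall y, w < `|y| -> b y = 0) ->
  forall x, w < `|x - X| -> packet xi X c b x = 0.
Proof. by move=> h x /h e; rewrite /packet e mulr0. Qed.

Lemma packet_ctest xi X c b w : csmooth b -> (forall y, w < `|y| -> b y = 0) ->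
  ctest (packet xi X c b).
Proof.
move=> sb h; split; first exact: packet_csmooth.
exists (w + `|X|) => x hx; apply: (packet_far _ _ h).
have : `|x| <= `|x - X| + `|X| by rewrite -[X in `|X| <= _](subrK X) ler_normD.
by lra.
Qed.

Lemma packet_norm xi X c b x : normc (packet xi X c b x) = normc c * normc (b (x - X)).
Proof. by rewrite /packet !normcM normc_cis mulr1. Qed.

Lemma packetZ xi X c d b : packet xi X c (fun y => d * b y) = packet xi X (c * d) b.
Proof. by apply/funext => x; rewrite /packet; ring. Qed.

Lemma packetD xi X c b1 b2 : packet xi X c (fun y => b1 y + b2 y) =
  fun x => packet xi X c b1 x + packet xi X c b2 x.
Proof. by apply/funext => x; rewrite /packet mulrDr. Qed.

Lemma packet_cder xi X c b : csmooth b ->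
  (fun x => 'i%C * cder (packet xi X c b) x) = packet xi X c (Qop xi b).
Proof.
move=> sb; apply/funext => x.
have h1 : is_cder (fun x => c * cis (- xi * x)) x (c * ((- xi)%:C * ('i%C * cis (- xi * x)))).
  apply: is_cderZ; apply: is_cder_comp; first exact: is_cder_cis.
  by have := is_derive_affine (- xi) 0 x; under eq_fun do rewrite addr0.
have h2 : is_cder (fun x => b (x + (- X))) x (cder b (x + (- X))).
  apply: (is_cder_eq (is_cder_comp (csmooth_cdf sb _) (is_derive_shift x 1 (- X)))).
  by rewrite mul1r.
rewrite (is_cderE (is_cderM h1 h2)) /packet /Qop /Jop rmorphN /=.
have i2 : 'i%C * 'i%C = -1 :> R[i] by rewrite -expr2 sqr_i.
transitivity (- ('i%C * 'i%C) * c * xi%:C * cis (- xi * x) * b (x + - X) +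
  c * cis (- xi * x) * ('i%C * cder b (x + - X))); first by ring.
by rewrite i2; ring.
Qed.

Lemma packet_iter xi X c b j : csmooth b ->
  (fun x => 'i%C ^+ j * iter j cder (packet xi X c b) x) =
  packet xi X c (iter j (Qop xi) b).
Proof.
move=> sb; elim: j => [|j IH]; first by apply/funext => x; rewrite expr0 mul1r.
rewrite iterS -packet_cder; last exact: csmooth_Qpow.
rewrite -IH cderZ; last exact/csmooth_cdf/csmooth_iter/packet_csmooth.
by apply/funext => x /=; rewrite exprS mulrA.
Qed.

Lemma packet_mul xi X c a b : (fun x => a x * packet xi X c b x) =
  packet xi X c (fun y => a (y + X) * b y).
Proof. by apply/funext => x; rewrite /packet subrK; ring. Qed.

Lemma iter_cderZ c z j : csmooth z ->
  iter j cder (fun x => c * z x) = fun x => c * iter j cder z x.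
Proof.
move=> sz; elim: j => [//|j IH]; rewrite iterS IH cderZ//.
exact/csmooth_cdf/csmooth_iter.
Qed.

Lemma ReRM (r : R) c : Re (r%:C * c) = r * Re c.
Proof. by case: c => ? ? /=; rewrite mul0r subr0. Qed.

Lemma pr_real u v (r : R) : L2 u -> L2 v -> pr u (fun x => r%:C * v x) = r * pr u v.
Proof.
move=> hu hv; rewrite /pr -RintegralZl//; last exact: L2_pr_integrable.
by apply: eq_Rintegral => x _; rewrite mulrCA ReRM.
Qed.

Lemma pr_Dx xi X c b w j u a : Hinf u -> csmooth a -> csmooth b ->
  (forall y, w < `|y| -> b y = 0) ->
  mu.-integrable setT (EFin \o (fun x => Re (a x * Dx j u x * packet xi X c b x))) /\
  pr (fun x => a x * Dx j u x) (packet xi X c b) =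
  pr u (packet xi X c (iter j (Qop xi) (fun y => a (y + X) * b y))).
Proof.
move=> hu sa sb hb.
have [h1 h2] := Hinf_wderiv j hu.
have tz := packet_ctest xi X c sb hb.
have taz := ctestM sa tz.
have tz' := ctestZ ('i%C ^- j) taz.
have e : (fun x => Re (a x * Dx j u x * packet xi X c b x)) =
   fun x => Re (wderiv j u x * ('i%C ^- j * (a x * packet xi X c b x))).
  by apply/funext => x; rewrite /Dx; congr Re; ring.
split; first by rewrite e; exact/(L2_pr_integrable h1)/ctest_L2.
rewrite {1}/pr e -[LHS]/(pr (wderiv j u) (fun x => 'i%C ^- j * (a x * packet xi X c b x))).
rewrite (pr_weak_deriv (Hinf_L2 hu) h1 h2 tz').
rewrite -pr_real; [|exact: Hinf_L2|exact/ctest_L2/ctest_iter].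
congr pr; rewrite iter_cderZ; last by case: taz.
rewrite packet_mul -packet_iter; last first.
  by apply: csmoothM => //; exact: csmooth_shift.
apply/funext => x; rewrite mulrA; congr (_ * _).
rewrite rmorphXn rmorphN1 -exprVn -exprMn; congr (_ ^+ _).
by rewrite mulN1r -invrN; apply/eqP; rewrite -(inj_eq (@mulfI _ (- 'i%C) _)) ?mulfV//
  ?mulNr -?expr2 ?sqr_i ?opprK// oppr_eq0 eq_complex /= oner_eq0 andbF.
Qed.

Lemma ampopE xi p (cp : R) (k : nat -> R -> R[i]) b y : (0 < p)%N -> xi != 0 ->
  ampop xi p cp k b y =
    'i%C * ((xi ^+ p * cp)%:C + (xi ^+ p.-1)%:C * k p.-1 0) * b y
    + (- (p%:R * cp * xi ^+ p.-1)%:C) * cder b y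
    - 'i%C * (cp%:C * iter p (Qop xi) b y +
        \sum_(j < p) iter j (Qop xi) (fun y => k j y * b y) y).
Proof.
case: p => // q _ xi0; rewrite big_ord_recr /= /ampop /Qrem1 /Qrem2 /Jop.
set S := \sum_(j < q) _.
have -> : q.+1%:R * xi ^+ q.+1 / xi = q.+1%:R * xi ^+ q.
  by rewrite exprSr mulrA mulfK.
rewrite !rmorphM /=.
have i2 : 'i%C * 'i%C = -1 :> R[i] by rewrite -expr2 sqr_i.
set A := q.+1%:R%:C; set B := (xi ^+ q)%:C; set D := (xi ^+ q.+1)%:C.
set P := iter q (Qop xi) _ y; set Q := Qop xi _ y.
transitivity ('i%C * (D * cp%:C + B * k q 0) * b y
   + ('i%C * 'i%C) * (A * cp%:C * B) * cder b y - 'i%C * (cp%:C * Q + (S + P))).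
  by ring.
by rewrite i2; ring.
Qed.

Lemma Qpow_far xi j h (w : R) : csmooth h -> (forall y, w < `|y| -> h y = 0) ->
  forall y, w < `|y| -> iter j (Qop xi) h y = 0.
Proof.
move=> sh hh; elim: j => [//|j IH] y hy.
by rewrite iterS /Qop /Jop IH// (cder_eq0 (@open_far _ w) IH)// !mulr0 addr0.
Qed.

Lemma ampop_far xi p (cp : R) (k : nat -> R -> R[i]) b (w : R) : (0 < p)%N -> xi != 0 ->
  csmooth b -> (forall j, (j < p)%N -> csmooth (k j)) ->
  (forall y, w < `|y| -> b y = 0) -> forall y, w < `|y| -> ampop xi p cp k b y = 0.
Proof.
move=> p0 xi0 sb sk hb y hy; rewrite ampopE// hb// (cder_eq0 (@open_far _ w) hb)//.
rewrite (Qpow_far _ _ sb hb)// big1 => [|j _]; first by rewrite !(mulr0, addr0, subr0).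
apply: Qpow_far hy; first by apply: csmoothM => //; exact: sk.
by move=> z /hb ->; rewrite mulr0.
Qed.

Lemma pr_equation xi X c b w p u v f (cp : R) (a : nat -> R -> R[i]) :
  Hinf u -> L2 v -> L2 f -> csmooth b -> (forall y, w < `|y| -> b y = 0) ->
  (forall j, (j < p)%N -> csmooth (a j)) ->
  {ae mu, forall x, v x + cp%:C * Dx p u x + \sum_(j < p) a j x * Dx j u x = f x} ->
  pr v (packet xi X c b) = pr f (packet xi X c b) -
    pr u (packet xi X c (fun y => cp%:C * iter p (Qop xi) b y +
       \sum_(j < p) iter j (Qop xi) (fun y => a j (y + X) * b y) y)).
Proof.
move=> hu hv hf sb hb sa e.
set z := packet xi X c b.
have tz : ctest z := packet_ctest xi X c sb hb.
have Lz := ctest_L2 tz; have Lu := Hinf_L2 hu.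
have sab j : (j < p)%N -> csmooth (fun y => a j (y + X) * b y).
  by move=> jp; apply: csmoothM => //; apply: csmooth_shift; exact: sa.
have far h : csmooth h -> (forall y, w < `|y| -> h y = 0) ->
    forall j, ctest (packet xi X c (iter j (Qop xi) h)).
  move=> sh hh j; apply: (@packet_ctest _ _ _ _ w); first exact: csmooth_Qpow.
  exact: Qpow_far.
have [ip ep] := pr_Dx xi X c p hu (csmooth_cst cp%:C) sb hb.
pose sD q x := \sum_(j < q) a j x * Dx j u x.
pose sQ q y := \sum_(j < q) iter j (Qop xi) (fun y => a j (y + X) * b y) y.
have sDS q x : sD q.+1 x = sD q x + a q x * Dx q u x by rewrite /sD big_ord_recr.
have S q : (q <= p)%N ->
   [/\ mu.-integrable setT (EFin \o (fun x => Re (sD q x * z x))),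
   pr (sD q) z = pr u (packet xi X c (sQ q)) & L2 (packet xi X c (sQ q))].
  elim: q => [_|q IH qp].
    have Z1 : sD 0%N = fun=> 0 by apply/funext => x; rewrite /sD big_ord0.
    have Z2 : packet xi X c (sQ 0%N) = fun=> 0.
      by apply/funext => x; rewrite /packet /sQ big_ord0 mulr0.
    rewrite Z2; split; last exact/ctest_L2/ctest_cst0.
      rewrite (_ : EFin \o _ = cst 0%E); first exact: integrable0.
      by apply/funext => x /=; rewrite Z1 mul0r.
    by rewrite Z1; apply: eq_Rintegral => x _; rewrite mulr0 mul0r.
  have [i1 e1 l1] := IH (ltnW qp).
  have hab y : w < `|y| -> a q (y + X) * b y = 0 by move=> /hb ->; rewrite mulr0.
  have [i2 e2] := pr_Dx xi X c q hu (sa q qp) sb hb.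
  have l2 := ctest_L2 (far _ (sab q qp) hab q).
  have -> : packet xi X c (sQ q.+1) = fun x => packet xi X c (sQ q) x
       + packet xi X c (iter q (Qop xi) (fun y => a q (y + X) * b y)) x.
    by rewrite -packetD; congr packet; apply/funext => y; rewrite /sQ big_ord_recr.
  split; last exact: L2D.
    have -> : EFin \o (fun x => Re (sD q.+1 x * z x)) = (fun x =>
      ((Re (sD q x * z x))%:E + (Re (a q x * Dx q u x * z x))%:E)%E).
      by apply/funext => x /=; rewrite sDS mulrDl ReD EFinD.
    exact: (integrableD measurableT i1 i2).
  rewrite prDr// -e1 -e2 /pr -RintegralD//.
  by apply: eq_Rintegral => x _; rewrite sDS mulrDl ReD.
have [iS eS lS] := S p (leqnn p).
rewrite packetD prDr//; last first.
  rewrite packetZ (_ : packet _ _ _ _ = fun x => cp%:C * packet xi X c (iter p (Qop xi) b) x).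
    exact/L2Z/ctest_L2/far.
  by apply/funext => x; rewrite /packet; ring.
rewrite -eS.
have -> : pr u (packet xi X c (fun y => cp%:C * iter p (Qop xi) b y)) =
   pr (fun x => cp%:C * Dx p u x) z.
  rewrite ep; congr (pr u (packet xi X c _)).
  have [_ ->] : csmooth (iter p (Qop xi) b) /\
      iter p (Qop xi) (fun y => cp%:C * b y) = (fun y => cp%:C * iter p (Qop xi) b y).
    elim: (p) => [//|q [s1 s2]]; split; first exact: csmooth_Qop.
    by rewrite iterS s2 QopZ.
  by [].
have iv := L2_pr_integrable hv Lz.
apply/eqP; rewrite eq_sym subr_eq; apply/eqP.
rewrite {1}/pr.
transitivity (\int[mu]_x (Re (v x * z x) + (Re (cp%:C * Dx p u x * z x)
    + Re (sD p x * z x))))%R.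
  rewrite /Rintegral; congr fine.
  apply: ae_eq_integral => //.
  - by case/integrableP: (L2_pr_integrable hf Lz).
  - have := integrableD measurableT iv (integrableD measurableT ip iS).
    by case/integrableP.
  - apply: filterS e; first exact: (ae_filter_ringOfSetsType mu).
    by move=> x /= <- _; rewrite !mulrDl !ReD addrA.
rewrite RintegralD//; last exact: (integrableD measurableT ip iS).
by rewrite RintegralD.
Qed.

End Packets.

Section MovingPackets.
Variable R : realType.
Local Notation mu := (@lebesgue_measure R).
Implicit Types (u v z b : R -> R[i]) (x y t xi : R) (n j : nat).

Lemma csmooth_bounded b w : csmooth b -> (forall y, w < `|y| -> b y = 0) ->
  exists2 B, 0 <= B & forall y, normc (b y) <= B.
Proof.
move=> sb hb; have [c1 c2] := csmooth_continuous sb.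
have cn : continuous (fun y => `|Re (b y)| + `|Im (b y)|).
  by move=> y; apply: cvgD; apply: cvg_norm; [exact: c1|exact: c2].
have w0 : - `|w| <= `|w| by rewrite ge0_cp.
have [m _ hm] := EVT_max w0 (continuous_subspaceT cn).
exists (`|Re (b m)| + `|Im (b m)|); first exact: addr_ge0.
move=> y; have [yw|yw] := leP `|y| `|w|.
  by rewrite (le_trans (normc_le _))// hm// in_itv /= -ler_norml.
rewrite hb ?normc0 ?addr_ge0//.
by rewrite (le_lt_trans (ler_norm w)).
Qed.

Lemma packet_L2norm xi X c b w B : csmooth b -> (forall y, w < `|y| -> b y = 0) ->
  0 <= w -> 2 * w <= 1 -> 0 <= B -> (forall y, normc (b y) <= B) ->
  L2norm (packet xi X c b) <= normc c * B.
Proof.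
move=> sb hb w0 w1 B0 hB.
have h0 : 0 <= normc c * B by rewrite mulr_ge0// normc_ge0.
rewrite -(@ler_pXn2r _ 2)// ?nnegrE ?L2norm_ge0//.
apply: (le_trans (L2norm_le_support (c := X) (ctest_L2 (packet_ctest xi X c sb hb)) h0 w0 _ _)).
- exact: packet_far.
- by move=> x; rewrite packet_norm ler_wpM2l ?normc_ge0.
- by rewrite ler_piMr// sqr_ge0.
Qed.

Lemma is_cder_packet xi (X : R -> R) (c : R -> R[i]) b t x (dX : R) (dc : R[i]) :
  csmooth b -> is_cder c t dc -> is_derive t 1 X dX ->
  is_cder (fun t => packet xi (X t) (c t) b x) t
    (packet xi (X t) 1 (fun y => dc * b y + (- (c t * dX%:C)) * cder b y) x).
Proof.
move=> sb hc hX.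
have h1 : is_cder (fun t => c t * cis (- xi * x)) t (dc * cis (- xi * x)).
  apply: (is_cder_eq (is_cderM hc (is_cder_cst (cis (- xi * x)) t))).
  by rewrite mulr0 addr0.
have h2 : is_derive t 1 (fun t => x + (- X t)) (- dX).
  by apply: (is_derive_eq (is_deriveD (is_derive_cst x t 1) (is_deriveN hX))); rewrite add0r.
have h3 := @is_cder_comp _ b (fun t => x + (- X t)) t _ _ (csmooth_cdf sb _) h2.
apply: (is_cder_eq (is_cderM h1 h3)).
by rewrite /packet rmorphN /=; ring.
Qed.

Lemma is_derive_pr_packet xi (X dX : R -> R) (c dc : R -> R[i]) b w u K s1 s2 t :
  L2 u -> csmooth b -> (forall y, w < `|y| -> b y = 0) ->
  (forall s, s1 < s < s2 -> is_cder c s (dc s)) ->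
  (forall s, s1 < s < s2 -> is_derive s 1 X (dX s)) ->
  (forall s, s1 < s < s2 -> [/\ normc (c s) <= K, normc (dc s) <= K, `|X s| <= K & `|dX s| <= K]) ->
  s1 < t < s2 ->
  is_derive t 1 (fun s => pr u (packet xi (X s) (c s) b))
    (pr u (packet xi (X t) 1 (fun y => dc t * b y + (- (c t * (dX t)%:C)) * cder b y))).
Proof.
move=> hu sb hb hc hX hK ht.
have hb' := cder_eq0 (@open_far _ w) hb.
have [B1 B10 hB1] := csmooth_bounded sb hb.
have [B2 B20 hB2] := csmooth_bounded (csmooth_cder sb) hb'.
have K0 : 0 <= K by have [h _ _ _] := hK t ht; apply: le_trans h; exact: normc_ge0.
pose f s x := Re (u x * packet xi (X s) (c s) b x).
pose f' s x := Re (u x *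
  packet xi (X s) 1 (fun y => dc s * b y + (- (c s * (dX s)%:C)) * cder b y) x).
have hf s x : s1 < s < s2 -> is_derive s 1 (f ^~ x) (f' s x).
  move=> hs.
  have [h _] := is_cderZ (u x) (is_cder_packet xi x sb (hc s hs) (hX s hs)).
  exact: h.
have ctb s : ctest (packet xi (X s) (c s) b) by exact: packet_ctest hb.
pose M := K * B1 + K * K * B2.
have M0 : 0 <= M by rewrite addr_ge0 ?mulr_ge0.
pose G x := normc (u x) * (M * \1_(`[(- (K + w)), (K + w)]%classic) x).
have G0 x : 0 <= G x by rewrite mulr_ge0 ?normc_ge0// mulr_ge0.
have iG : mu.-integrable setT (EFin \o G).
  apply/Lfun1_integrable; apply: Lfun2_mul_Lfun1; first exact: L2_normc.
  exact/Lfun2Z/indic_Lfun2.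
have bd s x : s1 < s < s2 -> `|f' s x| <= G x.
  move=> hs; have [k1 k2 k3 k4] := hK s hs.
  rewrite (le_trans (normc_Re _))// normcM /G ler_wpM2l ?normc_ge0//.
  have [xI|xI] := pselect (`[(- (K + w)), (K + w)]%classic x).
    rewrite indicE mem_set// mulr1 packet_norm normcR normr1 mul1r.
    rewrite (le_trans (normcD _ _))// lerD// !normcM.
      by rewrite ler_pM ?normc_ge0.
    rewrite normcN normcM normcR ler_pM ?mulr_ge0 ?normc_ge0//.
    by rewrite ler_pM ?normc_ge0.
  rewrite indicE memNset// mulr0.
  have hx : w < `|x - X s|.
    rewrite ltNge; apply/negP => hx; apply: xI; rewrite /= in_itv /= -ler_norml.
    have : `|x| <= `|x - X s| + `|X s| by rewrite -[X in `|X| <= _](subrK (X s)) ler_normD.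
    by lra.
  by rewrite packet_norm hb// hb'// !mulr0 addr0 normc0 mulr0.
have It : `]s1, s2[%classic t by rewrite /= in_itv.
have i1 s : `]s1, s2[%classic s -> mu.-integrable setT (EFin \o f s).
  by move=> _; exact/L2_pr_integrable/ctest_L2.
have i2 s x : `]s1, s2[%classic s -> setT x -> derivable (f ^~ x) s 1.
  by rewrite /= in_itv /= => hs _; have [] := hf s x hs.
have pE s x : s1 < s < s2 -> partial1of2 f s x = f' s x.
  by move=> hs; rewrite partial1of2E; have [_ ->] := hf s x hs.
have i3 s x : `]s1, s2[%classic s -> setT x -> `|partial1of2 f s x| <= G x.
  by rewrite /= in_itv /= => hs _; rewrite pE// bd.
split; first exact: (@derivable_under_integral _ _ _ mu f setT measurableT t s1 s2 It i1 i2 G G0 iG i3).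
rewrite -derive1E.
rewrite (@differentiation_under_integral _ _ _ mu f setT measurableT t s1 s2 It i1 i2 G G0 iG i3).
by apply: eq_Rintegral => x _; exact: pE.
Qed.

Lemma is_derive_pr_moving xi (X dX : R -> R) (c dc : R -> R[i]) b w (u : R -> R -> R[i]) v K s1 s2 t :
  (forall s, L2 (u s)) -> L2 v -> csmooth b -> (forall y, w < `|y| -> b y = 0) ->
  0 <= w -> 2 * w <= 1 ->
  (forall s, s1 < s < s2 -> is_cder c s (dc s)) ->
  (forall s, s1 < s < s2 -> is_derive s 1 X (dX s)) ->
  (forall s, s1 < s < s2 -> [/\ normc (c s) <= K, normc (dc s) <= K, `|X s| <= K & `|dX s| <= K]) ->
  s1 < t < s2 ->
  L2norm (fun x => 'i%C^-1 * ((t' - t)^-1)%:C * (u t' x - u t x) - v x) @[t' --> t^'] --> (0 : R) ->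
  is_derive t 1 (fun s => pr (u s) (packet xi (X s) (c s) b))
    (pr v (packet xi (X t) ('i%C * c t) b) +
     pr (u t) (packet xi (X t) 1 (fun y => dc t * b y + (- (c t * (dX t)%:C)) * cder b y))).
Proof.
move=> hu hv sb hb w0 w1 hc hX hK ht lim.
have [B B0 hB] := csmooth_bounded sb hb.
have K0 : 0 <= K by have [h _ _ _] := hK t ht; apply: le_trans h; exact: normc_ge0.
pose Z s := packet xi (X s) (c s) b; pose iZ s := packet xi (X s) ('i%C * c s) b.
have LZ s : L2 (Z s) by exact/ctest_L2/(packet_ctest _ _ _ sb hb).
have LiZ s : L2 (iZ s) by exact/ctest_L2/(packet_ctest _ _ _ sb hb).
have Ldiff s : L2 (fun x => u s x - u t x).
  exact: L2B.
have -> : (fun s => pr (u s) (packet xi (X s) (c s) b)) =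
    (fun s => pr (fun x => u s x - u t x) (Z s) + pr (u t) (Z s)).
  apply/funext => s; rewrite -prDl//.
  by congr pr; apply/funext => x; rewrite subrK.
apply: is_deriveD; last exact: is_derive_pr_packet hb hc hX hK ht.
have hic s : s1 < s < s2 -> is_cder (fun s => 'i%C * c s) s ('i%C * dc s).
  by move=> hs; apply: is_cderZ; exact: hc.
have hiK s : s1 < s < s2 -> [/\ normc ('i%C * c s) <= K, normc ('i%C * dc s) <= K, `|X s| <= K & `|dX s| <= K].
  by move=> hs; rewrite !normcM normc_i !mul1r; exact: hK.
have [dv _] := is_derive_pr_packet xi hv sb hb hic hX hiK ht.
have cv : {for t, continuous (fun s => pr v (iZ s))}.
  exact/differentiable_continuous/derivable1_diffP.
pose Q s x := 'i%C^-1 * ((s - t)^-1)%:C * (u s x - u t x) - v x.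
have LQ s : L2 (Q s).
  exact: L2B (L2Z _ (Ldiff s)) hv.
apply/is_derive1_caratheodory.
exists (fun s => if s == t then pr v (iZ t) else (s - t)^-1 * pr (fun x => u s x - u t x) (Z s)); split.
- move=> s; have e0 : pr (fun x => u t x - u t x) (Z t) = 0.
    transitivity (pr (u t) (fun x => 0%:C * Z t x)); last by rewrite pr_real// mul0r.
    by rewrite -prA; congr pr; apply/funext => x; rewrite subrr mul0r.
  rewrite e0 subr0; case: eqP => [->|/eqP st]; first by rewrite e0 subrr mulr0.
  by rewrite mulrC mulrA mulfV ?mul1r// subr_eq0.
- have key s : s1 < s < s2 -> s != t ->
    `|(s - t)^-1 * pr (fun x => u s x - u t x) (Z s) - pr v (iZ s)| <= L2norm (Q s) * (K * B).
    move=> hs st.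
    have -> : (s - t)^-1 * pr (fun x => u s x - u t x) (Z s) - pr v (iZ s) = pr (Q s) (iZ s).
      apply/eqP; rewrite subr_eq -prDl//; apply/eqP.
      rewrite -pr_real//.
      rewrite -prA; apply: eq_Rintegral => x _; congr Re.
      rewrite /Q subrK /iZ /Z /packet.
      have i1 : 'i%C^-1 * 'i%C = 1 :> R[i] by rewrite mulVf// eq_complex /= oner_eq0 andbF.
      transitivity (('i%C^-1 * 'i%C) * (((s - t)^-1)%:C * (u s x - u t x) * (c s * cis (- xi * x) * b (x + - X s)))).
        by rewrite i1 mul1r.
      by ring.
    apply: (le_trans (pr_bound (LQ s) (LiZ s))).
    rewrite ler_wpM2l ?L2norm_ge0//.
    have [k1 _ _ _] := hiK s hs.
    by rewrite (le_trans (packet_L2norm _ _ _ sb hb w0 w1 B0 hB))// ler_wpM2r.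
  apply/cvgrPdist_le => e e0; rewrite eqxx.
  have KB : 0 < K * B + 1 by rewrite ltr_wpDl// mulr_ge0.
  have e2 : 0 < e / 2 by rewrite divr_gt0.
  have n1 : \forall s \near t, s != t -> L2norm (Q s) <= e / 2 / (K * B + 1).
    have /cvgrPdist_le /(_ (e / 2 / (K * B + 1)) (divr_gt0 e2 KB)) := lim.
    rewrite near_withinE; apply: filterS => s h st; have := h st.
    by rewrite sub0r normrN; apply: le_trans; exact: ler_norm.
  have n2 : \forall s \near t, `|pr v (iZ t) - pr v (iZ s)| <= e / 2.
    by have /cvgrPdist_le /(_ _ e2) := cv.
  have /andP[t1 t2] := ht.
  near=> s.
  have q' : s != t -> L2norm (Q s) <= e / 2 / (K * B + 1) by near: s; exact: n1.
  case: eqP => [_|/eqP st]; first by rewrite subrr normr0 ltW.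
  have hs : s1 < s < s2.
    apply/andP; split; near: s; [exact: lt_nbhsr|exact: lt_nbhsl].
  have k := key s hs st.
  have q : L2norm (Q s) <= e / 2 / (K * B + 1) by exact: q'.
  have c2 : `|pr v (iZ t) - pr v (iZ s)| <= e / 2 by near: s.
  have k' : L2norm (Q s) * (K * B) <= e / 2.
    apply: (@le_trans _ _ (e / 2 / (K * B + 1) * (K * B + 1))); last by rewrite divfK// gt_eqF.
    by rewrite ler_pM ?L2norm_ge0 ?mulr_ge0// lerDl.
  rewrite -(subrKA (pr v (iZ s))) (le_trans (ler_normD _ _))// [X in _ <= X]splitr lerD//.
  by rewrite distrC (le_trans k).
- by rewrite eqxx.
Unshelve. all: by end_near. Qed.

End MovingPackets.

Section Clamp.
Variable R : realType.
Local Notation mu := (@lebesgue_measure R).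
Implicit Types (u v z b : R -> R[i]) (x y t xi : R) (n j : nat).

(* The data are unconstrained outside [0, T]. *)
Definition clamp (T t : R) : R := Num.max 0 (Num.min t T).

Lemma clamp_itv T t : 0 <= T -> 0 <= clamp T t <= T.
Proof. by move=> T0; rewrite /clamp le_max lexx /= ge_max T0 ge_min lexx orbT. Qed.

Lemma clamp_id T t : 0 <= t <= T -> clamp T t = t.
Proof. by move=> /andP[t0 tT]; rewrite /clamp min_l// max_r. Qed.

Lemma continuous_clamp T : continuous (clamp T).
Proof.
move=> t; apply: (@continuous_max _ _ (cst 0) (id \min cst T)); first exact: cvg_cst.
by apply: continuous_min; [exact: cvg_id|exact: cvg_cst].
Qed.

Lemma clamp_within (T t : R) (F : R -> Prop) : 0 <= T ->
  (\forall s \near within `[0, T] (nbhs (clamp T t)), F s) ->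
  \forall s \near t, F (clamp T s).
Proof.
move=> T0; rewrite near_withinE => h.
have h2 : \forall s \near t, `[0, T]%classic (clamp T s) -> F (clamp T s).
  exact: (@continuous_clamp T t _ h).
apply: filterS h2 => s; apply.
by have := clamp_itv s T0; rewrite /= in_itv.
Qed.

Lemma clamp_cvg (T t : R) (F : R -> R) (l : R) : 0 <= T ->
  F s @[s --> within `[0, T] (nbhs (clamp T t))] --> l ->
  F (clamp T s) @[s --> t] --> l.
Proof.
move=> T0 /cvgrPdist_le h; apply/cvgrPdist_le => e e0.
exact: (@clamp_within T t (fun s => `|l - F s| <= e) T0 (h e e0)).
Qed.

Lemma Binf_csmooth b : Binf b -> csmooth b.
Proof. by move=> [h1 h2 _]; exact: smooth_csmooth. Qed.

Lemma Bnorm_ub n b x : Binf b -> normc (iter n cder b x) <= Bnorm n b.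
Proof.
move=> [_ _ /(_ n) [M hM]]; rewrite iter_cderE; apply: sup_upper_bound; last by exists x.
split; first by exists (normc (cderiv n b 0)), 0.
by exists M => _ [y _ <-].
Qed.

Lemma Bnorm_le n b M : (forall x, normc (iter n cder b x) <= M) -> Bnorm n b <= M.
Proof.
move=> h; rewrite iter_cderE in h; apply: ge_sup.
  by exists (normc (cderiv n b 0)), 0.
by move=> _ [y _ <-].
Qed.

Lemma iter_cderB n b1 b2 : csmooth b1 -> csmooth b2 ->
  iter n cder (fun x => b1 x - b2 x) =
  fun x => iter n cder b1 x - iter n cder b2 x.
Proof.
move=> s1 s2.
have e (c1 c2 : R -> R[i]) : (fun x => c1 x - c2 x) = (fun x => c1 x + (-1) * c2 x).
  by apply/funext => x; rewrite mulN1r.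
elim: n => [//|n IH]; rewrite iterS IH e cderD; last 2 first.
- exact/csmooth_cdf/csmooth_iter.
- exact/csmooth_cdf/csmoothZ/csmooth_iter.
by rewrite cderZ ?e//; exact/csmooth_cdf/csmooth_iter.
Qed.

Lemma BinfB b1 b2 : Binf b1 -> Binf b2 -> Binf (fun x => b1 x - b2 x).
Proof.
move=> h1 h2; have s1 := Binf_csmooth h1; have s2 := Binf_csmooth h2.
have s : csmooth (fun x => b1 x - b2 x).
  have := csmoothD s1 (csmoothZ (-1) s2).
  by under eq_fun do rewrite mulN1r.
have [r1 r2] := csmooth_smooth s.
split=> // n; exists (Bnorm n b1 + Bnorm n b2) => x.
rewrite -iter_cderE iter_cderB// (le_trans (normcD _ _))// lerD ?Bnorm_ub//.
by rewrite normcN Bnorm_ub.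
Qed.

Lemma Bnorm_dist n b1 b2 : Binf b1 -> Binf b2 ->
  Bnorm n b1 <= Bnorm n b2 + Bnorm n (fun x => b1 x - b2 x).
Proof.
move=> h1 h2; apply: Bnorm_le => x.
have := @Bnorm_ub n _ x (BinfB h1 h2).
rewrite iter_cderB; [|exact: Binf_csmooth|exact: Binf_csmooth] => h.
rewrite -[X in normc X](subrK (iter n cder b2 x)) addrC (le_trans (normcD _ _))//.
by rewrite lerD ?Bnorm_ub.
Qed.

Section Coefficients.
Variables (T : R) (a : R -> R -> R[i]).
Hypotheses (T0 : 0 <= T) (ha : C0T T (@Binf R) (@Bnorm R) a).

Let Ba t : Binf (a (clamp T t)).
Proof. by apply: ha.1; exact: clamp_itv. Qed.

Lemma coef_csmooth t : csmooth (a (clamp T t)).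
Proof. exact: Binf_csmooth. Qed.

Lemma coef_bounded n : exists2 K, 0 <= K &
  forall t x, normc (iter n cder (a (clamp T t)) x) <= K.
Proof.
pose g t := Bnorm n (a (clamp T t)).
have cg : continuous g.
  move=> t; apply/cvgrPdist_le => e e0.
  have /cvgrPdist_le /(_ e e0) := clamp_cvg T0 (ha.2 n _ (clamp_itv t T0)).
  apply: filterS => s; rewrite sub0r normrN => h; rewrite ler_norml.
  have h' := le_trans (ler_norm _) h.
  have h1 := Bnorm_dist n (Ba s) (Ba t).
  have h2 := Bnorm_dist n (Ba t) (Ba s).
  have e3 : Bnorm n (fun x => a (clamp T t) x - a (clamp T s) x) =
            Bnorm n (fun x => a (clamp T s) x - a (clamp T t) x).
    congr sup; apply/seteqP; split=> _ [x _ <-]; exists x => //;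
      by rewrite -!iter_cderE !iter_cderB; try exact: coef_csmooth; rewrite -[RHS]normcN opprB.
  by rewrite e3 in h2; rewrite /g; apply/andP; split; lra.
have [m _ hm] := EVT_max T0 (continuous_subspaceT cg).
exists (g m).
  by apply: le_trans (@Bnorm_ub n _ 0 (Ba m)); exact: normc_ge0.
move=> t x; apply: (le_trans (Bnorm_ub _ _ (Ba t))).
have := hm (clamp T t); rewrite in_itv /= clamp_itv// /g => /(_ isT).
by rewrite (clamp_id (clamp_itv t T0)).
Qed.

Lemma coef_continuous t e : 0 < e ->
  \forall s \near t, forall x, normc (a (clamp T s) x - a (clamp T t) x) <= e.
Proof.
move=> e0.
have /cvgrPdist_le /(_ e e0) := clamp_cvg T0 (ha.2 0 _ (clamp_itv t T0)).
apply: filterS => s; rewrite sub0r normrN => h x.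
apply: le_trans h; apply: le_trans (ler_norm _).
exact: (@Bnorm_ub 0 _ x (BinfB (Ba s) (Ba t))).
Qed.

Lemma coef_path_continuous (X : R -> R) : continuous X ->
  continuous (fun t => Re (a (clamp T t) (X t))) /\
  continuous (fun t => Im (a (clamp T t) (X t))).
Proof.
move=> cX; have [K K0 hK] := coef_bounded 1.
have key t e : 0 < e -> \forall s \near t,
    normc (a (clamp T s) (X s) - a (clamp T t) (X t)) <= e.
  move=> e0; have e2 : 0 < e / 2 by rewrite divr_gt0.
  have K1 : 0 < 2 * K + 1 by rewrite ltr_wpDl// mulr_ge0.
  have h1 := coef_continuous t e2.
  have /cvgrPdist_le /(_ (e / 2 / (2 * K + 1)) (divr_gt0 e2 K1)) h2 := cX t.
  near=> s.
  have d1 : forall x, normc (a (clamp T s) x - a (clamp T t) x) <= e / 2 by near: s.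
  have d2 : `|X t - X s| <= e / 2 / (2 * K + 1) by near: s.
  rewrite -(subrKA (a (clamp T t) (X s))) (le_trans (normcD _ _))// [X in _ <= X]splitr lerD//.
  apply: (le_trans (cder_lipschitz (csmooth_cdf (coef_csmooth t)) (hK t) _ _)).
  rewrite distrC; apply: (@le_trans _ _ ((2 * K + 1) * (e / 2 / (2 * K + 1)))).
    by rewrite ler_pM ?mulr_ge0// lerDl.
  by rewrite mulrC divfK// gt_eqF.
split=> t; apply/cvgrPdist_le => e e0; apply: filterS (key t e e0) => s h.
- by rewrite -normrN opprB -ReN -ReD (le_trans (normc_Re _)).
- by rewrite -normrN opprB -ImN -ImD (le_trans (normc_Im _)).
Unshelve. all: by end_near. Qed.

End Coefficients.

Lemma continuous_pr_moving xi (X dX : R -> R) (c dc : R -> R[i]) b w (u : R -> R -> R[i]) K s1 s2 t :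
  (forall s, L2 (u s)) -> csmooth b -> (forall y, w < `|y| -> b y = 0) ->
  0 <= w -> 2 * w <= 1 ->
  (forall s, s1 < s < s2 -> is_cder c s (dc s)) ->
  (forall s, s1 < s < s2 -> is_derive s 1 X (dX s)) ->
  (forall s, s1 < s < s2 -> [/\ normc (c s) <= K, normc (dc s) <= K, `|X s| <= K & `|dX s| <= K]) ->
  s1 < t < s2 ->
  L2norm (fun x => u t' x - u t x) @[t' --> t] --> (0 : R) ->
  {for t, continuous (fun s => pr (u s) (packet xi (X s) (c s) b))}.
Proof.
move=> hu sb hb w0 w1 hc hX hK ht lim.
have [B B0 hB] := csmooth_bounded sb hb.
have K0 : 0 <= K by have [h _ _ _] := hK t ht; apply: le_trans h; exact: normc_ge0.
have LZ s : L2 (packet xi (X s) (c s) b) by exact/ctest_L2/(packet_ctest _ _ _ sb hb).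
have Ldiff s : L2 (fun x => u s x - u t x).
  exact: L2B.
have [dv _] := is_derive_pr_packet xi (hu t) sb hb hc hX hK ht.
have cv : {for t, continuous (fun s => pr (u t) (packet xi (X s) (c s) b))}.
  exact/differentiable_continuous/derivable1_diffP.
apply/cvgrPdist_le => e e0.
have KB : 0 < K * B + 1 by rewrite ltr_wpDl// mulr_ge0.
have e2 : 0 < e / 2 by rewrite divr_gt0.
have /cvgrPdist_le /(_ _ e2) n2 := cv.
have /cvgrPdist_le /(_ _ (divr_gt0 e2 KB)) n1 := lim.
have /andP[t1 t2] := ht.
near=> s.
have hs : s1 < s < s2.
  by apply/andP; split; near: s; [exact: lt_nbhsr|exact: lt_nbhsl].
have q1 : `|0 - L2norm (fun x => u s x - u t x)| <= e / 2 / (K * B + 1) by near: s; exact: n1.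
have q2 : `|pr (u t) (packet xi (X t) (c t) b) - pr (u t) (packet xi (X s) (c s) b)| <= e / 2.
  by near: s; exact: n2.
rewrite -(subrKA (pr (u t) (packet xi (X s) (c s) b))) (le_trans (ler_normD _ _))//.
rewrite [X in _ <= X]splitr lerD//.
have -> : pr (u t) (packet xi (X s) (c s) b) - pr (u s) (packet xi (X s) (c s) b) =
   - pr (fun x => u s x - u t x) (packet xi (X s) (c s) b).
  by rewrite prBl// opprB.
rewrite normrN (le_trans (pr_bound (Ldiff s) (LZ s)))//.
have [k1 _ _ _] := hK s hs.
rewrite sub0r normrN ger0_norm ?L2norm_ge0// in q1.
apply: (@le_trans _ _ (e / 2 / (K * B + 1) * (K * B + 1))); last by rewrite divfK// gt_eqF.
rewrite ler_pM ?L2norm_ge0//.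
apply: (le_trans (packet_L2norm _ _ _ sb hb w0 w1 B0 hB)).
by rewrite (le_trans (ler_wpM2r B0 k1))// lerDl.
Unshelve. all: by end_near. Qed.

End Clamp.

(** * The hierarchy of pairings *)

Section Hierarchy.
Variable R : realType.
Implicit Types (b : R -> R[i]) (t B : R) (n k : nat).

Lemma le_of_is_derive (f g df dg : R -> R) (te : R) : 0 < te ->
  {within `[0, te], continuous f} -> {within `[0, te], continuous g} ->
  (forall t, 0 < t < te -> is_derive t 1 f (df t)) ->
  (forall t, 0 < t < te -> is_derive t 1 g (dg t)) ->
  (forall t, 0 < t < te -> df t <= dg t) -> f 0 <= g 0 ->
  forall t, 0 <= t <= te -> f t <= g t.
Proof.
move=> te0 cf cg hf hg h h0 t /andP[t0 tte].
move: t0; rewrite le_eqVlt => /predU1P[<-//|t0].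
have sub : `[0, t] `<=` `[0, te].
  by move=> s /=; rewrite !in_itv /= => /andP[-> /le_trans]; apply.
have c : {within `[0, t], continuous (f - g)}.
  have cf' := continuous_subspaceW sub cf; have cg' := continuous_subspaceW sub cg.
  by move=> s; apply: cvgB; [exact: cf'|exact: cg'].
have d s : s \in `]0, t[ -> is_derive s 1 (f - g) (df s - dg s).
  rewrite in_itv /= => /andP[s0 st]; have hs : 0 < s < te by rewrite s0 (lt_le_trans st).
  by apply: is_deriveB; [exact: hf|exact: hg].
have [s] := MVT t0 d c.
rewrite in_itv /= subr0 => /andP[s0 st] e.
have hs : 0 < s < te by rewrite s0 (lt_le_trans st).
have e' : f t - g t - (f 0 - g 0) = (df s - dg s) * t := e.
have : (df s - dg s) * t <= 0 by rewrite mulr_le0_ge0 ?subr_le0 ?h// ltW.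
by rewrite -e'; lra.
Qed.

Variables (W w te eta : R) (p Nm : nat).
Variables (F S : (R -> R[i]) -> R -> R) (A : R -> (R -> R[i]) -> R -> R[i]).
Variables (sig H : R -> R).

Definition Cl n B b := [/\ csmooth b, forall y, w < `|y| -> b y = 0 & cb W w n B b].

Hypothesis te0 : 0 < te.
Hypothesis eta0 : 0 <= eta.
Hypothesis F0 : forall n B b, Cl n B b -> F b 0 = 0.
Hypothesis Fd : forall n B b t, Cl n B b -> 0 < t < te ->
  is_derive t 1 (F b) (S b t + F (A t b) t).
Hypothesis Fc : forall n B b, Cl n B b -> {within `[0, te], continuous (F b)}.
Hypothesis Fb : forall B b t, 0 <= B -> Cl 0 B b -> 0 <= t <= te -> `|F b t| <= B.
Hypothesis Ab : forall n B b t, (n + p.+1 <= Nm)%N -> 0 <= B ->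
  Cl (n + p.+1) B b -> 0 < t < te -> Cl n (eta * B) (A t b).
Hypothesis Sb : forall n B b t, 0 <= B -> Cl n B b -> 0 < t < te -> `|S b t| <= sig t * B.
Hypothesis H0 : H 0 = 0.
Hypothesis Hd : forall t, 0 < t < te -> is_derive t 1 H (sig t).
Hypothesis Hc : {within `[0, te], continuous H}.
Hypothesis sig0 : forall t, 0 < t < te -> 0 <= sig t.
Hypothesis small : eta * te <= 2^-1.

Lemma H_le t : 0 <= t <= te -> 0 <= H t <= H te.
Proof.
move=> ht.
have cst0 (c : R) : {within `[0, te], continuous (fun=> c)}.
  by apply: continuous_subspaceT => ?; exact: cvg_cst.
have h1 : forall t, 0 <= t <= te -> 0 <= H t.
  apply: (@le_of_is_derive (fun=> 0) H (fun=> 0) sig te) => //.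
  by rewrite H0.
rewrite h1//=; have /andP[t0 t1] := ht.
move: t1; rewrite le_eqVlt => /predU1P[->//|t1].
have sub : `[t, te] `<=` `[0, te].
  by move=> s /=; rewrite !in_itv /= => /andP[/(le_trans t0) -> ->].
have hd s : s \in `]t, te[ -> is_derive s 1 H (sig s).
  by rewrite in_itv /= => /andP[/(le_lt_trans t0) s1 s2]; apply: Hd; rewrite s1 s2.
have [s] := MVT t1 hd (continuous_subspaceW sub Hc).
rewrite in_itv /= => /andP[s1 s2] e.
by rewrite -subr_ge0 e mulr_ge0 ?sig0 ?subr_ge0 ?(ltW t1)// s2 (le_lt_trans t0).
Qed.

Lemma scale_within (c : R) : {within `[0, te], continuous (fun t : R => c * t)}.
Proof.
apply: continuous_subspaceT; apply: derivable_continuous => t.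
by have [] := is_derive_affine c 0 t; under eq_fun do rewrite addr0.
Qed.

Let Hte : 0 <= H te.
Proof.
by have /andP[] : 0 <= H te <= H te by apply: H_le; rewrite lexx (ltW te0).
Qed.

Let bnd k := 2 * H te + (eta * te) ^+ k.

Let bnd0 k : 0 <= bnd k.
Proof.
by rewrite addr_ge0 ?mulr_ge0 ?exprn_ge0 ?mulr_ge0// ltW.
Qed.

(* [p.+1] derivatives of the profile are spent on each application of [A]. *)
Lemma hierarchy_upper k B b t : 0 <= B -> (k * p.+1 <= Nm)%N ->
  Cl (k * p.+1) B b -> 0 <= t <= te -> `|F b t| <= B * (2 * H te + (eta * te) ^+ k).
Proof.
elim: k B b t => [|k IH] B b t B0 kN hb ht.
  by rewrite (le_trans (Fb B0 hb ht))// expr0 ler_peMr//; have := Hte; lra.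
have kN' : (k * p.+1 + p.+1 <= Nm)%N by rewrite mulSn addnC in kN.
have hb' : Cl (k * p.+1 + p.+1) B b by rewrite mulSn addnC in hb.
pose K := eta * B * bnd k.
have K0 : 0 <= K by rewrite mulr_ge0// mulr_ge0.
have df s : 0 < s < te -> `|S b s + F (A s b) s| <= B * sig s + K.
  move=> hs; rewrite (le_trans (ler_normD _ _))// lerD//.
    by rewrite mulrC; exact: Sb hb hs.
  have hs' : 0 <= s <= te by case/andP: hs => /ltW -> /ltW ->.
  apply: IH => //; [exact: mulr_ge0|by rewrite (leq_trans _ kN')// leq_addr|].
  exact: Ab.
pose G (s : R) := B * H s + K * s.
have dG s : 0 < s < te -> is_derive s 1 G (B * sig s + K).
  move=> hs; apply: (is_derive_eq (is_deriveD (is_deriveZ B (Hd hs)) (is_deriveZ K (is_derive_id s (1:R))))).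
  by rewrite /GRing.scale /= mulr1.
have cG : {within `[0, te], continuous G}.
  move=> s; apply: cvgD.
    by apply: cvgM; [exact: cvg_cst|exact: Hc].
  exact: (@scale_within K s).
have G0 : G 0 = 0 by rewrite /G H0 !mulr0 addr0.
have cN : {within `[0, te], continuous (fun s => - F b s)}.
  by move=> s; apply: cvgN; exact: Fc hb s.
have u1 := @le_of_is_derive (F b) G _ _ te te0 (Fc hb) cG (fun s hs => Fd hb hs) dG
  (fun s hs => le_trans (ler_norm _) (df s hs)).
have u2 := @le_of_is_derive (fun s => - F b s) G _ _ te te0 cN cG
  (fun s hs => is_deriveN (Fd hb hs)) dG.
have F00 := F0 hb.
have l1 : F b t <= G t by apply: (u1 _ _ ht); rewrite F00 G0.
have l2 : - F b t <= G t.
  apply: (u2 _ _ _ ht); last by rewrite F00 G0 oppr0.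
  by move=> s hs; apply: le_trans (df s hs); rewrite -normrN; exact: ler_norm.
have FG : `|F b t| <= G t by rewrite ler_norml lerNl l2 l1.
apply: (le_trans FG); rewrite /G.
have /andP[t0 t1] := ht.
have /andP[_ Ht] := H_le ht.
apply: (@le_trans _ _ (B * H te + K * te)).
  by rewrite lerD// ler_wpM2l.
have -> : B * H te + K * te = B * (H te + (eta * te) * (2 * H te) + (eta * te) ^+ k.+1).
  by rewrite /K /bnd exprS; ring.
rewrite ler_wpM2l// lerD2r.
have : (eta * te) * (2 * H te) <= 2^-1 * (2 * H te) by rewrite ler_wpM2r// mulr_ge0.
have -> : 2^-1 * (2 * H te) = H te by field.
set q := eta * te * _; lra.
Qed.

Lemma hierarchy_lower k B b (kap : R) : 0 <= B -> (k.+1 * p.+1 <= Nm)%N ->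
  Cl (k.+1 * p.+1) B b -> (forall t, 0 < t < te -> kap * sig t <= S b t) ->
  kap * H te <= F b te + eta * te * B * (2 * H te + (eta * te) ^+ k).
Proof.
move=> B0 kN hb hS.
have kN' : (k * p.+1 + p.+1 <= Nm)%N by rewrite mulSn addnC in kN.
have hb' : Cl (k * p.+1 + p.+1) B b by rewrite mulSn addnC in hb.
pose K := eta * B * bnd k.
pose G (s : R) := F b s + K * s.
have dG s : 0 < s < te -> is_derive s 1 G (S b s + F (A s b) s + K).
  move=> hs; apply: (is_derive_eq (is_deriveD (Fd hb hs) (is_deriveZ K (is_derive_id s (1:R))))).
  by rewrite /GRing.scale /= mulr1.
have cG : {within `[0, te], continuous G}.
  move=> s; apply: cvgD; first exact: Fc hb s.
  exact: (@scale_within K s).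
have cH : {within `[0, te], continuous (fun s => kap * H s)}.
  by move=> s; apply: cvgM; [exact: cvg_cst|exact: Hc].
have dH s : 0 < s < te -> is_derive s 1 (fun s => kap * H s) (kap * sig s).
  by move=> hs; exact: (is_deriveZ kap (Hd hs)).
have := @le_of_is_derive _ G _ _ te te0 cH cG dH dG.
have h s : 0 < s < te -> kap * sig s <= S b s + F (A s b) s + K.
  move=> hs; have hs' : 0 <= s <= te by case/andP: hs => /ltW -> /ltW ->.
  have : `|F (A s b) s| <= K.
    apply: hierarchy_upper => //; [exact: mulr_ge0|by rewrite (leq_trans _ kN')// leq_addr|].
    exact: Ab.
  rewrite ler_norml => /andP[h1 _]; have := hS s hs; lra.
move=> /(_ h); rewrite H0 mulr0 /G (F0 hb) mulr0 addr0 => /(_ (lexx _) te).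
rewrite lexx (ltW te0) => /(_ isT); rewrite /K /bnd.
by rewrite (_ : eta * B * _ * te = eta * te * B * (2 * H te + (eta * te) ^+ k)); last ring.
Qed.

End Hierarchy.

(** * Transport along a ray *)

Section Primitive.
Variable R : realType.
Local Notation mu := (@lebesgue_measure R).
Implicit Types (f : R -> R) (s t N : R).

Definition prim f t : R :=
  if 0 <= t then (\int[mu]_(s in `]0%R, t]) f s)%R else - (\int[mu]_(s in `]t, 0%R]) f s)%R.

Lemma primE f N t : continuous f -> N <= t -> N <= 0 ->
  prim f t = (\int[mu]_(s in `[N, t]) f s)%R - (\int[mu]_(s in `[N, 0%R]) f s)%R.
Proof.
move=> cf Nt N0; rewrite /prim; case: ifPn => [t0|]; last rewrite -ltNge => t0.
- rewrite (Rintegral_itvB (continuous_integrable _ _ cf))//.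
- rewrite -[RHS]opprB; congr (- _).
  rewrite (Rintegral_itvB (continuous_integrable _ _ cf))//.
  by rewrite bnd_simp ltW.
Qed.

Lemma prim0 f : prim f 0 = 0.
Proof. by rewrite /prim lexx set_itvoc0 Rintegral_set0. Qed.

Lemma is_derive_prim f t : continuous f -> is_derive t 1 (prim f) (f t).
Proof.
move=> cf; pose N := - `|t| - 1.
have N0 : N <= 0 by rewrite /N; have := normr_ge0 t; lra.
have Nt : N < t by rewrite /N; have := ler_norm (- t); rewrite normrN; lra.
apply: (@near_eq_is_derive _ _ _
  (fun t => (\int[mu]_(s in `[N, t]) f s)%R - (\int[mu]_(s in `[N, 0%R]) f s)%R)).
  by near=> s; rewrite (primE cf _ N0)//; apply: ltW; near: s; exact: lt_nbhsr.
have t1 : t < t + 1 by rewrite ltrDl.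
have [d e] := @continuous_FTC1_closed R f N t (t + 1) t1 (continuous_integrable _ _ cf) Nt (cf t).
apply: (is_derive_eq (is_deriveB (DeriveDef d _) (is_derive_cst _ t 1))); last by rewrite subr0.
by rewrite -derive1E.
Unshelve. all: by end_near. Qed.

Lemma continuous_prim f : continuous f -> continuous (prim f).
Proof.
by move=> cf; apply: derivable_continuous => t; have [] := is_derive_prim t cf.
Qed.

End Primitive.

Section ExponentialWeight.
Variable R : realType.
Implicit Types (t : R).

Definition expcis (g k : R -> R) t : R[i] := (expR (g t))%:C * cis (k t).

Lemma normc_expcis g k t : normc (expcis g k t) = expR (g t).
Proof. by rewrite normcM normc_cis mulr1 normcR ger0_norm// expR_ge0. Qed.

Lemma is_cder_expcis g k t dg dk : is_derive t 1 g dg -> is_derive t 1 k dk ->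
  is_cder (expcis g k) t ((dg +i* dk) * expcis g k t).
Proof.
move=> hg hk.
have h1 : is_cder (fun t => (expR (g t))%:C) t (dg * expR (g t))%:C.
  apply: is_cder_real.
  by apply: (is_derive_eq (is_derive1_comp (is_derive_expR _) hg)); rewrite mulrC.
have h2 := is_cder_comp (is_cder_cis (k t)) hk.
apply: (is_cder_eq (is_cderM h1 h2)).
rewrite /expcis rmorphM /=.
have -> : dg +i* dk = dg%:C + 'i%C * dk%:C by apply/eqP; rewrite eq_complex /=; apply/andP; split; apply/eqP; ring.
by ring.
Qed.

End ExponentialWeight.

Lemma sum4_le (R : realType) (e y z1 z2 m : R) : 0 <= e -> 0 <= y -> 0 <= z1 -> 0 <= z2 ->
  e + y + (z1 + z2) <= m -> [/\ e <= m, y <= m, z1 <= m & z2 <= m].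
Proof. by move=> *; split; lra. Qed.

Section PacketAlongRay.
Variable R : realType.
Local Notation mu := (@lebesgue_measure R).
Implicit Types (t x s : R) (b : R -> R[i]) (n j : nat).

Variables (p : nat) (T : R) (ap : R -> R) (a : nat -> R -> R -> R[i]).
Hypotheses (hp : (2 <= p)%N) (hT : 0 < T).
Hypothesis hap : {within `[0, T], continuous ap}.
Hypothesis ha : forall j, (j < p)%N -> C0T T (@Binf R) (@Bnorm R) (a j).

Let T0 : 0 <= T. Proof. exact: ltW. Qed.
Let pp : (p.-1 < p)%N. Proof. by rewrite prednK// ltnW. Qed.
Let p0 : (0 < p)%N. Proof. exact: ltnW. Qed.

Definition cap t := ap (clamp T t).

Lemma continuous_cap : continuous cap.
Proof.
move=> t; apply: (@clamp_cvg _ T t ap (ap (clamp T t)) T0).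
move/subspace_continuousP : hap; apply.
by have := clamp_itv t T0; rewrite /= in_itv.
Qed.

Variables (xi xs g0 : R).
Hypothesis xi0 : 0 < xi.

Definition ray t := xs + p%:R * xi ^+ p.-1 * prim cap t.

Lemma is_derive_ray t : is_derive t 1 ray (p%:R * xi ^+ p.-1 * cap t).
Proof.
apply: (is_derive_eq (is_deriveD (is_derive_cst xs t 1)
  (is_deriveZ (p%:R * xi ^+ p.-1) (is_derive_prim t continuous_cap)))).
by rewrite add0r.
Qed.

Lemma continuous_ray : continuous ray.
Proof. by apply: derivable_continuous => t; have [] := is_derive_ray t. Qed.

Definition qray t := a p.-1 (clamp T t) (ray t).

Lemma continuous_qray : continuous (fun t => Re (qray t)) /\
  continuous (fun t => Im (qray t)).
Proof. exact: (coef_path_continuous T0 (ha pp) continuous_ray). Qed.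

(* [amp] solves the transport equation which makes the leading part of
   [ampopE] cancel; its modulus is governed by [growth]. *)
Definition growth t := prim (fun t => Im (qray t)) t.
Definition amp t := expcis
  (fun t => g0 + (- xi ^+ p.-1) * growth t)
  (fun t => xi ^+ p * prim cap t + xi ^+ p.-1 * prim (fun t => Re (qray t)) t) t.

Lemma normc_amp t : normc (amp t) = expR (g0 - xi ^+ p.-1 * growth t).
Proof. by rewrite normc_expcis mulNr. Qed.

Definition damp t := ('i%C * ((xi ^+ p * cap t)%:C + (xi ^+ p.-1)%:C * qray t)) * amp t.

Lemma is_cder_amp t : is_cder amp t (damp t).
Proof.
have [cR cI] := continuous_qray.
have hg := is_deriveD (is_derive_cst g0 t 1) (is_deriveZ (- xi ^+ p.-1) (is_derive_prim t cI)).
have hk := is_deriveD (is_deriveZ (xi ^+ p) (is_derive_prim t continuous_cap))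
   (is_deriveZ (xi ^+ p.-1) (is_derive_prim t cR)).
apply: (is_cder_eq (is_cder_expcis hg hk)); congr (_ * _).
rewrite add0r /GRing.scale /=.
by apply/eqP; rewrite eq_complex ReM ImM !ReD !ImD !ReM !ImM /=;
  apply/andP; split; apply/eqP; ring.
Qed.

Lemma amp_bound s1 s2 : s1 <= s2 -> exists K, forall s, s1 < s < s2 ->
  [/\ normc (amp s) <= K, normc (damp s) <= K, `|ray s| <= K &
      `|p%:R * xi ^+ p.-1 * cap s| <= K].
Proof.
move=> s12; have [cR cI] := continuous_qray.
pose E t := expR (g0 + (- xi ^+ p.-1) * growth t).
pose Y t := `|xi ^+ p| * `|cap t| + `|xi ^+ p.-1| * (`|Re (qray t)| + `|Im (qray t)|).
pose Z t := `|ray t| + `|p%:R * xi ^+ p.-1 * cap t|.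
have cN (f : R -> R) : continuous f -> continuous (fun t => `|f t|).
  by move=> cf t; apply: cvg_norm; exact: cf.
have cE : continuous E.
  move=> t; apply: (@continuous_comp _ _ _ (fun t => g0 + (- xi ^+ p.-1) * growth t) expR).
    apply: cvgD; first exact: cvg_cst.
    by apply: cvgM; [exact: cvg_cst|exact: continuous_prim].
  exact: continuous_expR.
have cY : continuous Y.
  move=> t; apply: cvgD; apply: cvgM; try exact: cvg_cst.
    exact: cN continuous_cap t.
  by apply: cvgD; [exact: cN cR t|exact: cN cI t].
have cZ : continuous Z.
  move=> t; apply: cvgD; first exact: cN continuous_ray t.
  apply: cvg_norm; apply: cvgM; first exact: cvg_cst.
  exact: continuous_cap.
have cS : continuous (fun t => E t + Y t * E t + Z t).
  move=> t; apply: cvgD; last exact: cZ.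
  by apply: cvgD; [exact: cE|apply: cvgM; [exact: cY|exact: cE]].
have [m _ hm] := EVT_max s12 (continuous_subspaceT cS).
exists (E m + Y m * E m + Z m) => s /andP[h1 h2].
have {}hm := hm s (_ : s \in `[s1, s2]).
rewrite in_itv /= (ltW h1) (ltW h2) in hm; have {}hm := hm isT.
have E0 : 0 <= E s by exact: expR_ge0.
have Y0 : 0 <= Y s by rewrite addr_ge0 ?mulr_ge0 ?addr_ge0.
have YE : 0 <= Y s * E s by exact: mulr_ge0.
have n1 : normc (amp s) = E s by rewrite normc_expcis.
have n2 : normc (damp s) <= Y s * E s.
  rewrite normcM n1 ler_wpM2r// normcM normc_i mul1r (le_trans (normcD _ _))//.
  by rewrite normcR normrM normcM normcR lerD2l ler_wpM2l// normc_le.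
have z1 := normr_ge0 (ray s); have z2 := normr_ge0 (p%:R * xi ^+ p.-1 * cap s).
have [k1 k2 k3 k4] := sum4_le E0 YE z1 z2 hm.
by split; [rewrite n1|exact: le_trans n2 k2| |].
Qed.

Variables (f : R -> R -> R[i]) (g : R -> R[i]) (u : R -> R -> R[i]).
Hypothesis hf : forall t, 0 <= t <= T -> L2 (f t).
Hypothesis hg : forall x, g x = 0.
Hypothesis hu : solution p T ap a f g u.

Variable w : R.
Hypotheses (w0 : 0 <= w) (w1 : 2 * w <= 1).

Definition Fray b t := pr (u (clamp T t)) (packet xi (ray t) (amp t) b).
Definition Sray b t := pr (f (clamp T t)) (packet xi (ray t) ('i%C * amp t) b).
Definition Aray t b := ampop xi p (cap t) (fun j y => a j (clamp T t) (y + ray t)) b.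

Let Lu t : L2 (u (clamp T t)).
Proof.
have [[h _] _ _] := hu; apply: Hinf_L2; apply: h; exact: clamp_itv.
Qed.

Lemma Fray0 b : csmooth b -> (forall y, w < `|y| -> b y = 0) -> Fray b 0 = 0.
Proof.
move=> sb hb; rewrite /Fray.
have [_ _ e] := hu.
have c0 : clamp T 0 = 0 by rewrite clamp_id// lexx.
have L0 : L2 (fun=> 0 : R[i]) by exact/ctest_L2/ctest_cst0.
have Lz := ctest_L2 (packet_ctest xi (ray 0) (amp 0) sb hb).
rewrite (pr_ae (Lu 0) L0 Lz); last first.
  rewrite c0; apply: filterS e; first exact: (ae_filter_ringOfSetsType mu).
  by move=> x /= ->.
rewrite -[RHS](mul0r (pr (u (clamp T 0)) (packet xi (ray 0) (amp 0) b))).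
rewrite -pr_real// -prA; congr pr; apply/funext => x.
by rewrite rmorph0 mul0r.
Qed.

Lemma Fray_continuous b t : csmooth b -> (forall y, w < `|y| -> b y = 0) ->
  {for t, continuous (Fray b)}.
Proof.
move=> sb hb.
have t12 : t - 1 <= t + 1 by lra.
have [K hK] := amp_bound t12.
have ht : t - 1 < t < t + 1 by rewrite ltrBlDr ltrDl ltr01.
have lim : L2norm (fun x => u (clamp T s) x - u (clamp T t) x) @[s --> t] --> (0 : R).
  have [[h1 h2] _ _] := hu.
  have := clamp_cvg T0 (h2 0 _ (clamp_itv t T0)).
  rewrite (_ : (fun s => Hnorm 0 _) = fun s => L2norm (fun x => u (clamp T s) x - u (clamp T t) x))//.
  by apply/funext => s; apply: Hnorm0E; exact: L2B.
exact: (@continuous_pr_moving _ xi ray _ amp damp b w _ K _ _ t Lu sb hb w0 w1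
   (fun s _ => is_cder_amp s) (fun s _ => is_derive_ray s) hK ht lim).
Qed.

Lemma is_derive_Fray b t : csmooth b -> (forall y, w < `|y| -> b y = 0) ->
  0 < t < T -> is_derive t 1 (Fray b) (Sray b t + Fray (Aray t b) t).
Proof.
move=> sb hb ht; have /andP[t0 tT] := ht.
have ht' : 0 <= t <= T by rewrite !ltW.
have ct : clamp T t = t by exact: clamp_id.
have [[h1 h2] h3 _] := hu.
have [v [hv lim] e] := h3 t ht'.
have Lv := Hinf_L2 hv.
have sa j : (j < p)%N -> csmooth (a j t).
  by move=> jp; have := coef_csmooth T0 (ha jp) t; rewrite ct.
have [K hK] := amp_bound T0.
have hlim : L2norm (fun x => 'i%C^-1 * ((t' - t)^-1)%:C * (u (clamp T t') x - u (clamp T t) x) - v x)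
    @[t' --> t^'] --> (0 : R).
  have := lim 0; rewrite ct => /cvgrPdist_le l.
  apply/cvgrPdist_le => ep ep0; have := l ep ep0.
  rewrite !near_withinE => l'.
  have n1 : \forall s \near t, 0 < s by exact: lt_nbhsr.
  have n2 : \forall s \near t, s < T by exact: lt_nbhsl.
  near=> s => st.
  have s0 : 0 < s by near: s.
  have sT : s < T by near: s.
  have hs : 0 <= s <= T by rewrite !ltW.
  have : s != t -> `[0, T]%classic s -> `|0 - Hnorm 0 (fun x => 'i%C^-1 * ((s - t)^-1)%:C * (u s x - u t x) - v x)| <= ep.
    by near: s.
  move=> /(_ st); rewrite /= in_itv /= => /(_ hs).
  rewrite (clamp_id hs) Hnorm0E//.
  have L1 := Lu s; have L2' := Lu t; rewrite (clamp_id hs) in L1; rewrite ct in L2'.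
  exact: L2B (L2Z _ (L2B L1 L2')) Lv.
have D := @is_derive_pr_moving _ xi ray _ amp damp b w _ v K _ _ t Lu Lv sb hb w0 w1 (fun s _ => is_cder_amp s)
   (fun s _ => is_derive_ray s) hK ht hlim.
apply: (is_derive_eq D).
rewrite ct (pr_equation xi (ray t) ('i%C * amp t) (h1 t ht') Lv (hf ht') sb hb sa e).
rewrite /Sray ct -addrA; congr (_ + _).
set P := fun y => _ + \sum_(j < p) _.
rewrite /Fray ct.
have sP : ctest (packet xi (ray t) ('i%C * amp t) P).
  apply: (@packet_ctest _ _ _ _ _ w).
    apply: csmoothD; first exact/csmoothZ/csmooth_Qpow.
    apply: csmooth_sum => j; apply: csmooth_Qpow; apply: csmoothM => //.
    exact/csmooth_shift/sa.
  move=> y hy; rewrite /P (Qpow_far _ _ sb hb)// mulr0 add0r big1 // => j _.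
  apply: Qpow_far hy; last by move=> z /hb ->; rewrite mulr0.
  by apply: csmoothM => //; exact/csmooth_shift/sa.
have sD : ctest (packet xi (ray t) 1
    (fun y => damp t * b y + (- (amp t * (p%:R * xi ^+ p.-1 * cap t)%:C)) * cder b y)).
  apply: (@packet_ctest _ _ _ _ _ w).
    by apply: csmoothD; apply: csmoothZ => //; exact: csmooth_cder.
  by move=> y hy; rewrite hb// (cder_eq0 (@open_far _ w) hb)// !mulr0 addr0.
have Lut := Lu t; rewrite ct in Lut.
have eN : - pr (u t) (packet xi (ray t) ('i%C * amp t) P) =
    pr (u t) (fun x => (-1)%:C * packet xi (ray t) ('i%C * amp t) P x).
  by rewrite pr_real ?mulN1r//; exact: ctest_L2.
rewrite addrC eN -prDr//; [|exact: ctest_L2|exact/L2Z/ctest_L2].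
congr pr; apply/funext => x; rewrite /packet mul1r.
rewrite /Aray ampopE//; last by rewrite gt_eqF.
rewrite /P /damp /qray ct add0r rmorphN rmorph1.
rewrite !(rmorphM (real_complex R)) /= (_ : cap t = ap t); last by rewrite /cap ct.
by ring.
Unshelve. all: by end_near. Qed.

End PacketAlongRay.

Lemma four_points (R : realType) (y1 y2 z1 z2 l E : R) :
  y1 - z1 <= E -> - E <= y2 - z2 -> l <= z2 - z1 -> l - 2 * E <= y2 - y1.
Proof. by move=> *; lra. Qed.

Lemma quotient_bound (R : realType) (D l E d y : R) : 0 < d -> y = D * d ->
  l * d - 2 * E <= y -> l - 2 * E / d <= D.
Proof. by move=> d0 -> h; rewrite -(ler_pM2r d0) mulrBl divfK ?gt_eqF. Qed.

(** * Choice of the ray *)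

Section Averaging.
Variable R : realType.
Local Notation mu := (@lebesgue_measure R).
Implicit Types (s t x y m : R).

Lemma constant_sign (f : R -> R) m : continuous f -> 0 < m -> (forall t, m <= `|f t|) ->
  exists2 e : R, e * e = 1 & forall t, f t = e * `|f t|.
Proof.
move=> cf m0 fm.
have nz t : f t != 0 by rewrite -normr_gt0 (lt_le_trans m0).
have H x y : f x < 0 -> 0 < f y -> False.
  move=> fx fy; have [xy|yx] := leP x y.
  - have [|c _ fc] := IVT xy (continuous_subspaceT cf) (_ : Num.min (f x) (f y) <= 0 <= Num.max (f x) (f y)).
      by rewrite ge_min le_max (ltW fx) (ltW fy) orbT.
    by have := nz c; rewrite fc eqxx.
  - have [|c _ fc] := IVT (ltW yx) (continuous_subspaceT cf) (_ : Num.min (f y) (f x) <= 0 <= Num.max (f y) (f x)).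
      by rewrite ge_min le_max (ltW fx) (ltW fy) orbT.
    by have := nz c; rewrite fc eqxx.
have [f0|f0|f0] := ltgtP (f 0) 0.
- exists (-1); first by rewrite mulrNN mulr1.
  move=> t; rewrite mulN1r; have [ft|ft|ft] := ltgtP (f t) 0.
  + by rewrite ltr0_norm// opprK.
  + by case: (H 0 t).
  + by have := nz t; rewrite ft eqxx.
- exists 1; first by rewrite mulr1.
  move=> t; rewrite mul1r; have [ft|ft|ft] := ltgtP (f t) 0.
  + by case: (H t 0).
  + by rewrite gtr0_norm.
  + by have := nz t; rewrite ft eqxx.
- by have := nz 0; rewrite f0 eqxx.
Qed.

Lemma ge_of_derivative_bound (f df : R -> R) m :
  (forall x : R, is_derive x 1 f (df x)) -> (forall x, m <= df x) ->
  forall x y, x <= y -> m * (y - x) <= f y - f x.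
Proof.
move=> h1 h2 x y; rewrite le_eqVlt => /predU1P[->|xy]; first by rewrite !subrr mulr0.
have cf : continuous f by apply: derivable_continuous => z; have [] := h1 z.
have [|z _ ->] := MVT xy (fun z _ => h1 z); first exact: continuous_subspaceT.
by rewrite ler_wpM2r// subr_ge0 ltW.
Qed.

(* Reparametrizes time so that the rays have constant velocity. *)
Lemma inverse_of_increasing (f df : R -> R) m : 0 < m ->
  (forall x : R, is_derive x 1 f (df x)) -> (forall x, m <= df x) ->
  exists k : R -> R, [/\ cancel f k, cancel k f & forall y, is_derive y 1 k (df (k y))^-1].
Proof.
move=> m0 h1 h2; have G := ge_of_derivative_bound h1 h2.
have cf : continuous f by apply: derivable_continuous => z; have [] := h1 z.
have surj y : exists x, f x = y.
  pose N := (`|y| + `|f 0|) / m.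
  have N0 : 0 <= N by rewrite divr_ge0 ?addr_ge0// ltW.
  have mN : m * N = `|y| + `|f 0| by rewrite mulrC divfK// gt_eqF.
  have g1 := G 0 N N0; rewrite subr0 mN in g1.
  have NN0 : - N <= 0 by rewrite oppr_le0.
  have g2 := G (- N) 0 NN0; rewrite sub0r opprK mN in g2.
  have y1 := ler_norm y; have y2 := ler_norm (- y); rewrite normrN in y2.
  have f1 := ler_norm (f 0); have f2 := ler_norm (- f 0); rewrite normrN in f2.
  have hy : f (- N) <= y <= f N by apply/andP; split; lra.
  have NN : - N <= N by rewrite (le_trans NN0).
  have [|c _ fc] := IVT NN (continuous_subspaceT cf) (_ : Num.min (f (- N)) (f N) <= y <= Num.max (f (- N)) (f N)).
    by case/andP: hy => u1 u2; rewrite ge_min le_max u1 u2 orbT.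
  by exists c.
have [k hk] := choice surj.
have inj : injective f.
  move=> x y; wlog xy : x y / x <= y.
    by move=> h e; have [/h->//|/ltW/h->//] := leP x y.
  move=> e; have := G _ _ xy; rewrite e subrr pmulr_rle0// subr_le0 => yx.
  by apply/eqP; rewrite eq_le xy yx.
have fk : cancel f k by move=> x; apply: inj; exact: hk.
exists k; split=> // y; rewrite -{1}(hk y).
have n1 : \forall z \near k y, k (f z) = z by near=> z; exact: fk.
have n2 : \forall z \near k y, {for z, continuous f} by near=> z; exact: cf.
apply: (is_derive_inverse n1 n2 (h1 (k y))).
by rewrite gt_eqF// (lt_le_trans m0).
Unshelve. all: by end_near. Qed.

Lemma prim_dist (f g : R -> R) K t : continuous f -> continuous g ->
  (forall s, `|f s - g s| <= K) -> `|prim f t - prim g t| <= K * `|t|.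
Proof.
move=> cf cg h.
have D s := is_deriveB (is_derive_prim s cf) (is_derive_prim s cg).
have := le_of_derivative_bound D h t 0.
by rewrite -[_ t - _ 0]/((prim f t - prim g t) - (prim f 0 - prim g 0)) !prim0 !subr0.
Qed.

Lemma prim_lipschitz (f : R -> R) C s t : continuous f -> (forall s, `|f s| <= C) ->
  `|prim f s - prim f t| <= C * `|s - t|.
Proof.
by move=> cf h; exact: (le_of_derivative_bound (fun s => is_derive_prim s cf) h).
Qed.

Variables (b : R -> R -> R) (x : R -> R) (C C1 rho m : R) (k dk : R -> R).
Hypothesis C0 : 0 <= C.
Hypothesis C10 : 0 <= C1.
Hypothesis rho0 : 0 < rho.
Hypothesis m0 : 0 < m.
Hypothesis bc : forall X : R -> R, continuous X -> continuous (fun t => b t (X t)).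
Hypothesis bC : forall t y, `|b t y| <= C.
Hypothesis bL : forall t y z, `|b t y - b t z| <= C1 * `|y - z|.
Hypothesis cx : continuous x.
Hypothesis hk : forall s, is_derive s 1 k (dk s).
Hypothesis dk0 : forall s, 0 <= dk s.
Hypothesis dk1 : forall s, dk s <= m^-1.
Hypothesis cdk : continuous dk.

Let ck : continuous k.
Proof. by apply: derivable_continuous => s; have [] := hk s. Qed.

Let beta t th := prim (fun s => b s (x th)) t.

Let cb th : continuous (fun s => b s (x th)).
Proof. by apply: (bc (X := fun=> x th)) => ?; exact: cvg_cst. Qed.

Let cbeta (T : R -> R) : continuous T ->
  forall th : R, {for th, continuous (fun th : R => beta (T th) th)}.
Proof.
move=> cT th; apply/cvgrPdist_le => e e0.
pose M := `|T th| + 1.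
have M0 : 0 < M by rewrite ltr_wpDl.
have e2 : 0 < e / 2 by rewrite divr_gt0.
have d1 : 0 < e / 2 / (C + 1) by rewrite divr_gt0// ltr_wpDl.
have C1M : 0 < C1 * M + 1 by rewrite ltr_wpDl// mulr_ge0// ltW.
have d2 : 0 < e / 2 / (C1 * M + 1) by rewrite divr_gt0.
have /cvgrPdist_le /(_ _ d1) n1 := @cT th.
have /cvgrPdist_le /(_ _ ltr01) n3 := @cT th.
have /cvgrPdist_le /(_ _ d2) n2 := @cx th.
near=> s.
have q1 : `|T th - T s| <= e / 2 / (C + 1) by near: s; exact: n1.
have q2 : `|x th - x s| <= e / 2 / (C1 * M + 1) by near: s; exact: n2.
have q3 : `|T th - T s| <= 1 by near: s; exact: n3.
have TM : `|T s| <= M.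
  rewrite /M -[T s](subKr (T th)) (le_trans (ler_normB _ _))// lerD2l.
  exact: q3.
rewrite -(subrKA (beta (T s) th)) (le_trans (ler_normD _ _))// [X in _ <= X]splitr lerD//.
  apply: (le_trans (prim_lipschitz _ _ (@cb th) (fun r => bC r (x th)))).
  apply: (@le_trans _ _ ((C + 1) * (e / 2 / (C + 1)))).
    by rewrite ler_pM// lerDl.
  by rewrite mulrC divfK// gt_eqF// ltr_wpDl.
apply: (le_trans (prim_dist _ (@cb th) (@cb s) (fun r => bL r (x th) (x s)))).
apply: (@le_trans _ _ ((C1 * M + 1) * (e / 2 / (C1 * M + 1)))); last first.
  by rewrite mulrC divfK// gt_eqF.
rewrite mulrAC ler_pM//; first by rewrite mulr_ge0.
by rewrite (le_trans (ler_wpM2l C10 TM))// lerDl.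
Unshelve. all: by end_near. Qed.

Definition sweep c s := (\int[mu]_(th in `[(- rho), rho]) beta (k (s + c * th)) th)%R.

Let cshift (c s : R) : continuous (fun th : R => k (s + c * th)).
Proof.
move=> th; apply: (@continuous_comp _ _ _ (fun th : R => s + c * th) k); last exact: ck.
exact: continuous_line.
Qed.

Lemma is_derive_sweep c s : is_derive s 1 (sweep c)
  (\int[mu]_(th in `[(- rho), rho]) (dk (s + c * th) * b (k (s + c * th)) (x th)))%R.
Proof.
pose f (r th : R) : R := beta (k (r + c * th)) th.
pose f' (r th : R) : R := dk (r + c * th) * b (k (r + c * th)) (x th).
have hf (r th : R) : is_derive r 1 (f ^~ th) (f' r th).
  have h1 : is_derive r 1 (fun r : R => r + c * th) 1 by exact: is_derive_shift.
  have h2 := @is_derive1_comp _ k (fun r : R => r + c * th) r _ _ (hk (r + c * th)) h1.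
  have h3 := @is_derive1_comp _ _ (k \o (fun r : R => r + c * th)) r _ _
    (is_derive_prim (k (r + c * th)) (@cb th)) h2.
  by apply: (is_derive_eq h3); rewrite mulr1 mulrC.
pose G (th : R) := m^-1 * C.
have G0 th : 0 <= G th by rewrite mulr_ge0// invr_ge0 ltW.
have iG : mu.-integrable `[(- rho), rho] (EFin \o G).
  exact: cst_integrable.
have If r : `](s - 1), (s + 1)[%classic r -> mu.-integrable `[(- rho), rho] (EFin \o f r).
  by move=> _; apply: continuous_integrable; apply: cbeta; exact: cshift.
have Is : `](s - 1), (s + 1)[%classic s by rewrite /= in_itv /= ltrBlDr ltrDl ltr01.
have pE r th : partial1of2 f r th = f' r th.
  by rewrite partial1of2E; have [_ ->] := hf r th.
have i2 r th : `](s - 1), (s + 1)[%classic r -> `[(- rho), rho]%classic th -> derivable (f ^~ th) r 1.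
  by move=> _ _; have [] := hf r th.
have i3 r th : `](s - 1), (s + 1)[%classic r -> `[(- rho), rho]%classic th -> `|partial1of2 f r th| <= G th.
  move=> _ _; rewrite pE normrM ler_pM//.
  by rewrite ger0_norm.
have mI : measurable (`[(- rho), rho]%classic : set R) by exact: measurable_itv.
split; first exact: (@derivable_under_integral _ _ _ mu f _ mI s (s - 1) (s + 1) Is If i2 G G0 iG i3).
rewrite -derive1E.
rewrite (@differentiation_under_integral _ _ _ mu f _ mI s (s - 1) (s + 1) Is If i2 G G0 iG i3).
by apply: eq_Rintegral => th _; exact: pE.
Qed.

Lemma sweep_shift c s : 0 <= c -> `|sweep c s - sweep 0 s| <= C * m^-1 * c * rho * (2 * rho).
Proof.
move=> c0.
have I1 r : mu.-integrable `[(- rho), rho] (EFin \o (fun th => beta (k (s + r * th)) th)).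
  by apply: continuous_integrable; apply: cbeta; exact: cshift.
have mI : measurable (`[(- rho), rho]%classic : set R) by exact: measurable_itv.
have i2 : mu.-integrable `[(- rho), rho]
    (EFin \o (fun th => beta (k (s + c * th)) th - beta (k (s + 0 * th)) th)).
  apply: continuous_integrable => th.
  by apply: cvgB; apply: cbeta; exact: cshift.
have e1 : sweep c s - sweep 0 s =
    (\int[mu]_(th in `[(- rho), rho]) (beta (k (s + c * th)) th - beta (k (s + 0 * th)) th))%R.
  by rewrite /sweep RintegralB//; exact: I1.
rewrite e1; apply: (le_trans (le_normr_Rintegral _ i2)); first exact: measurable_itv.
have e2 : (\int[mu]_(th in `[(- rho), rho]) (C * m^-1 * c * rho))%R = C * m^-1 * c * rho * (2 * rho).
  by rewrite Rintegral_cst_itv ?ge0_cp ?(ltW rho0)//; ring.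
rewrite -e2; apply: le_Rintegral => //.
- by have := integrable_norm i2.
- exact: cst_integrable.
- move=> th; rewrite /= in_itv /= -ler_norml => hth.
  apply: (le_trans (prim_lipschitz _ _ (@cb th) (fun r => bC r (x th)))).
  rewrite -!mulrA ler_wpM2l//.
  have hk' r : `|dk r| <= m^-1 by rewrite ger0_norm.
  apply: (le_trans (le_of_derivative_bound hk hk' _ _)).
  rewrite ler_wpM2l ?invr_ge0 ?(ltW m0)//.
  have -> : s + c * th - (s + 0 * th) = c * th by ring.
  by rewrite normrM ger0_norm// ler_wpM2l.
Qed.

(* Sweeping the rays through the slab [k c1, k c2] x [-rho, rho] covers it, up
   to an error at the two ends, exactly as the slices t = const do; hence some
   ray sees at least the average of the slices. *)
Lemma exists_ray_average c s1 s2 l : 0 <= c -> s1 < s2 ->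
  (forall s, l <= \int[mu]_(th in `[(- rho), rho]) (dk s * b (k s) (x th)))%R ->
  exists2 s, s1 < s < s2 &
    l - 2 * (C * m^-1 * c * rho * (2 * rho)) / (s2 - s1) <=
    (\int[mu]_(th in `[(- rho), rho]) (dk (s + c * th) * b (k (s + c * th)) (x th)))%R.
Proof.
move=> c0 s12 hl.
have s21 : 0 < s2 - s1 by rewrite subr_gt0.
have g0 : l * (s2 - s1) <= sweep 0 s2 - sweep 0 s1.
  apply: ge_of_derivative_bound (ltW s12) => [s|s]; first exact: is_derive_sweep.
  apply: (le_trans (hl s)); rewrite le_eqVlt; apply/orP; left; apply/eqP.
  by apply: eq_Rintegral => th _; rewrite mul0r addr0.
have e12 := le_trans (ler_norm _) (sweep_shift s1 c0).
have e21 := lerNnormlW (sweep_shift s2 c0).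
have cs : continuous (sweep c).
  by apply: derivable_continuous => s; have [] := is_derive_sweep c s.
have [|s hs e] := MVT s12 (fun s _ => is_derive_sweep c s); first exact: continuous_subspaceT.
rewrite in_itv /= in hs; exists s; first exact: hs.
exact: quotient_bound s21 e (four_points e12 e21 g0).
Qed.

End Averaging.

Section GrowingRay.
Variable R : realType.
Local Notation mu := (@lebesgue_measure R).
Implicit Types (s t y : R).

Lemma integral_is_derive (F f : R -> R) a b : a < b -> continuous f ->
  (forall t : R, is_derive t 1 F (f t)) -> (\int[mu]_(t in `[a, b]) f t)%R = F b - F a.
Proof.
move=> ab cf h.
have cF : continuous F by apply: derivable_continuous => t; have [] := h t.
have LR : derivable_oo_LRcontinuous F a b.
  by split; [move=> t _; have [] := h t|exact/cvg_at_right_filter/cF|exact/cvg_at_left_filter/cF].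
have e : {in `]a, b[, derive1 F =1 f}.
  by move=> t _; rewrite derive1E; have [_] := h t.
by rewrite /Rintegral (continuous_FTC2 ab (continuous_subspaceT cf) LR e).
Qed.

Lemma primZ (f g : R -> R) c t : continuous f -> continuous g ->
  (forall s, f s = c * g s) -> prim f t = c * prim g t.
Proof.
move=> cf cg h.
have D s := is_deriveB (is_derive_prim s cf) (is_deriveZ c (is_derive_prim s cg)).
have D0 s : `|f s - c *: g s| <= 0 by rewrite /GRing.scale /= h subrr normr0.
have := le_of_derivative_bound D D0 t 0; rewrite mul0r.
rewrite -[_ t - _ 0]/((prim f t - c * prim g t) - (prim f 0 - c * prim g 0)) !prim0 mulr0 !subr0.
by rewrite normr_le0 subr_eq0 => /eqP.
Qed.

Lemma growing_ray_arith (al m Am Lam C lam T' rho c d U : R) :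
  0 < m -> m <= al -> al <= Am -> 0 <= Lam -> 0 <= C -> 0 < lam -> 0 < T' -> 0 < rho ->
  rho ^+ 2 <= lam * T' -> 4 * Am * rho <= m * (lam * T') -> c = al / lam ->
  m * T' - 2 * (al * rho / lam) <= d ->
  Lam / Am - 2 * (C * m^-1 * c * rho * (2 * rho)) / d <= U ->
  m / Am * Lam - 8 * C * Am ^+ 2 / m ^+ 2 <= al * U.
Proof.
move=> m0 mal alA L0 C0 lam0 T0 r0 h1 h2 cE hd hU.
have al0 : 0 < al := lt_le_trans m0 mal.
have A0 : 0 < Am := lt_le_trans al0 alA.
have lT : 0 < lam * T' by rewrite mulr_gt0.
have d1 : m * T' / 2 <= d.
  apply: le_trans hd.
  have : 2 * (al * rho / lam) <= m * T' / 2.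
    rewrite -(ler_pM2r lam0).
    have -> : 2 * (al * rho / lam) * lam = 2 * al * rho by field; rewrite gt_eqF.
    have : al * rho <= Am * rho by rewrite ler_wpM2r// ltW.
    have -> : m * T' / 2 * lam = m * (lam * T') / 2 by ring.
    have h2' : 4 * (Am * rho) <= m * (lam * T') by rewrite mulrA.
    by move: h2'; rewrite -(mulrA 2); set q := m * (lam * T'); lra.
  by lra.
have mT0 : 0 < m * T' / 2 by rewrite divr_gt0// mulr_gt0.
have d0 : 0 < d := lt_le_trans mT0 d1.
apply: (@le_trans _ _ (al * (Lam / Am - 2 * (C * m^-1 * c * rho * (2 * rho)) / d))); last first.
  by rewrite ler_wpM2l// ltW.
rewrite mulrBr lerB//.
  have -> : m / Am * Lam = m * (Lam / Am) by ring.
  by rewrite ler_wpM2r// divr_ge0// ltW.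
have e1 : 2 * (C * m^-1 * c * rho * (2 * rho)) / d <= 2 * (C * m^-1 * c * rho * (2 * rho)) / (m * T' / 2).
  rewrite ler_wpM2l//.
    by rewrite cE; nneg.
  by rewrite lef_pV2.
have e2 : 2 * (C * m^-1 * c * rho * (2 * rho)) / (m * T' / 2) =
   8 * C * al / m ^+ 2 * (rho ^+ 2 / (lam * T')).
  by rewrite cE; field; rewrite !gt_eqF.
have e3 : rho ^+ 2 / (lam * T') <= 1 by rewrite ler_pdivrMr// mul1r.
apply: (@le_trans _ _ (al * (8 * C * al / m ^+ 2))).
  rewrite ler_wpM2l ?(ltW al0)//; apply: (le_trans e1); rewrite e2.
  by rewrite ler_piMr//; nneg.
have -> : al * (8 * C * al / m ^+ 2) = (8 * C / m ^+ 2) * al ^+ 2 by ring.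
have -> : 8 * C * Am ^+ 2 / m ^+ 2 = (8 * C / m ^+ 2) * Am ^+ 2 by ring.
rewrite ler_wpM2l//; first by nneg.
by rewrite ler_pXn2r// nnegrE ltW.
Qed.

Lemma exists_growing_ray (b : R -> R -> R) (cp : R -> R) (C C1 m Am lam rho x0 Lam T' : R) (p : nat) :
  0 <= C -> 0 <= C1 -> 0 < m -> 0 < lam -> 0 < rho -> 0 <= Lam -> 0 < T' ->
  (forall X : R -> R, continuous X -> continuous (fun t => b t (X t))) ->
  (forall t y, `|b t y| <= C) ->
  (forall t y z, `|b t y - b t z| <= C1 * `|y - z|) ->
  continuous cp -> (forall t, m <= `|cp t|) -> (forall t, `|cp t| <= Am) ->
  rho ^+ 2 <= lam * T' -> 4 * Am * rho <= m * (lam * T') ->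
  (forall t, Lam <= \int[mu]_(th in `[(- rho), rho]) b t (x0 + p%:R * cp 0 * th))%R ->
  exists xs t1 t2, [/\ 0 <= t1, t1 <= t2, t2 <= T' &
    m / Am * Lam - 8 * C * Am ^+ 2 / m ^+ 2 <=
    lam * (prim (fun t => b t (xs + p%:R * lam * prim cp t)) t2 -
           prim (fun t => b t (xs + p%:R * lam * prim cp t)) t1)].
Proof.
move=> C0 C10 m0 lam0 rho0 L0 T0 bc bC bL ccp cpm cpA h1 h2 hL.
have [e ee he] := constant_sign ccp m0 cpm.
have cn : continuous (fun t => `|cp t|) by move=> t; apply: cvg_norm; exact: ccp.
have A0 : 0 < Am by rewrite (lt_le_trans m0)// (le_trans (cpm 0)).
have [k [fk kf hk]] := inverse_of_increasing m0 (fun t => is_derive_prim t cn) cpm.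
pose dk s := `|cp (k s)|^-1.
have ck : continuous k by apply: derivable_continuous => s; have [] := hk s.
have cdk : continuous dk.
  move=> s; apply: cvgV; first by rewrite gt_eqF// (lt_le_trans m0).
  exact: (continuous_comp (ck s) (cn (k s))).
have dk0 s : 0 <= dk s by rewrite invr_ge0.
have dk1 s : dk s <= m^-1.
  by rewrite lef_pV2 ?posrE//; apply: lt_le_trans m0 _.
have dkA s : Am^-1 <= dk s.
  by rewrite lef_pV2 ?posrE//; apply: lt_le_trans m0 _.
have kmono s s' : s <= s' -> k s <= k s'.
  move=> ss; have := ge_of_derivative_bound hk dk0 ss.
  by rewrite mul0r subr_ge0.
pose x th : R := x0 + p%:R * cp 0 * th.
have cx : continuous x.
  exact: continuous_line.
pose al := `|cp 0|.
pose c := al / lam.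
have c0 : 0 <= c by apply: divr_ge0; [exact: normr_ge0|exact: ltW].
have Ap_ge t t' : t <= t' -> m * (t' - t) <= prim (fun t => `|cp t|) t' - prim (fun t => `|cp t|) t.
  exact: (ge_of_derivative_bound (fun t => is_derive_prim t cn) cpm).
pose s1 := c * rho; pose s2 := prim (fun t => `|cp t|) T' - c * rho.
have k0 : k 0 = 0 by rewrite -[in LHS](prim0 (fun t => `|cp t|)) fk.
have hd : m * T' - 2 * (al * rho / lam) <= s2 - s1.
  have := Ap_ge 0 T' (ltW T0); rewrite prim0 !subr0 /s2 /s1 /c => h.
  have -> : al / lam * rho = al * rho / lam by rewrite mulrAC.
  by move: h; set q := prim _ _; set r := _ / lam; lra.
have alA : al <= Am := cpA 0.
have lT : 0 < lam * T' by rewrite mulr_gt0.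
have s12 : s1 < s2.
  rewrite -subr_gt0; apply: lt_le_trans hd.
  rewrite subr_gt0 -(ltr_pM2r lam0).
  have -> : 2 * (al * rho / lam) * lam = 2 * al * rho by field; rewrite gt_eqF.
  have q1 : al * rho <= Am * rho by rewrite ler_wpM2r// ltW.
  have -> : m * T' * lam = m * (lam * T') by ring.
  apply: (@lt_le_trans _ _ (4 * Am * rho)) => //.
  have : 0 < Am * rho by rewrite mulr_gt0.
  by rewrite -!mulrA; lra.
have hl s : Lam / Am <= (\int[mu]_(th in `[(- rho), rho]) (dk s * b (k s) (x th)))%R.
  have ib : mu.-integrable `[(- rho), rho] (EFin \o (fun th => b (k s) (x th))).
    apply: continuous_integrable => th; apply/cvgrPdist_le => ep ep0.
    have C1' : 0 < C1 + 1 by rewrite ltr_wpDl.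
    have /cvgrPdist_le /(_ _ (divr_gt0 ep0 C1')) := cx th.
    apply: filterS => r hr; rewrite (le_trans (bL _ _ _))//.
    apply: (@le_trans _ _ ((C1 + 1) * (ep / (C1 + 1)))); last by rewrite mulrC divfK// gt_eqF.
    by rewrite ler_pM// lerDl.
  rewrite RintegralZl//.
  apply: (@le_trans _ _ (Am^-1 * Lam)); first by rewrite mulrC.
  apply: (@le_trans _ _ (dk s * Lam)); first by rewrite ler_wpM2r.
  by rewrite ler_wpM2l.
have [s hs hU] := exists_ray_average C0 C10 rho0 m0 bc bC bL cx hk dk0 dk1 c0 s12 hl.
have hU' := growing_ray_arith m0 (cpm 0) alA L0 C0 lam0 T0 rho0 h1 h2 (erefl c) hd hU.
pose P := p%:R * lam.
pose xs := x0 - P * e * s.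
pose X t := xs + P * prim cp t.
have cX : continuous X.
  move=> t; apply: cvgD; first exact: cvg_cst.
  by apply: cvgM; [exact: cvg_cst|exact: continuous_prim].
have Xk th : X (k (s + c * th)) = x th.
  rewrite /X /x /xs (primZ _ ccp cn he) kf.
  rewrite [cp 0]he -/al /P /c.
  by field; rewrite gt_eqF.
have cG := bc X cX.
pose D (th : R) : R := prim (fun t => b t (X t)) (k (s + c * th)).
have dD (th : R) : is_derive th 1 D (c * (dk (s + c * th) * b (k (s + c * th)) (x th))).
  have a1 := is_derive_affine c s th.
  have a2 : is_derive th 1 (fun th : R => s + c * th) c.
    by under eq_fun do rewrite addrC; exact: a1.
  have a3 := @is_derive1_comp _ k (fun th : R => s + c * th) th _ _ (hk (s + c * th)) a2.
  have a4 := @is_derive1_comp _ _ (k \o (fun th : R => s + c * th)) th _ _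
    (is_derive_prim (k (s + c * th)) cG) a3.
  by apply: (is_derive_eq a4); rewrite Xk /dk; ring.
have cV : continuous (fun th : R => dk (s + c * th) * b (k (s + c * th)) (x th)).
  have -> : (fun th : R => dk (s + c * th) * b (k (s + c * th)) (x th)) =
    (fun r : R => dk r * b (k r) (X (k r))) \o (fun th : R => s + c * th).
    by apply/funext => th /=; rewrite Xk.
  move=> th; apply: continuous_comp; first exact: continuous_line.
  by apply: cvgM; [exact: cdk|exact: (continuous_comp (ck _) (cG _))].
have cD : continuous (fun th : R => c * (dk (s + c * th) * b (k (s + c * th)) (x th))).
  by move=> th; apply: cvgM; [exact: cvg_cst|exact: cV].
have rr : - rho < rho by rewrite (lt_trans _ rho0)// oppr_lt0.
have I := integral_is_derive rr cD dD.
have /andP[hs1 hs2] := hs.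
exists xs, (k (s + c * (- rho))), (k (s + c * rho)); split.
- by rewrite -k0 kmono// mulrN subr_ge0 ltW.
- by apply: kmono; rewrite lerD2l ler_wpM2l// ltW.
- rewrite -[leRHS](fk T'); apply: kmono.
  by move: hs2; rewrite /s2 ltrBrDr => /ltW.
- apply: (le_trans hU'); rewrite -[X in lam * X]/(D rho - D (- rho)) -I.
  rewrite RintegralZl; [|exact: measurable_itv|exact: continuous_integrable].
  by rewrite /c mulrA mulrCA mulfV ?mulr1// gt_eqF.
Qed.

End GrowingRay.

(** * Consequences of well-posedness *)

Section Source.
Variable R : realType.
Local Notation mu := (@lebesgue_measure R).
Implicit Types (u v z b : R -> R[i]) (x y t xi : R) (n j : nat).

Lemma normc_conj (c : R[i]) : normc (conjc c) = normc c.
Proof. by case: c => a1 a2 /=; rewrite sqrrN. Qed.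

Lemma is_cder_conj z x d : is_cder z x d -> is_cder (fun y => conjc (z y)) x (conjc d).
Proof.
move=> [h1 h2]; split.
- have -> : (fun y => Re (conjc (z y))) = (fun y => Re (z y)).
    by apply/funext => y; case: (z y).
  by apply: (is_derive_eq h1); case: (d).
- have -> : (fun y => Im (conjc (z y))) = (fun y => - Im (z y)).
    by apply/funext => y; case: (z y).
  by apply: (is_derive_eq (is_deriveN h2)); case: (d).
Qed.

Lemma cder_conj z : cdf z ->
  cdf (fun y => conjc (z y)) /\ cder (fun y => conjc (z y)) = fun y => conjc (cder z y).
Proof. by move=> h; apply: cdf_of => x; exact: is_cder_conj. Qed.

Lemma ctest_conj z : ctest z -> ctest (fun y => conjc (z y)).
Proof.
move=> [sz [r hr]]; split.
  move=> n; elim: n z sz {hr} => [//|n IH] z sz; have [h1 h2] := cder_conj (csmooth_cdf sz).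
  by split; [exact: h1|rewrite h2; apply: IH; exact: csmooth_cder].
by exists r => x /hr ->; rewrite conjc0.
Qed.

Lemma iter_cder_conj n z : csmooth z ->
  iter n cder (fun y => conjc (z y)) = fun y => conjc (iter n cder z y).
Proof.
move=> sz; elim: n => [//|n IH]; rewrite iterS IH.
by have [_ ->] := cder_conj (csmooth_cdf (csmooth_iter n sz)).
Qed.

Lemma ctest_derivatives_bounded n z (c w : R) : ctest z ->
  (forall x, w < `|x - c| -> z x = 0) ->
  exists2 B, 0 <= B & forall i x, (i <= n)%N -> normc (iter i cder z x) <= B.
Proof.
move=> [sz [r hr]] hz; elim: n => [|n [B B0 hB]].
  have [B B0 hB] := csmooth_bounded sz hr.
  by exists B => // i x; rewrite leqn0 => /eqP ->.
have hr' : forall x, r < `|x| -> iter n.+1 cder z x = 0.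
  elim: n.+1 => [//|k IH]; exact: (cder_eq0 (@open_far _ r) IH).
have [B' B'0 hB'] := csmooth_bounded (csmooth_iter n.+1 sz) hr'.
exists (Num.max B B'); first by rewrite le_max B0.
move=> i x; rewrite leq_eqVlt => /predU1P[->|].
  by rewrite le_max hB' orbT.
by rewrite ltnS => hi; rewrite le_max hB.
Qed.

Lemma source_C0T (T : R) (chi : R -> R) z (c w : R) : continuous chi -> ctest z ->
  (forall x, w < `|x - c| -> z x = 0) -> 0 <= w -> 2 * w <= 1 ->
  C0T T (@Hinf R) (@Hnorm R) (fun t x => (chi t)%:C * z x).
Proof.
move=> cchi hz hs w0 w1; split=> [t _|n t _].
  exact/ctest_Hinf/ctestZ.
have [B B0 hB] := ctest_derivatives_bounded n hz hs.
apply: cvg_within_filter.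
have nB : 0 < n.+1%:R * B + 1 by rewrite ltr_wpDl// mulr_ge0.
apply/cvgrPdist_le => e e0.
have /cvgrPdist_le /(_ _ (divr_gt0 e0 nB)) := cchi t.
apply: filterS => s hst.
have -> : (fun x => (chi s)%:C * z x - (chi t)%:C * z x) = fun x => (chi s - chi t)%:C * z x.
  by apply/funext => x; rewrite rmorphB /= mulrBl.
have hz' := ctestZ (chi s - chi t)%:C hz.
rewrite sub0r normrN ger0_norm ?sqrtr_ge0//.
have K0 : 0 <= `|chi s - chi t| * B by rewrite mulr_ge0.
apply: (le_trans (@Hnorm_le _ n _ c w _ hz' K0 w0 w1 _ _)).
- by move=> x /hs ->; rewrite mulr0.
- move=> i x hi; have [sz _] := hz.
  by rewrite iter_cderZ// normcM normcR ler_wpM2l// hB.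
- rewrite distrC in hst; rewrite mulrCA.
  apply: (@le_trans _ _ (e / (n.+1%:R * B + 1) * (n.+1%:R * B + 1))); last first.
    by rewrite divfK// gt_eqF.
  by rewrite ler_pM ?mulr_ge0// lerDl.
Qed.

Lemma zero_solution (p : nat) (T : R) (ap : R -> R) (a : nat -> R -> R -> R[i]) :
  solution p T ap a (fun _ _ => 0) (fun=> 0) (fun _ _ => 0).
Proof.
have H0 : Hinf (fun=> 0 : R[i]) by exact/ctest_Hinf/ctest_cst0.
split.
- split=> [t _ //|n t _].
  under eq_fun do under [X in Hnorm n X]eq_fun do rewrite subr0.
  rewrite Hnorm_eq0; exact: cvg_cst.
- move=> t _; exists (fun=> 0).
    split=> // s.
    under eq_fun do under [X in Hnorm s X]eq_fun do rewrite !subr0 mulr0.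
    rewrite Hnorm_eq0; exact: cvg_cst.
  have z j : iter j (@cder R) (fun=> 0) = fun=> 0.
    elim: j => [//|j /= ->]; by have [_ ->] := cdf_of (is_cder_cst (0 : R[i])).
  have h j : {ae mu, forall x, wderiv j (fun=> 0 : R[i]) x = 0}.
    apply: wderiv_ae; first exact/ctest_L2/ctest_cst0.
    by have := ctest_weak_deriv j (@ctest_cst0 R); rewrite z.
  have hh := @ae_foralln _ _ _ mu _ h.
  apply: filterS hh => x hx.
  rewrite /Dx hx mulr0 mulr0 add0r add0r big1 // => j _.
  by rewrite hx !mulr0.
- by apply: aeW.
Qed.

(* Only sources [chi t * z x] with [z] supported in an interval of length at
   most 1 are needed, and for these the Sobolev norm of [z] is controlled by the
   sup norms of its derivatives. *)
Definition a_priori_bound (p : nat) (T : R) (ap : R -> R) (a : nat -> R -> R -> R[i])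
    (r : nat) (delta : R) := forall (chi : R -> R) z (c w : R),
  continuous chi -> ctest z -> (forall x, w < `|x - c| -> z x = 0) ->
  0 <= w -> 2 * w <= 1 -> (forall t, 0 <= chi t <= 1) ->
  (forall i x, (i <= r)%N -> r.+1%:R * normc (iter i cder z x) <= delta) ->
  exists2 u, solution p T ap a (fun t x => (chi t)%:C * z x) (fun=> 0) u &
    forall t, 0 <= t <= T -> L2norm (u t) <= 1.

Lemma well_posed_a_priori_bound (p : nat) (T : R) (ap : R -> R) (a : nat -> R -> R -> R[i]) :
  well_posed p T ap a -> exists (r : nat) (delta : R), 0 < delta /\ a_priori_bound p T ap a r delta.
Proof.
move=> [ex _ cont].
have C0 : C0T T (@Hinf R) (@Hnorm R) (fun _ _ => 0).
  by have [h _ _] := zero_solution p T ap a.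
have H0 : Hinf (fun=> 0 : R[i]) by exact/ctest_Hinf/ctest_cst0.
have [r [delta [d0 hd]]] := cont _ _ _ C0 H0 (zero_solution p T ap a) 0%N 1 ltr01.
exists r, delta; split=> // chi z c w cchi hz hs w0 w1 chi01 hB.
have Cf := source_C0T T cchi hz hs w0 w1.
have [u hu] := ex _ _ Cf H0.
exists u => // t ht.
have [[hu1 _] _ _] := hu.
have := hd _ _ _ Cf H0 hu _ _ t ht.
under [X in Hnorm 0 X]eq_fun do rewrite subr0.
rewrite Hnorm0E; last exact/Hinf_L2/hu1.
apply.
- move=> s hs'; under [X in Hnorm r X]eq_fun do rewrite subr0.
  have hz' := ctestZ (chi s)%:C hz.
  have r0 : 0 < r.+1%:R :> R by rewrite ltr0n.
  have K0 : 0 <= delta / r.+1%:R by rewrite divr_ge0// ltW.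
  apply: (le_trans (@Hnorm_le _ r _ c w _ hz' K0 w0 w1 _ _)).
  + by move=> x /hs ->; rewrite mulr0.
  + move=> i x hi; have [sz _] := hz.
    rewrite iter_cderZ// normcM normcR.
    have /andP[c0 c1] := chi01 s; rewrite ger0_norm//.
    apply: (@le_trans _ _ (1 * normc (iter i cder z x))).
      by rewrite ler_wpM2r ?normc_ge0.
    by rewrite mul1r ler_pdivlMr// mulrC hB.
  + by rewrite mulrC divfK// gt_eqF.
- under [X in Hnorm r X]eq_fun do rewrite subr0.
  by rewrite Hnorm_eq0 ltW.
Qed.

Lemma packet_pr_bound xi1 xi2 X1 X2 (c1 c2 : R[i]) b1 b2 (w B1 B2 : R) z :
  csmooth b1 -> csmooth b2 -> (forall y, w < `|y| -> b1 y = 0) ->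
  (forall y, w < `|y| -> b2 y = 0) -> 0 <= w -> 0 <= B1 -> 0 <= B2 ->
  (forall y, `|y| <= w -> normc (b1 y) <= B1) ->
  (forall y, `|y| <= w -> normc (b2 y) <= B2) ->
  ctest z -> (forall x, normc (z x) = normc (packet xi1 X1 c1 b1 x)) ->
  `|pr z (packet xi2 X2 c2 b2)| <= normc c1 * B1 * (normc c2 * B2) * (2 * w).
Proof.
move=> s1 s2 f1 f2 w0 B10 B20 h1 h2 hz ez.
have all (b : R -> R[i]) B : 0 <= B -> (forall y, w < `|y| -> b y = 0) ->
    (forall y, `|y| <= w -> normc (b y) <= B) -> forall y, normc (b y) <= B.
  move=> B0 fb hb y; have [/hb//|/fb ->] := leP `|y| w.
  by rewrite normc0.
have g1 := all _ _ B10 f1 h1; have g2 := all _ _ B20 f2 h2.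
have Lz := ctest_L2 hz.
have Lp := ctest_L2 (packet_ctest xi2 X2 c2 s2 f2).
have K1 : 0 <= normc c1 * B1 by rewrite mulr_ge0// normc_ge0.
have K2 : 0 <= normc c2 * B2 by rewrite mulr_ge0// normc_ge0.
have n1 : L2norm z ^+ 2 <= (normc c1 * B1) ^+ 2 * (2 * w).
  apply: (L2norm_le_support (c := X1)) => //.
  - move=> x hx; have e := ez x; rewrite (packet_far xi1 c1 f1 hx) normc0 in e.
    exact: ComplexField.Normc.eq0_normc e.
  - by move=> x; rewrite ez packet_norm ler_wpM2l ?normc_ge0.
have n2 : L2norm (packet xi2 X2 c2 b2) ^+ 2 <= (normc c2 * B2) ^+ 2 * (2 * w).
  apply: (L2norm_le_support (c := X2)) => //.
  - exact: packet_far.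
  - by move=> x; rewrite packet_norm ler_wpM2l ?normc_ge0.
apply: (le_trans (pr_bound Lz Lp)).
have P1 : 0 <= normc c1 * B1 * (normc c2 * B2) * (2 * w).
  by apply: mulr_ge0; apply: mulr_ge0.
have P2 : 0 <= L2norm z * L2norm (packet xi2 X2 c2 b2) by rewrite mulr_ge0// L2norm_ge0.
rewrite -(@ler_pXn2r _ 2)// ?nnegrE//.
rewrite exprMn (le_trans (ler_pM (sqr_ge0 _) (sqr_ge0 _) n1 n2))//.
by rewrite le_eqVlt; apply/orP; left; apply/eqP; ring.
Qed.

Lemma bump_ge y : `|y| <= 2^-1 -> expR (- 4) <= bump y.
Proof.
rewrite ler_norml => /andP[h1 h2].
have F s : 2^-1 <= s -> expR (- 2) <= flat 0 s.
  move=> hs; have s0 : 0 < s by rewrite (lt_le_trans _ hs)// invr_gt0.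
  rewrite /flat s0 expr0 invr1 mul1r ler_expR lerN2.
  by rewrite -[leRHS]invrK lef_pV2 ?posrE// invr_gt0.
have -> : expR (- 4) = expR (- 2) * expR (- 2) :> R by rewrite -expRD; congr expR; ring.
by rewrite /bump ler_pM ?expR_ge0// F//; lra.
Qed.

Definition sbump (W y : R) : R[i] := (bump (W * y + 0))%:C.

Lemma csmooth_sbump W : csmooth (sbump W).
Proof. exact: (csmooth_affine W 0 (csmooth_bump R)). Qed.

Lemma sbump_far (W w : R) : 0 < W -> W * w = 1 -> forall y, w < `|y| -> sbump W y = 0.
Proof.
move=> W0 Ww y hy; rewrite /sbump bump_eq0// addr0 normrM (gtr0_norm W0).
by rewrite -Ww ler_wpM2l// ltW.
Qed.

Lemma iter_cder_sbump W n : iter n cder (sbump W) =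
  fun y => (W ^+ n)%:C * iter n cder (fun y => (bump y)%:C) (W * y + 0).
Proof.
have sb := csmooth_bump R.
elim: n => [|n IH]; first by apply/funext => y; rewrite expr0 mul1r.
rewrite iterS IH cderZ; last first.
  exact/csmooth_cdf/(csmooth_affine W 0 (csmooth_iter n sb)).
rewrite cder_affine; last exact/csmooth_cdf/csmooth_iter.
by apply/funext => y; rewrite exprSr rmorphM /= mulrA.
Qed.

Lemma cb_sbump n (W w B : R) : 0 < W -> 0 <= B ->
  (forall i x, (i <= n)%N -> normc (iter i cder (fun y => (bump y)%:C) x) <= B) ->
  cb W w n B (sbump W).
Proof.
move=> W0 B0 hB.
have Wn j : 0 <= W ^+ j by rewrite exprn_ge0// ltW.
have H : forall j k, (j + k <= n)%N -> cb W w k (B * W ^+ j) (iter j cder (sbump W)).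
  move=> j k; elim: k j => [|k IH] j hjk; split=> //.
  - move=> x _; rewrite iter_cder_sbump normcM normcR ger0_norm ?Wn//.
    by rewrite mulrC ler_wpM2r ?Wn// hB// (leq_trans _ hjk)// leq_addr.
  - move=> x _; rewrite iter_cder_sbump normcM normcR ger0_norm ?Wn//.
    by rewrite mulrC ler_wpM2r ?Wn// hB// (leq_trans _ hjk)// leq_addr.
  - by rewrite -mulrA -exprSr -iterS; apply: IH; rewrite addSnnS.
by have := H 0 n; rewrite add0n expr0 mulr1; apply.
Qed.

End Source.

(** * The estimate along a ray *)

Section RayEstimate.
Variable R : realType.
Local Notation mu := (@lebesgue_measure R).
Implicit Types (b : R -> R[i]) (t x y : R) (n j : nat).

Lemma dist_le_of_derivative_on (f df : R -> R) (te D : R) : 0 < te ->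
  continuous f -> (forall t, 0 < t < te -> is_derive t 1 f (df t)) ->
  (forall t, 0 < t < te -> `|df t| <= D) ->
  forall s t, 0 <= s <= te -> 0 <= t <= te -> `|f s - f t| <= D * `|s - t|.
Proof.
move=> te0 cf hf hD s t.
wlog st : s t / s <= t.
  move=> H hs ht; have [/H|/ltW/H] := leP s t; first by apply.
  by move=> /(_ ht hs); rewrite distrC (distrC t).
move: st; rewrite le_eqVlt => /predU1P[-> _ _|st /andP[s0 _] /andP[_ t1]].
  by rewrite !subrr normr0 mulr0.
have d r : r \in `]s, t[ -> is_derive r 1 f (df r).
  by rewrite in_itv /= => /andP[r1 r2]; apply: hf; rewrite (le_lt_trans s0) //= (lt_le_trans r2).
have [r] := MVT st d (continuous_subspaceT cf).
rewrite in_itv /= => /andP[r1 r2] e.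
rewrite distrC e normrM distrC ler_wpM2r// hD//.
by rewrite (le_lt_trans s0)//= (lt_le_trans r2).
Qed.

(* The source is switched on for a time [h] so short that the phase of the packet
   hardly turns. *)
Definition tent (s h t : R) : R := Num.max 0 (1 - `|t - s| / h).

Lemma tent_itv s h t : 0 < h -> 0 <= tent s h t <= 1.
Proof.
move=> h0; rewrite /tent le_max lexx /= ge_max ler01 /=.
by rewrite lerBlDr lerDl divr_ge0// ltW.
Qed.

Lemma tent_far s h t : 0 < h -> h <= `|t - s| -> tent s h t = 0.
Proof.
by move=> h0 hts; rewrite /tent max_l// subr_le0 ler_pdivlMr// mul1r.
Qed.

Lemma tent_near s h t : 0 < h -> `|t - s| <= h / 2 -> 2^-1 <= tent s h t.
Proof.
move=> h0 hts; rewrite /tent le_max; apply/orP; right.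
have : `|t - s| / h <= 2^-1 by rewrite ler_pdivrMr// mulrC.
by lra.
Qed.

Lemma continuous_tent s h : continuous (tent s h).
Proof.
move=> t; apply: (@continuous_max _ _ (cst 0) (fun t => 1 - `|t - s| / h)); first exact: cvg_cst.
apply: cvgB; first exact: cvg_cst.
apply: cvgM; last exact: cvg_cst.
apply: cvg_norm; apply: cvgB; [exact: cvg_id|exact: cvg_cst].
Qed.

Lemma prim_tent_ge s h te : 0 < h -> h <= te -> 0 <= s <= te ->
  h / 4 <= prim (tent s h) te.
Proof.
move=> h0 hte /andP[s0 ste].
have ct := @continuous_tent s h.
have mono x y : x <= y -> prim (tent s h) x <= prim (tent s h) y.
  move=> xy; have := ge_of_derivative_bound (fun t => is_derive_prim t ct)
    (fun t => proj1 (andP (tent_itv s t h0))) xy.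
  by rewrite mul0r subr_ge0.
have step x : `|x - s| <= h / 2 -> `|x + h / 2 - s| <= h / 2 ->
    h / 4 <= prim (tent s h) (x + h / 2) - prim (tent s h) x.
  move=> h1 h2.
  have xx : x < x + h / 2 by rewrite ltrDl divr_gt0.
  have [|z + ->] := MVT xx (fun t _ => is_derive_prim t ct).
    exact/continuous_subspaceT/continuous_prim.
  rewrite in_itv /= => /andP[z1 z2].
  have hz : 2^-1 <= tent s h z.
    apply: tent_near => //; move: h1 h2; rewrite !ler_norml => /andP[a1 a2] /andP[a3 a4].
    by apply/andP; split; lra.
  have -> : x + h / 2 - x = h / 2 by ring.
  have -> : h / 4 = 2^-1 * (h / 2) by field.
  by rewrite ler_wpM2r// divr_ge0// ltW.
have h20 : 0 <= h / 2 by rewrite divr_ge0// ltW.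
have [sh|sh] := leP (h / 2) s.
- have := step (s - h / 2); rewrite subrK subrr normr0 addrAC subrr sub0r normrN ger0_norm//.
  move=> /(_ (lexx _) h20) g.
  have g1 := mono _ _ ste.
  have := mono 0 (s - h / 2); rewrite prim0 subr_ge0 => /(_ sh); lra.
- have := step s; rewrite subrr normr0 addrAC subrr add0r ger0_norm//.
  move=> /(_ h20 (lexx _)) g.
  have g1 : prim (tent s h) (s + h / 2) <= prim (tent s h) te.
    by apply: mono; apply: le_trans hte; rewrite [leRHS]splitr lerD2r ltW.
  have := mono 0 s s0; rewrite prim0; lra.
Qed.

Lemma half_le_of_dist (A x y : R) : A <= x -> x - y <= A / 2 -> A / 2 <= y.
Proof. by move=> *; lra. Qed.

Lemma iter_cder_shift f n (c : R) : csmooth f ->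
  iter n cder (fun y => f (y + c)) = fun y => iter n cder f (y + c).
Proof.
move=> sf; elim: n => [//|n IH]; rewrite iterS IH cder_shift//.
exact/csmooth_cdf/csmooth_iter.
Qed.

Lemma half_tail (kap H F q B e : R) : 0 <= H -> 8 * q * B <= 2 * kap ->
  kap * H <= F + q * B * (2 * H + e) -> kap / 2 * H <= F + B * (q * e).
Proof.
move=> H0 h1 h2; have : 8 * q * B * H <= 2 * kap * H by exact: ler_wpM2r.
have -> : 8 * q * B * H = 8 * (q * B * H) by ring.
have -> : 2 * kap * H = 2 * (kap * H) by ring.
have -> : kap / 2 * H = kap * H / 2 by ring.
move: h2; have -> : q * B * (2 * H + e) = 2 * (q * B * H) + B * (q * e) by ring.
set x := q * B * H; set y := kap * H; lra.
Qed.

Variables (p : nat) (T : R) (ap : R -> R) (a : nat -> R -> R -> R[i]).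
Hypotheses (hp : (2 <= p)%N) (hT : 0 < T).
Hypothesis hap : {within `[0, T], continuous ap}.
Hypothesis ha : forall j, (j < p)%N -> C0T T (@Binf R) (@Bnorm R) (a j).
Variables (xi xs g0 te s W w B Ca Am delta h : R) (r k : nat).
Hypothesis apriori : a_priori_bound p T ap a r delta.
Hypotheses (delta0 : 0 < delta) (te0 : 0 < te) (teT : te <= T) (hs : 0 <= s <= te).
Hypotheses (W1 : 1 <= W) (Ww : W * w = 1) (w1 : 2 * w <= 1) (Wxi : W <= xi).
Let Nm := (k.+1 * p.+1)%N.
Hypotheses (rNm : (r <= Nm)%N) (B1 : 1 <= B).
Hypothesis hB : forall i x, (i <= Nm)%N -> normc (iter i cder (fun y => (bump y)%:C) x) <= B.
Hypothesis Ca0 : 0 <= Ca.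
Hypothesis hCa : forall j, (j < p)%N -> forall i, (i <= Nm)%N -> forall t x,
  normc (iter i cder (a j (clamp T t)) x) <= Ca.
Hypothesis hAm : forall t, `|cap T ap t| <= Am.
Let E (t : R) : R := g0 - xi ^+ p.-1 * growth p T ap a xi xs t.
Hypothesis hE : forall t, 0 <= t <= te -> E t <= 0.
Hypothesis hEs : E s = 0.
Hypotheses (h0 : 0 < h) (hte : h <= te).
Let c0 : R := expR (- 8).
Hypothesis hsmall : h * (4 * B ^+ 2 * (Am + Ca + p%:R * Am) * xi ^+ p) <= c0.
Let eta : R := (3 ^+ p * Am + 2 ^+ Nm * Ca * (3 ^+ p + 2 + p%:R * 2 ^+ p))
  * xi ^+ p.-1 * (W ^+ 2 / xi + w).
Hypothesis eta_te : eta * te <= 2^-1.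
Hypothesis eta_te' : 16 * B ^+ 2 * (eta * te) <= c0.
Let mu0 : R := delta / (r.+1%:R * (2 * xi) ^+ r * B).

Let W0 : 0 < W. Proof. exact: lt_le_trans ltr01 W1. Qed.
Let w0 : 0 < w. Proof. by rewrite -(pmulr_rgt0 _ W0) Ww. Qed.
Let w0' : 0 <= w. Proof. exact: ltW. Qed.
Let xi0 : 0 < xi. Proof. exact: lt_le_trans W0 Wxi. Qed.
Let xi1 : 1 <= xi. Proof. exact: le_trans W1 Wxi. Qed.
Let B0 : 0 < B. Proof. exact: lt_le_trans ltr01 B1. Qed.
Let B0' : 0 <= B. Proof. exact: ltW. Qed.
Let Am0 : 0 <= Am. Proof. exact: le_trans (hAm 0). Qed.
Let p0 : (0 < p)%N. Proof. exact: ltnW. Qed.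
Let mu00 : 0 < mu0.
Proof.
rewrite divr_gt0// mulr_gt0// mulr_gt0 ?ltr0n// exprn_gt0// mulr_gt0//.
Qed.
Let eta0 : 0 <= eta.
Proof. by rewrite /eta; nneg. Qed.

Let psi := sbump W.
Let spsi : csmooth psi. Proof. exact: csmooth_sbump. Qed.
Let fpsi : forall y, w < `|y| -> psi y = 0. Proof. exact: sbump_far. Qed.
Let cpsi : cb W w Nm B psi. Proof. exact: cb_sbump. Qed.

Let Am_ t := amp p T ap a xi xs g0 t.
Let X t := ray p T ap xi xs t.
(* The source is the conjugate of the test packet at time [s], so that their pairing
   at that time is an integral of a square. *)
Let z0 := packet xi (X s) ('i%C * Am_ s) psi.
Let cz0 := fun x => conjc (z0 x).

Let amp_s : normc (Am_ s) = 1.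
Proof. by rewrite normc_amp -/(E s) hEs expR0. Qed.

Let amp_le t : 0 <= t <= te -> normc (Am_ t) <= 1.
Proof. by move=> ht; rewrite normc_amp -/(E t) expR_le1 hE. Qed.

Let tz0 : ctest z0. Proof. exact: packet_ctest spsi fpsi. Qed.
Let tcz0 : ctest cz0. Proof. exact: ctest_conj. Qed.

Let z0_iter i x : (i <= r)%N -> normc (iter i cder z0 x) <= (2 * xi) ^+ r * B.
Proof.
move=> ir.
have e := congr1 (fun F => normc (F x)) (packet_iter xi (X s) ('i%C * Am_ s) i spsi).
move: e; rewrite /= normcM normcX normc_i expr1n mul1r => ->.
rewrite packet_norm normcM normc_i amp_s !mul1r.
have x21 : 1 <= 2 * xi by have := xi1; lra.
have K0 : 0 <= (2 * xi) ^+ r * B by nneg.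
have [hx|hx] := leP `|x - X s| w.
  have hi : cb W w (0 + i) B psi by apply: cb_leq cpsi; rewrite add0n (leq_trans ir).
  apply: (le_trans (cb0 (cb_Qpow (ltW W0) W0 Wxi B0' spsi hi) hx)).
  by rewrite ler_wpM2r// ler_weXn2l.
by rewrite (Qpow_far _ _ spsi fpsi)// normc0.
Qed.

Let conj_far x : w < `|x - X s| -> mu0%:C * cz0 x = 0.
Proof. by move=> hx; rewrite /cz0 /z0 (packet_far _ _ fpsi hx) conjc0 mulr0. Qed.

Let conj_bound i x : (i <= r)%N ->
  r.+1%:R * normc (iter i cder (fun x => mu0%:C * cz0 x) x) <= delta.
Proof.
move=> ir; rewrite iter_cderZ; last by case: tcz0.
rewrite iter_cder_conj; last by case: tz0.
rewrite normcM normcR gtr0_norm// normc_conj.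
have r0 : 0 < r.+1%:R :> R by rewrite ltr0n.
have q0 : 0 < (2 * xi) ^+ r by rewrite exprn_gt0// mulr_gt0.
apply: (@le_trans _ _ (r.+1%:R * (mu0 * ((2 * xi) ^+ r * B)))).
  by rewrite ler_wpM2l ?(ltW r0)// ler_wpM2l ?(ltW mu00)// z0_iter.
rewrite /mu0 le_eqVlt; apply/orP; left; apply/eqP.
by field; rewrite !gt_eqF.
Qed.

Let K t := pr cz0 (packet xi (X t) ('i%C * Am_ t) psi).

Let K_s : c0 * w <= K s.
Proof.
have Lz := ctest_L2 tz0.
have -> : K s = (\int[mu]_x (normc (z0 x) ^+ 2))%R.
  apply: eq_Rintegral => x _; rewrite -/z0 /cz0.
  by case: (z0 x) => u v /=; rewrite sqr_sqrtr ?addr_ge0 ?sqr_ge0//; ring.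
have /Lfun2P[_ iz] := L2_normc Lz.
pose A := `[X s - w / 2, X s + w / 2]%classic.
have e2 : (\int[mu]_(x in A) c0)%R = c0 * w.
  rewrite Rintegral_cst_itv; first by congr (_ * _); field.
  by rewrite lerD2l ge0_cp ?divr_ge0.
rewrite -e2.
have izA : mu.-integrable A (EFin \o (fun x => normc (z0 x) ^+ 2)).
  by apply: (integrableS measurableT _ (@subsetT _ _) iz); exact: measurable_itv.
apply: (@le_trans _ _ (\int[mu]_(x in A) (normc (z0 x) ^+ 2))%R).
  apply: le_Rintegral => //.
  - exact: measurable_itv.
  - exact: cst_integrable.
  - move=> x hx'.
    have hx : `|x - X s| <= w / 2 by move: hx'; rewrite /A /= in_itv /= -ler_distl.
    rewrite -[leRHS]/(normc (z0 x) ^+ 2) /z0 packet_norm normcM normc_i amp_s !mul1r /psi /sbump normcR.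
    have -> : c0 = expR (- 4) ^+ 2 by rewrite /c0 -expRM_natr; congr expR; ring.
    rewrite ler_pXn2r// ?nnegrE ?expR_ge0//.
    apply: le_trans (ler_norm _); apply: bump_ge.
    rewrite addr0 normrM (gtr0_norm W0).
    apply: (le_trans (ler_wpM2l (ltW W0) hx)).
    by rewrite mulrA Ww mul1r.
rewrite [leLHS]Rintegral_mkcond; apply: le_Rintegral => //.
- rewrite -restrict_EFin; apply/(integrable_restrict _ _ (@measurableT _ _)).
    exact: measurable_itv.
  by rewrite setTI.
- by move=> x _; rewrite patchE; case: ifPn => // _; exact: sqr_ge0.
Qed.

Let psi_le y : `|y| <= w -> normc (psi y) <= B. Proof. exact: (cb0 cpsi). Qed.

Let dpsi_le y : `|y| <= w -> normc (cder psi y) <= B * W.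
Proof.
have : cb W w 1 B psi by apply: cb_leq cpsi.
by case=> _ [q _]; exact: q.
Qed.

Let dX t := p%:R * xi ^+ p.-1 * cap T ap t.
Let dc t := 'i%C * damp p T ap a xi xs g0 t.
Let dK t := pr cz0 (packet xi (X t) 1
  (fun y => dc t * psi y + (- ('i%C * Am_ t * (dX t)%:C)) * cder psi y)).

Let is_derive_K t : is_derive t 1 K (dK t).
Proof.
have t12 : t - 1 <= t + 1 by lra.
have [M hM] := amp_bound hp hT hap ha xi xs g0 t12.
apply: (@is_derive_pr_packet _ xi X dX (fun t => 'i%C * Am_ t) dc psi w cz0 M (t - 1) (t + 1)).
- exact: ctest_L2.
- exact: spsi.
- exact: fpsi.
- move=> s1 _; apply: is_cderZ; exact: is_cder_amp.
- move=> s1 _; exact: is_derive_ray.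
- move=> s1 /hM [h1 h2 h3 h4]; split; last exact: h4.
  + by rewrite normcM normc_i mul1r.
  + by rewrite normcM normc_i mul1r.
  + exact: h3.
- by rewrite ltrBlDr ltrDl ltr01.
Qed.

Let dK_le t : 0 <= t <= te -> `|dK t| <= 2 * w * (B ^+ 2 * ((Am + Ca + p%:R * Am) * xi ^+ p)).
Proof.
move=> ht.
pose b2 := fun y => dc t * psi y + (- ('i%C * Am_ t * (dX t)%:C)) * cder psi y.
have s2 : csmooth b2 by apply: csmoothD; apply: csmoothZ => //; exact: csmooth_cder.
have f2 y : w < `|y| -> b2 y = 0.
  by move=> hy; rewrite /b2 fpsi// (cder_eq0 (@open_far _ w) fpsi)// !mulr0 addr0.
have xip : xi ^+ p = xi ^+ p.-1 * xi by rewrite -[in LHS](prednK p0) exprSr.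
have xq : 0 <= xi ^+ p.-1 by nneg.
have xqp : xi ^+ p.-1 <= xi ^+ p by rewrite xip ler_peMr.
have A1 := amp_le ht.
have capA := hAm t.
have d1 : normc (dc t) <= (Am + Ca) * xi ^+ p.
  rewrite normcM normc_i mul1r normcM -[leRHS]mulr1; apply: ler_pM; rewrite ?normc_ge0//.
  rewrite normcM normc_i mul1r (le_trans (normcD _ _))// mulrDl lerD//.
    by rewrite normcR normrM ger0_norm ?exprn_ge0 ?(ltW xi0)// mulrC ler_wpM2r// exprn_ge0// ltW.
  rewrite normcM normcR ger0_norm// mulrC; apply: ler_pM => //; first exact: normc_ge0.
  by apply: (hCa _ (leq0n _)); rewrite prednK.
have d2 : normc (- ('i%C * Am_ t * (dX t)%:C)) <= p%:R * Am * xi ^+ p.-1.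
  rewrite normcN normcM normcM normc_i mul1r normcR -[leRHS]mul1r.
  apply: ler_pM; rewrite ?normc_ge0//.
  rewrite /dX normrM normrM ger0_norm// (ger0_norm xq) -!mulrA ler_wpM2l//.
  by rewrite mulrC ler_wpM2r.
have h2 y : `|y| <= w -> normc (b2 y) <= B * ((Am + Ca + p%:R * Am) * xi ^+ p).
  move=> hy; rewrite (le_trans (normcD _ _))// (normcM (dc t) (psi y)) (normcM (- _) (cder psi y)).
  apply: (@le_trans _ _ ((Am + Ca) * xi ^+ p * B + p%:R * Am * xi ^+ p.-1 * (B * W))).
    apply: lerD.
      exact: (ler_pM (normc_ge0 _) (normc_ge0 _) d1 (psi_le hy)).
    exact: (ler_pM (normc_ge0 _) (normc_ge0 _) d2 (dpsi_le hy)).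
  have -> : p%:R * Am * xi ^+ p.-1 * (B * W) = p%:R * Am * (xi ^+ p.-1 * W) * B by ring.
  have -> : B * ((Am + Ca + p%:R * Am) * xi ^+ p) = (Am + Ca) * xi ^+ p * B + p%:R * Am * xi ^+ p * B by ring.
  by rewrite lerD2l ler_wpM2r// ler_wpM2l ?mulr_ge0// xip ler_wpM2l.
have D0 : 0 <= B * ((Am + Ca + p%:R * Am) * xi ^+ p) by nneg.
have e x : normc (cz0 x) = normc (packet xi (X s) ('i%C * Am_ s) psi x) by rewrite normc_conj.
have := packet_pr_bound xi (X t) 1 spsi s2 fpsi f2 w0' B0' D0 psi_le h2 tcz0 e.
rewrite normcM normc_i amp_s ComplexField.Normc.normc1 !mul1r => H.
apply: (le_trans H); rewrite le_eqVlt; apply/orP; left; apply/eqP; ring.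
Qed.

Let K_near t : 0 <= t <= te -> `|t - s| <= h -> c0 * w / 2 <= K t.
Proof.
move=> ht hts.
have cK : continuous K.
  by apply: derivable_continuous => x; have [] := is_derive_K x.
have hd t' : 0 < t' < te -> is_derive t' 1 K (dK t') by move=> _; exact: is_derive_K.
have hD t' : 0 < t' < te -> `|dK t'| <= 2 * w * (B ^+ 2 * ((Am + Ca + p%:R * Am) * xi ^+ p)).
  by case/andP=> u1 u2; apply: dK_le; rewrite !ltW.
have := dist_le_of_derivative_on te0 cK hd hD hs ht.
set D := 2 * w * _ => H.
have D0 : 0 <= D by rewrite /D; nneg.
have {}H : K s - K t <= D * h.
  apply: le_trans (ler_norm _) _; apply: le_trans H _.
  by rewrite ler_wpM2l// distrC.
have e : D * h <= c0 * w / 2.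
  have -> : D * h = (h * (4 * B ^+ 2 * (Am + Ca + p%:R * Am) * xi ^+ p)) * (w / 2).
    by rewrite /D; field.
  by rewrite -[leRHS]mulrA ler_wpM2r// divr_ge0.
exact: half_le_of_dist K_s (le_trans H e).
Qed.

Let source t x : R[i] := (tent s h t)%:C * (mu0%:C * cz0 x).

Let L2cz0 : L2 cz0. Proof. exact: ctest_L2. Qed.

Let SrayE b t : csmooth b -> (forall y, w < `|y| -> b y = 0) -> 0 < t < te ->
  Sray p T ap a xi xs g0 source b t =
  tent s h t * (mu0 * pr cz0 (packet xi (X t) ('i%C * Am_ t) b)).
Proof.
move=> sb fb /andP[t0 t1].
have ct : clamp T t = t by apply: clamp_id; rewrite (ltW t0) (le_trans (ltW t1)).
have Lp : L2 (packet xi (X t) ('i%C * Am_ t) b) by exact/ctest_L2/(packet_ctest _ _ _ sb fb).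
rewrite /Sray ct /source prA pr_real//; last exact: L2Z.
by congr (_ * _); rewrite prA pr_real.
Qed.

Let L2source t : L2 (source t). Proof. by apply: L2Z; exact: L2Z. Qed.

Let sig t := tent s h t * (mu0 * (2 * w * B)).

Let m2 : 0 <= mu0 * (2 * w * B). Proof. by rewrite mulr_ge0 ?(ltW mu00)//; nneg. Qed.

Let Sray_bound n b B' t : 0 <= B' -> Cl W w n B' b -> 0 < t < te ->
  `|Sray p T ap a xi xs g0 source b t| <= sig t * B'.
Proof.
move=> Bn [sb fb cb_b] ht; have /andP[t0 t1] := ht.
rewrite SrayE// normrM normrM (ger0_norm (proj1 (andP (tent_itv s t h0)))) (gtr0_norm mu00).
have e x : normc (cz0 x) = normc (packet xi (X s) ('i%C * Am_ s) psi x) by rewrite normc_conj.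
have := packet_pr_bound xi (X t) ('i%C * Am_ t) spsi sb fpsi fb w0' B0' Bn psi_le (cb0 cb_b) tcz0 e.
rewrite !(normcM 'i%C) normc_i amp_s !mul1r => HH.
rewrite /sig -mulrA ler_wpM2l ?(proj1 (andP (tent_itv s t h0)))//.
rewrite -mulrA ler_wpM2l ?(ltW mu00)//; apply: (le_trans HH).
have A1 : normc (Am_ t) * B' <= B' by rewrite ler_piMl// amp_le// !ltW.
have -> : 2 * w * B * B' = B * B' * (2 * w) by ring.
by rewrite ler_wpM2r ?mulr_ge0// ler_wpM2l.
Qed.

Let Sray_lower t : 0 < t < te ->
  c0 / (4 * B) * sig t <= Sray p T ap a xi xs g0 source psi t.
Proof.
move=> ht; have /andP[t0 t1] := ht.
rewrite SrayE//.
have -> : c0 / (4 * B) * sig t = tent s h t * (mu0 * (c0 * w / 2)).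
  by rewrite /sig; field; rewrite gt_eqF.
have [hts|hts] := leP h `|t - s|; first by rewrite (tent_far h0 hts) !mul0r.
apply: (ler_wpM2l (proj1 (andP (tent_itv s t h0)))); apply: (ler_wpM2l (ltW mu00)).
by apply: K_near; [rewrite !ltW|exact: ltW].
Qed.

Let Aray_bound n b B' t : (n + p.+1 <= Nm)%N -> 0 <= B' ->
  Cl W w (n + p.+1) B' b -> Cl W w n (eta * B') (Aray p T ap a xi xs t b).
Proof.
move=> nN B'0 [sb fb cb_b].
have T0 := ltW hT.
have sc j : (j < p)%N -> csmooth (fun y => a j (clamp T t) (y + X t)).
  by move=> jp; apply: csmooth_shift; exact: coef_csmooth T0 (ha jp) t.
have [] := @ampop_bound _ W w xi W1 Ww Wxi p n B' Ca Am (cap T ap t)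
  (fun j y => a j (clamp T t) (y + X t)) b hp B'0 Ca0 (hAm t) sb cb_b sc.
  move=> j jp i iN x; rewrite iter_cder_shift; last exact: coef_csmooth T0 (ha jp) t.
  by apply: hCa => //; exact: leq_trans nN.
move=> sA cA; split; first exact: sA.
  by apply: ampop_far => //; rewrite gt_eqF.
apply: cb_le cA; first exact: ltW.
rewrite ler_wpM2r// /eta ler_wpM2r ?ler_wpM2r ?exprn_ge0 ?(ltW xi0)//.
  by rewrite addr_ge0// ?mulr_ge0 ?sqr_ge0 ?invr_ge0// ltW.
rewrite lerD2l; apply: ler_wpM2r; first by nneg.
by rewrite ler_wpM2r// ler_weXn2l ?ler1n.
Qed.

Lemma ray_estimate :
  c0 * mu0 * w * h / 16 <= B * expR (E te) + B * (eta * te) ^+ k.+1.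
Proof.
have [u hu Lu] := apriori (continuous_tent (s := s) (h := h)) (ctestZ mu0%:C tcz0) conj_far w0'
  w1 (fun t => tent_itv s t h0) conj_bound.
have T0 := ltW hT.
pose F := Fray p T ap a xi xs g0 u.
pose H t := prim (tent s h) t * (mu0 * (2 * w * B)).
have cT := @continuous_tent s h.
have in_T t : 0 < t < te -> 0 < t < T.
  by case/andP => -> t1; rewrite (lt_le_trans t1).
have F00 n B' b : Cl W w n B' b -> F b 0 = 0.
  by case=> sb fb _; exact: (Fray0 hT xi xs g0 (fun=> erefl) hu sb fb).
have Fd n B' b t : Cl W w n B' b -> 0 < t < te ->
    is_derive t 1 (F b) (Sray p T ap a xi xs g0 source b t + F (Aray p T ap a xi xs t b) t).
  case=> sb fb _ /in_T ht.
  exact: (is_derive_Fray hp hT hap ha xs g0 xi0 (fun t _ => L2source t) hu w0' w1 sb fb ht).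
have Fc n B' b : Cl W w n B' b -> {within `[0, te], continuous (F b)}.
  case=> sb fb _; apply: continuous_subspaceT => t.
  exact: (Fray_continuous hp hT hap ha hu w0' w1 sb fb).
have Fb' B' b t : 0 <= B' -> Cl W w 0 B' b -> 0 <= t <= te ->
    `|F b t| <= normc (Am_ t) * B'.
  move=> B'0 [sb fb cb_b] ht.
  have Lut : L2 (u (clamp T t)).
    by have [[q _] _ _] := hu; apply: Hinf_L2; apply: q; exact: clamp_itv.
  have all y : normc (b y) <= B'.
    have [hy|/fb ->] := leP `|y| w; first exact: (cb0 cb_b).
    by rewrite normc0.
  apply: (le_trans (pr_bound Lut (ctest_L2 (packet_ctest _ _ _ sb fb)))).
  have n1 := Lu _ (clamp_itv t T0).
  rewrite -[leRHS]mul1r; apply: ler_pM; rewrite ?L2norm_ge0//.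
  exact: packet_L2norm sb fb w0' w1 B'0 all.
have Fb B' b t : 0 <= B' -> Cl W w 0 B' b -> 0 <= t <= te -> `|F b t| <= B'.
  move=> B'0 hb ht; apply: (le_trans (Fb' _ _ _ B'0 hb ht)).
  by rewrite ler_piMl// amp_le.
have Hd t : 0 < t < te -> is_derive t 1 H (sig t).
  move=> _; have -> : H = (mu0 * (2 * w * B)) \*: prim (tent s h).
    by apply/funext => x; rewrite /H mulrC.
  apply: (is_derive_eq (is_deriveZ _ (is_derive_prim t cT))).
  by rewrite /sig [RHS]mulrC.
have Hc : {within `[0, te], continuous H}.
  apply: continuous_subspaceT => t; apply: cvgM; first exact: continuous_prim.
  exact: cvg_cst.
have H0 : H 0 = 0 by rewrite /H prim0 mul0r.
have sig0 t : 0 < t < te -> 0 <= sig t.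
  by move=> _; rewrite /sig mulr_ge0// (proj1 (andP (tent_itv s t h0))).
have Cpsi : Cl W w (k.+1 * p.+1) B psi by split.
have low := @hierarchy_lower _ W w te eta p Nm F (Sray p T ap a xi xs g0 source)
  (fun t b => Aray p T ap a xi xs t b) sig H te0 eta0 F00 Fd Fc Fb
  (fun n B' b t nN B'0 hb _ => @Aray_bound n b B' t nN B'0 hb) (fun n B' b t => @Sray_bound n b B' t) H0 Hd Hc sig0 eta_te
  k B psi (c0 / (4 * B)) B0' (leqnn _) Cpsi Sray_lower.
have Hte : h / 4 * (mu0 * (2 * w * B)) <= H te.
  by rewrite /H ler_wpM2r// prim_tent_ge.
have Hge : 0 <= H te.
  by apply: le_trans Hte; rewrite mulr_ge0// divr_ge0// ltW.
have q : 8 * (eta * te) * B <= 2 * (c0 / (4 * B)).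
  have -> : 2 * (c0 / (4 * B)) = c0 / (2 * B) by field; rewrite gt_eqF.
  rewrite ler_pdivlMr; last by rewrite mulr_gt0.
  by apply: le_trans eta_te'; rewrite le_eqVlt; apply/orP; left; apply/eqP; ring.
have := half_tail Hge q low; rewrite -exprS => fin.
apply: le_trans (le_trans _ fin) _.
  apply: le_trans (_ : c0 / (4 * B) / 2 * (h / 4 * (mu0 * (2 * w * B))) <= _).
    rewrite le_eqVlt; apply/orP; left; apply/eqP; field; rewrite gt_eqF//.
  by rewrite ler_wpM2l// !divr_ge0 ?mulr_ge0 ?expR_ge0.
rewrite lerD2r; apply: (le_trans (ler_norm _)).
have tete : 0 <= te <= te by rewrite lexx (ltW te0).
have C0 : Cl W w 0 B psi by split => //; exact: cb_leq cpsi.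
apply: (le_trans (Fb' _ _ _ B0' C0 tete)).
by rewrite normc_amp -/(E te) mulrC.
Qed.

End RayEstimate.

Section Constants.
Variable R : realType.
Local Notation mu := (@lebesgue_measure R).

Lemma uniform_constant n (P : nat -> R -> Prop) :
  (forall i K K', K <= K' -> P i K -> P i K') -> (forall i, (i < n)%N -> exists K, P i K) ->
  exists2 K, 1 <= K & forall i, (i < n)%N -> P i K.
Proof.
move=> mono; elim: n => [|n IH] ex; first by exists 1.
have [|K K1 hK] := IH; first by move=> i ilt; apply: ex; exact: ltnW.
have [K' hK'] := ex n (leqnn _).
exists (Num.max K K'); first by rewrite le_max K1.
move=> i; rewrite ltnS leq_eqVlt => /predU1P[->|/hK].
  by apply: mono hK'; rewrite le_max lexx orbT.
by apply: mono; rewrite le_max lexx.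
Qed.

Variables (p : nat) (T m : R) (ap : R -> R) (a : nat -> R -> R -> R[i]).
Hypotheses (hp : (2 <= p)%N) (hT : 0 < T).
Hypothesis hap : {within `[0, T], continuous ap}.
Hypothesis ha : forall j, (j < p)%N -> C0T T (@Binf R) (@Bnorm R) (a j).
Let T0 : 0 <= T. Proof. exact: ltW. Qed.
Let pp : (p.-1 < p)%N. Proof. by rewrite prednK// ltnW. Qed.

Lemma cap_bounded : exists Am, forall t, `|cap T ap t| <= Am.
Proof.
have cc : continuous (fun t => `|cap T ap t|).
  by move=> t; apply: cvg_norm; exact: (continuous_cap hT hap).
have [s _ hs] := EVT_max T0 (continuous_subspaceT cc).
exists `|cap T ap s| => t.
have -> : cap T ap t = cap T ap (clamp T t) by rewrite /cap (clamp_id (clamp_itv t T0)).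
by apply: hs; rewrite in_itv; exact: clamp_itv.
Qed.

Lemma coefs_bounded n : exists2 Ca, 1 <= Ca &
  forall j, (j < p)%N -> forall i, (i <= n)%N -> forall t x,
  normc (iter i cder (a j (clamp T t)) x) <= Ca.
Proof.
apply: (@uniform_constant p (fun j K => forall i, (i <= n)%N -> forall t x,
  normc (iter i cder (a j (clamp T t)) x) <= K)).
  by move=> j K K' KK' h i iN t x; exact: le_trans (h i iN t x) KK'.
move=> j jp.
have [|i _|K _ hK] := @uniform_constant n.+1 (fun i K => forall t x,
  normc (iter i cder (a j (clamp T t)) x) <= K).
- by move=> i K K' KK' h t x; exact: le_trans (h t x) KK'.
- by have [K _ hK] := coef_bounded T0 (ha jp) i; exists K.
- by exists K => i iN; exact: hK.
Qed.

Lemma average_le (C rho c x t : R) : (forall y, normc (a p.-1 (clamp T t) y) <= C) -> 0 < rho ->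
  (\int[mu]_(th in `[(- rho)%R, rho]) Im (a p.-1 (clamp T t) (x + c * th)%R))%R <= 2 * rho * C.
Proof.
move=> hC rho0.
have [_ cI] := csmooth_continuous (csmooth_affine c x (coef_csmooth T0 (ha pp) t)).
have -> : 2 * rho * C = (\int[mu]_(th in `[(- rho)%R, rho]) C)%R.
  by rewrite Rintegral_cst_itv ?ge0_cp ?(ltW rho0)//; ring.
under eq_Rintegral do rewrite addrC.
apply: le_Rintegral.
- exact: measurable_itv.
- exact: continuous_integrable.
- exact: cst_integrable.
- by move=> th _; apply: le_trans (ler_norm _) _; exact: le_trans (normc_Im _) (hC _).
Qed.

End Constants.

(** * Choice of the scales *)

Section Contradiction.
Variable R : realType.
Local Notation mu := (@lebesgue_measure R).

Lemma growth_increment_le (f : R -> R) (C s t : R) : continuous f -> (forall t, `|f t| <= C) ->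
  0 <= s -> s <= t -> prim f t - prim f s <= C * t.
Proof.
move=> cf hC s0 st.
have C0 : 0 <= C := le_trans (normr_ge0 _) (hC 0).
have := le_of_derivative_bound (fun t => is_derive_prim t cf) hC t s.
move=> /(le_trans (ler_norm _)) H; apply: (le_trans H).
by rewrite ger0_norm ?subr_ge0// ler_wpM2l// gerBl.
Qed.

Lemma expRN_lt (x : R) : 0 < x -> expR (- x) < x^-1.
Proof.
move=> x0; rewrite expRN ltf_pV2 ?posrE ?expR_gt0//.
by have := @expR_gt1Dx _ x; rewrite gt_eqF// => /(_ isT); lra.
Qed.

Lemma lt_halves (u v w : R) : u < w / 2 -> v <= w / 2 -> w <= u + v -> False.
Proof. by move=> *; lra. Qed.

Lemma double_le_half (x y : R) : 4 * x <= y -> 2 * x <= 2^-1 * y.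
Proof. by move=> *; lra. Qed.

Lemma exponent_bound (x1 x2 x3 x4 x5 x6 C : R) : x4 - C <= x3 - x2 ->
  x5 + C + x6 <= x4 -> x1 <= x2 -> x1 - x3 <= - x5 - x6.
Proof. by move=> *; lra. Qed.

Lemma exponents_even r p : (2 * (6 * r + 6 * p + 4).+1 = 12 * r + 12 * p + 8 + 2)%N.
Proof. lia. Qed.

Lemma exponents_ge r p : (r <= (6 * r + 6 * p + 4).+1)%N.
Proof. lia. Qed.

Lemma ln1_expR n (rho : R) : 0 < rho -> expR (- (n%:R * ln (1 + rho))) <= rho^-1 ^+ n.
Proof.
move=> rho0; have q : 0 < 1 + rho by rewrite addr_gt0.
rewrite -mulrN mulrC expRM_natr expRN lnK ?posrE//.
apply: lerXn2r; rewrite ?nnegrE ?invr_ge0 ?(ltW q) ?(ltW rho0)//.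
by rewrite lef_pV2 ?posrE// lerDr.
Qed.

Variables (p : nat) (T m : R) (ap : R -> R) (a : nat -> R -> R -> R[i]).
Hypotheses (hp : (2 <= p)%N) (hT : 0 < T).
Hypothesis hap : {within `[0, T], continuous ap}.
Hypothesis ha : forall j, (j < p)%N -> C0T T (@Binf R) (@Bnorm R) (a j).
Hypotheses (hm : 0 < m) (hcap : forall t, m <= `|cap T ap t|).
Variables (B Ca Am delta : R) (r : nat).
Hypothesis apriori : a_priori_bound p T ap a r delta.
Hypothesis delta0 : 0 < delta.
Let k := (6 * r + 6 * p + 4)%N.
Let Nm := (k.+1 * p.+1)%N.
Hypothesis B1 : 1 <= B.
Hypothesis hB : forall i x, (i <= Nm)%N -> normc (iter i cder (fun y => (bump y)%:C) x) <= B.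
Hypothesis Ca1 : 1 <= Ca.
Hypothesis hCa : forall j, (j < p)%N -> forall i, (i <= Nm)%N -> forall t x,
  normc (iter i cder (a j (clamp T t)) x) <= Ca.
Hypothesis hAm : forall t, `|cap T ap t| <= Am.

Let c0 : R := expR (- 8).
Let kap0 : R := c0 / (4 * B ^+ 2 * (Am + Ca + p%:R * Am)).
Let Keta : R := 3 ^+ p * Am + 2 ^+ Nm * Ca * (3 ^+ p + 2 + p%:R * 2 ^+ p).
Let K1 : R := c0 * delta * kap0 / (16 * r.+1%:R * 2 ^+ r * B).
Let C2 : R := 8 * Ca * Am ^+ 2 / m ^+ 2.
Let Ex := (12 * r + 12 * p + 8)%N.

Let T0 : 0 <= T. Proof. exact: ltW. Qed.
Let B0 : 0 < B. Proof. exact: lt_le_trans ltr01 B1. Qed.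
Let Ca0 : 0 < Ca. Proof. exact: lt_le_trans ltr01 Ca1. Qed.
Let Am0 : 0 < Am. Proof. exact: lt_le_trans hm (le_trans (hcap 0) (hAm 0)). Qed.
Let c00 : 0 < c0. Proof. exact: expR_gt0. Qed.
Let c01 : c0 <= 1. Proof. by rewrite expR_le1 lerNl oppr0 ler0n. Qed.
Let Gam : R := Am + Ca + p%:R * Am.
Let Gam0 : Ca <= Gam. Proof. by rewrite /Gam -addrA addrCA lerDl addr_ge0 ?mulr_ge0 ?ler0n ?(ltW Am0). Qed.
Let den0 : 0 < 4 * B ^+ 2 * Gam.
Proof.
apply: mulr_gt0; last exact: lt_le_trans Gam0.
by apply: mulr_gt0; rewrite ?ltr0n// exprn_gt0.
Qed.
Let kap00 : 0 < kap0. Proof. exact: divr_gt0 c00 den0. Qed.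
Let Keta0 : 0 <= Keta.
Proof.
by have A := ltW Am0; have C := ltW Ca0; rewrite /Keta; nneg.
Qed.
Let K10 : 0 < K1.
Proof.
apply: divr_gt0; first exact: mulr_gt0 (mulr_gt0 c00 delta0) kap00.
by rewrite mulr_gt0// mulr_gt0 ?exprn_gt0// mulr_gt0 ?ltr0n.
Qed.
Let pp : (p.-1 < p)%N. Proof. by rewrite prednK// ltnW. Qed.
Let kap0_le : kap0 <= Ca^-1.
Proof.
rewrite /kap0 ler_pdivrMr// mulrC ler_pdivlMr//.
apply: (@le_trans _ _ (1 * Ca)); first by rewrite ler_wpM2r// ltW.
rewrite mul1r (le_trans Gam0)// ler_peMl ?(le_trans (ltW Ca0))//.
by rewrite -[leLHS]mul1r ler_pM ?ler1n// exprn_ege1.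
Qed.

Section LargeScale.
Variables (rho Lam x0 : R).
Hypotheses (rho2 : 2 <= rho) (rhoA : 4 * Am <= m * rho) (rhoT : 1 <= T * rho).
Hypotheses (rhoK : 4 * Keta <= rho) (rhoB : 32 * B ^+ 2 * Keta <= c0 * rho).
Hypothesis rhoK1 : 2 * B * (2 * Keta) ^+ k.+1 <= K1 * rho.
Hypotheses (Lam1 : 1 + C2 <= m / Am * Lam).
Hypothesis (LamE : Ex%:R * ln (1 + rho) + C2 + 2 * B / K1 <= m / Am * Lam).
Hypothesis HLam : forall t, Lam <= (\int[mu]_(th in `[(- rho)%R, rho])
  Im (a p.-1 (clamp T t) (x0 + p%:R * cap T ap 0 * th)%R))%R.

Let rho0 : 0 < rho. Proof. by apply: lt_le_trans rho2. Qed.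
Let rho1 : 1 <= rho. Proof. by apply: le_trans rho2; rewrite ler1n. Qed.

(* With these scales [W ^+ 2 / xi + w] is [2 * rho ^- 4], hence [eps] below tends to 0. *)
Let W : R := rho ^+ 4.
Let w : R := rho^-1 ^+ 4.
Let xi : R := rho ^+ 12.
Let lam : R := xi ^+ p.-1.
Let T' : R := rho ^+ 2 / lam.

Let W1 : 1 <= W. Proof. exact: exprn_ege1. Qed.
Let Ww : W * w = 1. Proof. by rewrite -exprMn mulfV ?gt_eqF// expr1n. Qed.
Let w0 : 0 < w. Proof. by rewrite exprn_gt0// invr_gt0. Qed.
Let w1 : 2 * w <= 1.
Proof.
rewrite -[leRHS]Ww ler_wpM2r ?(ltW w0)//; apply: (le_trans rho2).
by rewrite /W exprS ler_peMr ?(ltW rho0)// exprn_ege1.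
Qed.
Let Wxi : W <= xi. Proof. exact: ler_weXn2l. Qed.
Let xi0 : 0 < xi. Proof. exact: exprn_gt0. Qed.
Let lam0 : 0 < lam. Proof. exact: exprn_gt0. Qed.
Let T'0 : 0 < T'. Proof. by rewrite divr_gt0// exprn_gt0. Qed.
Let lamT' : lam * T' = rho ^+ 2. Proof. by rewrite /T' mulrC divfK// gt_eqF. Qed.
Let T'T : T' <= T.
Proof.
have xl : xi <= lam.
  rewrite /lam -[leLHS]expr1; apply: ler_weXn2l; first exact: exprn_ege1.
  by move: hp; case: (p) => [//|[]].
rewrite ler_pdivrMr//; apply: (@le_trans _ _ (T * xi)); last by rewrite ler_wpM2l.
apply: (@le_trans _ _ (T * rho * rho ^+ 2)).
  by rewrite ler_peMl// exprn_ge0// ltW.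
rewrite -mulrA -exprS ler_wpM2l// ler_weXn2l//.
Qed.
Let b t y : R := Im (a p.-1 (clamp T t) y).
Let bC t y : `|b t y| <= Ca.
Proof. by apply: (le_trans (normc_Im _)); exact: (hCa pp (leq0n _) t y). Qed.
Let bL t y z : `|b t y - b t z| <= 2 * Ca * `|y - z|.
Proof.
have sa := coef_csmooth T0 (ha pp) t.
have N1 : (1 <= Nm)%N by [].
have := cder_lipschitz (csmooth_cdf sa) (fun x => hCa pp N1 t x) y z.
by apply: le_trans; rewrite /b -raddfB; exact: normc_Im.
Qed.
Let bX X : continuous X -> continuous (fun t => b t (X t)).
Proof. by move=> cX; exact: (coef_path_continuous T0 (ha pp) cX).2. Qed.

Let w_le1 : w <= 1. Proof. by have := w1; have := w0; set z := w; lra. Qed.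
Let xi_ge1 : 1 <= xi. Proof. exact: exprn_ege1. Qed.
Let xip : xi ^+ p = lam * xi. Proof. by rewrite /lam -exprSr prednK// ltnW. Qed.
Let xip0 : 0 < xi ^+ p. Proof. exact: exprn_gt0. Qed.

Let h : R := kap0 * w / xi ^+ p.
Let h0 : 0 < h. Proof. by apply: divr_gt0 => //; exact: mulr_gt0. Qed.
Let hsmall : h * (4 * B ^+ 2 * Gam * xi ^+ p) <= c0.
Proof.
have -> : h * (4 * B ^+ 2 * Gam * xi ^+ p) = c0 * w.
  rewrite /h /kap0 -/Gam; set G := 4 * _ * Gam; have G0 : G != 0 by rewrite gt_eqF.
  by field; rewrite G0 gt_eqF.
by rewrite ler_piMr// ltW.
Qed.

Let h_le te : 1 <= lam * (Ca * te) -> h <= te.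
Proof.
move=> H; have lC : 0 < lam * Ca by exact: mulr_gt0.
apply: (@le_trans _ _ ((lam * Ca)^-1)); last first.
  by rewrite -[leLHS]mul1r ler_pdivrMr// mulrC -mulrA.
rewrite /h ler_pdivrMr// xip.
have -> : (lam * Ca)^-1 * (lam * xi) = Ca^-1 * xi by field; rewrite !gt_eqF.
apply: ler_pM; rewrite ?(ltW kap00) ?(ltW w0)//.
exact: le_trans w_le1 xi_ge1.
Qed.

Let eps : R := 2 * Keta * rho^-1 ^+ 2.
Let eta_te te : te <= T' -> Keta * xi ^+ p.-1 * (W ^+ 2 / xi + w) * te <= eps.
Proof.
move=> teT'.
have -> : eps = Keta * xi ^+ p.-1 * (W ^+ 2 / xi + w) * T'.
  have -> : W ^+ 2 / xi + w = 2 * rho^-1 ^+ 4 by rewrite /W /xi /w; field; rewrite gt_eqF.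
  by rewrite /eps /T' -/lam; field; rewrite !gt_eqF.
apply: ler_wpM2l => //; apply: mulr_ge0; first by apply: mulr_ge0 => //; exact: ltW.
by apply: addr_ge0; [apply: divr_ge0; [exact: sqr_ge0|exact: ltW]|exact: ltW].
Qed.

Let rhoV1 : rho^-1 <= 1. Proof. by rewrite invf_le1. Qed.
Let rhoV0 : 0 < rho^-1. Proof. by rewrite invr_gt0. Qed.
Let eps_le : eps <= 2 * Keta / rho.
Proof.
rewrite /eps ler_wpM2l ?mulr_ge0//.
by rewrite expr2 ler_piMr// ltW.
Qed.

Let eps_half : eps <= 2^-1.
Proof.
apply: (le_trans eps_le); rewrite ler_pdivrMr//.
exact: double_le_half.
Qed.

Let eps_c0 : 16 * B ^+ 2 * eps <= c0.
Proof.
apply: (@le_trans _ _ (16 * B ^+ 2 * (2 * Keta / rho))).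
  by rewrite ler_wpM2l// mulr_ge0// sqr_ge0.
rewrite !mulrA ler_pdivrMr//; apply: le_trans rhoB.
by rewrite le_eqVlt; apply/orP; left; apply/eqP; ring.
Qed.

Let eps0 : 0 <= eps. Proof. by rewrite /eps mulr_ge0 ?mulr_ge0 ?exprn_ge0// ltW. Qed.

Let eps_pow : B * eps ^+ k.+1 <= K1 * rho^-1 ^+ Ex / 2.
Proof.
have -> : eps ^+ k.+1 = (2 * Keta) ^+ k.+1 * (rho^-1 ^+ Ex * rho^-1 ^+ 2).
  by rewrite /eps exprMn -exprM -exprD; congr (_ * _ ^+ _); exact: exponents_even.
have q0 : 0 <= rho^-1 ^+ Ex by rewrite exprn_ge0// ltW.
have e2 : rho^-1 ^+ 2 <= rho^-1 by rewrite expr2 ler_piMr// ltW.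
apply: (@le_trans _ _ (B * ((2 * Keta) ^+ k.+1 * (rho^-1 ^+ Ex * rho^-1)))).
  rewrite ler_wpM2l ?(ltW B0)// ler_wpM2l ?exprn_ge0 ?mulr_ge0//.
  by rewrite ler_wpM2l.
have -> : B * ((2 * Keta) ^+ k.+1 * (rho^-1 ^+ Ex * rho^-1)) =
   (2 * B * (2 * Keta) ^+ k.+1) * (rho^-1 * rho^-1 ^+ Ex / 2) by field; rewrite gt_eqF.
apply: (@le_trans _ _ (K1 * rho * (rho^-1 * rho^-1 ^+ Ex / 2))).
  by rewrite ler_wpM2r// divr_ge0// mulr_ge0// ltW.
rewrite le_eqVlt; apply/orP; left; apply/eqP.
by rewrite -!mulrA; congr (_ * _); rewrite mulVKf ?gt_eqF.
Qed.

Lemma no_large_average : False.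
Proof.
have Lam0 : 0 <= Lam.
  have C20 : 0 <= C2 by rewrite divr_ge0 ?sqr_ge0// mulr_ge0 ?sqr_ge0// mulr_ge0// ltW.
  have : 0 < m / Am * Lam by apply: lt_le_trans Lam1; exact: ltr_wpDr.
  by rewrite pmulr_rgt0 ?divr_gt0// => /ltW.
have hl1 : rho ^+ 2 <= lam * T' by rewrite lamT'.
have hl2 : 4 * Am * rho <= m * (lam * T').
  by rewrite lamT' expr2 mulrA ler_wpM2r// ltW.
have [xs [t1 [t2 [t10 t12 t2T' inc]]]] := exists_growing_ray (ltW Ca0)
  (mulr_ge0 (ler0n _ 2) (ltW Ca0)) hm lam0 rho0 Lam0 T'0 bX bC bL (continuous_cap hT hap)
  hcap hAm hl1 hl2 HLam.
pose G := growth p T ap a xi xs.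
have [_ cI] : continuous (fun t => Re (qray p T ap a xi xs t)) /\
    continuous (fun t => Im (qray p T ap a xi xs t)).
  by apply: continuous_qray.
have cG : continuous G := continuous_prim cI.
have {}inc : m / Am * Lam - C2 <= lam * (G t2 - G t1) := inc.
have t20 : 0 <= t2 := le_trans t10 t12.
have [s hs hmin] := EVT_min t20 (continuous_subspaceT cG).
rewrite in_itv /= in hs.
have lt2 : 1 <= lam * (Ca * t2).
  apply: (@le_trans _ _ (m / Am * Lam - C2)); first by rewrite lerBrDr.
  apply: (le_trans inc); apply: (ler_wpM2l (ltW lam0)).
  by apply: growth_increment_le => // t; exact: bC.
have ht2 := h_le lt2.
have t2p : 0 < t2 := lt_le_trans h0 ht2.
have hE t : 0 <= t <= t2 -> lam * G s - xi ^+ p.-1 * G t <= 0.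
  move=> ht; rewrite -/lam -mulrBr mulr_ge0_le0 ?(ltW lam0)// subr_le0.
  by apply: hmin; rewrite in_itv.
have hEs : lam * G s - xi ^+ p.-1 * G s = 0 by rewrite subrr.
have rN : (r <= k.+1 * p.+1)%N.
  by exact: leq_trans (exponents_ge r p) (leq_pmulr _ _).
have et := eta_te t2T'.
have et2 : 16 * B ^+ 2 * (Keta * xi ^+ p.-1 * (W ^+ 2 / xi + w) * t2) <= c0.
  apply: le_trans eps_c0; apply: ler_wpM2l => //.
  by apply: mulr_ge0 => //; exact: sqr_ge0.
have := ray_estimate hp hT hap ha apriori delta0 t2p (le_trans t2T' T'T) hs W1 Ww w1 Wxi
  rN B1 hB (ltW Ca0) hCa hAm hE hEs h0 ht2 hsmall (le_trans et eps_half) et2.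
set L := (X in X <= _) => fin.
have LE : L = K1 * rho^-1 ^+ Ex.
  have -> : rho^-1 ^+ Ex = (xi ^+ r)^-1 * (xi ^+ p)^-1 * w ^+ 2.
    by rewrite /xi /w -!exprM -!exprVn -!exprD; congr (_ ^+ _).
  have r0 : r.+1%:R != 0 :> R by rewrite pnatr_eq0.
  have p2 : 2 ^+ r != 0 :> R by rewrite expf_neq0// pnatr_eq0.
  have x1 : xi ^+ r != 0 by rewrite expf_neq0// gt_eqF.
  have x2 : xi ^+ p != 0 by rewrite gt_eqF.
  have b0 : B != 0 by rewrite gt_eqF.
  rewrite /L exprMn /K1 /h -/c0; move: r0 p2 x1 x2 b0.
  set y1 := xi ^+ r; set y2 := xi ^+ p; set y3 := 2 ^+ r; set y4 := _.+1%:R; move=> *.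
  by field; do ?[apply/andP; split].
have tail : B * (Keta * xi ^+ p.-1 * (W ^+ 2 / xi + w) * t2) ^+ k.+1 <= K1 * rho^-1 ^+ Ex / 2.
  apply: le_trans eps_pow; rewrite ler_wpM2l ?(ltW B0)// lerXn2r ?nnegrE//.
  apply: mulr_ge0 => //; apply: mulr_ge0; first by apply: mulr_ge0 => //; exact: ltW.
  by apply: addr_ge0; [apply: divr_ge0; [exact: sqr_ge0|exact: ltW]|exact: ltW].
have head : B * expR (lam * G s - xi ^+ p.-1 * G t2) < K1 * rho^-1 ^+ Ex / 2.
  have le1 : lam * G s - xi ^+ p.-1 * G t2 <= - (Ex%:R * ln (1 + rho)) - 2 * B / K1.
    have g1 : G s <= G t1 by apply: hmin; rewrite in_itv /= t10.
    have g2 : lam * G s <= lam * G t1 by exact: (ler_wpM2l (ltW lam0)).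
    rewrite -/lam; move: inc LamE g2; rewrite mulrBr.
    exact: exponent_bound.
  apply: (@le_lt_trans _ _ (B * (expR (- (Ex%:R * ln (1 + rho))) * expR (- (2 * B / K1))))).
    by rewrite ler_wpM2l ?(ltW B0)// -expRD ler_expR.
  apply: (@le_lt_trans _ _ (B * (rho^-1 ^+ Ex * expR (- (2 * B / K1))))).
    rewrite ler_wpM2l ?(ltW B0)// ler_wpM2r ?expR_ge0//; exact: ln1_expR.
  have -> : K1 * rho^-1 ^+ Ex / 2 = B * (rho^-1 ^+ Ex * (2 * B / K1)^-1).
    by field; rewrite !gt_eqF.
  rewrite ltr_pM2l// ltr_pM2l ?exprn_gt0//; apply: expRN_lt.
  by rewrite divr_gt0// mulr_gt0.
by apply: (lt_halves head tail); rewrite -LE.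
Qed.

End LargeScale.

Lemma average_bound : exists M N : R, 0 < M /\ 0 < N /\ forall rho x : R, 0 < rho ->
  exists2 t, 0 <= t <= T &
    (\int[mu]_(th in `[(- rho)%R, rho])
      Im (a p.-1 t (x + p%:R * ap 0 * th)%R))%R <= M * ln (1 + rho) + N.
Proof.
have C20 : 0 <= C2.
  by apply: divr_ge0; rewrite ?sqr_ge0// mulr_ge0 ?sqr_ge0// mulr_ge0// ltW.
pose q1 := 4 * Am / m; pose q2 := T^-1; pose q3 := 4 * Keta.
pose q4 := 32 * B ^+ 2 * Keta / c0.
pose q5 := 2 * B * (2 * Keta) ^+ k.+1 / K1.
pose Q := Num.max 2 (Num.max (Num.max q1 q2) (Num.max q3 (Num.max q4 q5))).
have Q2 : 2 <= Q by rewrite /Q le_max lexx.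
pose Y := 1 + C2 + 2 * B / K1.
have BK0 : 0 < 2 * B / K1 by rewrite divr_gt0// mulr_gt0.
have Y0 : 0 < Y by rewrite /Y addr_gt0// ltr_wpDr.
have Am_m : 0 < Am / m by exact: divr_gt0.
exists (Am / m * Ex%:R), (Am / m * Y + 2 * Q * Ca); split.
  by rewrite mulr_gt0// ltr0n /Ex addnS.
split.
  apply: addr_gt0; rewrite mulr_gt0// mulr_gt0//.
  exact: lt_le_trans Q2.
move=> rho x rho0; set V := _ * _ + _.
apply: contrapT => no.
have cap0 : cap T ap 0 = ap 0 by rewrite /cap clamp_id// lexx.
have big t : V <= (\int[mu]_(th in `[(- rho)%R, rho])
    Im (a p.-1 (clamp T t) (x + p%:R * cap T ap 0 * th)%R))%R.
  rewrite cap0; apply: ltW; rewrite ltNge; apply/negP => le; apply: no.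
  by exists (clamp T t) => //; exact: clamp_itv.
have ln0 : 0 <= ln (1 + rho) by rewrite ln_ge0// lerDl ltW.
have l0 : 0 <= Am / m * Ex%:R * ln (1 + rho).
  by apply: mulr_ge0 => //; apply: mulr_ge0; [exact: ltW|exact: ler0n].
have [Qrho|rhoQ] := leP Q rho; last first.
  have := le_trans (big 0) (average_le hp hT ha (p%:R * cap T ap 0) x (hCa pp (leq0n _) 0) rho0).
  rewrite leNgt => /negP; apply.
  apply: (@lt_le_trans _ _ (2 * Q * Ca)); first by rewrite ltr_pM2r// ltr_pM2l.
  by rewrite /V addrA lerDr addr_ge0// mulr_ge0// ltW.
have : Q <= rho := Qrho.
rewrite /Q !ge_max => /and3P[r2 /andP[r3 r4] /and3P[r5 r6 r7]].
have mV : m / Am * V = Ex%:R * ln (1 + rho) + Y + m / Am * (2 * Q * Ca).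
  by rewrite /V; field; rewrite !gt_eqF.
have e0 : 0 <= m / Am * (2 * Q * Ca).
  apply: mulr_ge0; first by rewrite divr_ge0// ltW.
  by rewrite !mulr_ge0 ?(ltW Ca0)// (le_trans _ Q2).
apply: (@no_large_average rho V x) => //.
- by rewrite [leRHS]mulrC -ler_pdivrMr.
- by rewrite [leRHS]mulrC -ler_pdivrMr ?mul1r.
- by rewrite [leRHS]mulrC -ler_pdivrMr.
- by rewrite [leRHS]mulrC -ler_pdivrMr.
- rewrite mV; apply: (@le_trans _ _ Y); first by rewrite lerDl ltW.
  by rewrite addrAC lerDr addr_ge0// mulr_ge0.
- rewrite mV -addrA -[leRHS]addrA lerD2l; apply: (@le_trans _ _ Y).
    by rewrite (_ : Y = 1 + (C2 + 2 * B / K1)) ?lerDr// /Y addrA.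
  by rewrite lerDl.
Qed.

End Contradiction.

Section Main.
Variable R : realType.
Local Notation mu := (@lebesgue_measure R).

Lemma well_posed_average_bound (p : nat) (T m : R) (ap : R -> R) (a : nat -> R -> R -> R[i]) :
  (2 <= p)%N -> 0 < T -> {within `[0, T], continuous ap} ->
  (forall j, (j < p)%N -> C0T T (@Binf R) (@Bnorm R) (a j)) ->
  0 < m -> (forall t : R, 0 <= t <= T -> m <= `|ap t|) -> well_posed p T ap a ->
  exists M N : R, 0 < M /\ 0 < N /\ forall rho x : R, 0 < rho ->
    exists2 t, 0 <= t <= T &
      (\int[mu]_(th in `[(- rho)%R, rho])
        Im (a p.-1 t (x + p%:R * ap 0 * th)%R))%R <= M * ln (1 + rho) + N.
Proof.
move=> hp hT hap ha hm hapm hwp.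
have T0 := ltW hT.
have [r [delta [delta0 apriori]]] := well_posed_a_priori_bound hwp.
pose Nm := ((6 * r + 6 * p + 4).+1 * p.+1)%N.
have [B B1 hB] : exists2 B : R, 1 <= B & forall i x, (i <= Nm)%N ->
    normc (iter i cder (fun y => (bump y)%:C) x) <= B.
  have far x : 1 < `|x - 0| -> (bump x)%:C = 0 :> R[i].
    by rewrite subr0 => x1; rewrite bump_eq0// ltW.
  have ct : ctest (fun y : R => (bump y)%:C).
    split; first exact: csmooth_bump.
    by exists 1 => x x1; apply: far; rewrite subr0.
  have [B _ hB] := ctest_derivatives_bounded Nm ct far.
  exists (Num.max 1 B); first by rewrite le_max lexx.
  by move=> i x iN; rewrite le_max hB ?orbT.
have [Ca Ca1 hCa] := coefs_bounded hT ha Nm.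
have [Am hAm] := cap_bounded hT hap.
have hcap t : m <= `|cap T ap t| by apply: hapm; exact: clamp_itv.
exact: (average_bound hp hT hap ha hm hcap apriori delta0 B1 hB Ca1 hCa hAm).
Qed.

End Main.

Theorem theorem1p1 (R : realType) (p : nat) (T m : R)
  (ap : R -> R) (a : nat -> R -> R -> R[i])
  (hp : (2 <= p)%N) (hT : 0 < T)
  (hap : {within `[0, T], continuous ap})
  (ha : forall j, (j < p)%N -> C0T T (@Binf R) (@Bnorm R) (a j))
  (hm : 0 < m) (hapm : forall t : R, 0 <= t <= T -> m <= `|ap t|)
  (hwp : well_posed p T ap a) :
  exists M N : R, 0 < M /\ 0 < N /\
    forall rho : R, 0 < rho ->
      (ereal_sup (range (fun x : R =>
         ereal_inf [set
           (\int[@lebesgue_measure R]_(theta in `[(- rho)%R, rho])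
              complex.Im (a p.-1 q.2 (x + p%:R * ap q.1 * theta)))%R%:E
           | q in [set q : R * R | 0 <= q.1 /\ q.1 <= q.2 /\ q.2 <= T]%R]))
       <= (M * ln (1 + rho) + N)%:E)%E.
Proof.
have [M [N [M0 [N0 H]]]] := well_posed_average_bound hp hT hap ha hm hapm hwp.
exists M, N; split=> //; split=> // rho rho0.
apply: ge_ereal_sup => _ [x _ <-].
have [t /andP[t0 tT] ht] := H rho x rho0.
apply: (@le_trans _ _ (\int[@lebesgue_measure R]_(th in `[(- rho)%R, rho])
        complex.Im (a p.-1 t (x + p%:R * ap 0 * th)%R))%R%:E).
  by apply: ereal_inf_lbound; exists (0, t).
by rewrite lee_fin.
Qed.
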